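(* Consider the one-dimensional vectorial Deffuant model with $F$ issues and confidence threshold $\theta$, where $F = \theta + 1$, started from the uniform product measure, i.e. the initial opinions $\eta_0(x)$, $x \in \mathbb{Z}$, are independent and uniformly distributed on $\{0,1\}^F$. Then the system clusters: $\lim_{t \to \infty} P(\eta_t(x) = \eta_t(y)) = 1$ for all $x, y \in \mathbb{Z}$.
   Context: $F \geq 2$ and $\theta \geq 1$ are integers. The opinion set is $\Gamma = \{0,1\}^F$ with Hamming distance $H(u,v) = \#\{i : u_i \neq v_i\}$. The vectorial Deffuant model on $\mathbb{Z}$ is the continuous-time Markov process $(\eta_t)_{t \geq 0}$, $\eta_t : \mathbb{Z} \to \Gamma$, with the following dynamics: independently at rate one, each vertex $x$ chooses one of its two nearest neighbors $y \in \{x-1,x+1\}$ uniformly at random; if $1 \leq H(\eta(x),\eta(y)) \leq \theta$, an issue $i$ is chosen uniformly at random among those with $\eta(x)_i \neq \eta(y)_i$ and the $i$-th coordinate of $\eta(x)$ is set equal to $\eta(y)_i$ (all else unchanged); otherwise nothing happens. (Equivalently, the opinion at $x$ is replaced by a uniformly chosen $u \in \Gamma$ with $H(u,\eta(y)) = H(\eta(x),\eta(y)) - 1$.) *)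

(* Defs.v *)
From HB Require Import structures.
From mathcomp Require Import all_boot all_order all_algebra all_fingroup.
From mathcomp Require Import all_classical all_reals all_analysis.
Set Implicit Arguments. Unset Strict Implicit. Unset Printing Implicit Defensive.
Import Order.TTheory GRing.Theory Num.Theory.
Import numFieldNormedType.Exports.
Local Open Scope classical_set_scope.
Local Open Scope ring_scope.

Definition opinion (F : nat) := {ffun 'I_F -> bool}.

Definition hamming (F : nat) (u v : opinion F) : nat := #|[set i | u i != v i]|.

(** Issue selection.  [s : {perm 'I_F}] assigns a rank to each issue; the
    selected issue is the disagreeing issue of smallest rank.  When [s] is a
    uniform random permutation this issue is uniform among the disagreeing
    issues (this is how the "uniform choice of a disagreeing issue" is
    realized in the graphical construction). *)
Definition pick_issue (F : nat) (s : {perm 'I_F}) (u v : opinion F) : option 'I_F :=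
  [pick i | (u i != v i) && [forall k, (u k != v k) ==> (s i <= s k)%N]].

Definition deff_update (F theta : nat) (s : {perm 'I_F}) (u v : opinion F) : opinion F :=
  if (1 <= hamming u v <= theta)%N then
    match pick_issue s u v with
    | Some i => [ffun j => if j == i then v j else u j]
    | None => u
    end
  else u.

Definition nbr (b : bool) (x : int) : int := if b then x + 1 else x - 1.

Definition mutually_independent {d} {Omega : measurableType d} {R : realType}
    (P : probability Omega R) {I : Type} (C : I -> set (set Omega)) : Prop :=
  forall (n : nat) (f : 'I_n -> I), injective f ->
  forall E : 'I_n -> set Omega, (forall k, C (f k) (E k)) ->
  P (\bigcap_(k in [set: 'I_n]) E k) = (\prod_(k < n) P (E k))%E.

Inductive mark :=
| MInit of int
| MTime of int & nat    (* n-th inter-arrival time of the rate-1 clock of x *)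
| MDir of int & nat     (* neighbour chosen at the (n+1)-th ring of x *)
| MRank of int & nat.   (* issue ranking used at the (n+1)-th ring of x *)

Section Graphical.
Context {R : realType} {d : measure_display} {Omega : measurableType d}.
Variable F : nat.
Variable eta0 : int -> Omega -> opinion F.
Variable tau : int -> nat -> Omega -> R.
Variable dir : int -> nat -> Omega -> bool.
Variable rk : int -> nat -> Omega -> {perm 'I_F}.

Definition mark_events (i : mark) : set (set Omega) :=
  match i with
  | MInit x => [set eta0 x @^-1` [set u] | u in [set: opinion F]]
  | MTime x n => [set tau x n @^-1` B | B in [set B : set R | measurable B]]
  | MDir x n => [set dir x n @^-1` [set b] | b in [set: bool]]
  | MRank x n => [set rk x n @^-1` [set s] | s in [set: {perm 'I_F}]]
  end.

Definition graphical_marks (P : probability Omega R) : Prop :=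
  [/\ (forall x u, measurable (eta0 x @^-1` [set u]) /\
                   P (eta0 x @^-1` [set u]) = ((2 ^+ F)%:R^-1)%:E),
      (forall x n, measurable_fun [set: Omega] (tau x n) /\
         forall s : R, 0 <= s -> P [set w | s < tau x n w] = (expR (- s))%:E),
      (forall x n b, measurable (dir x n @^-1` [set b]) /\
                     P (dir x n @^-1` [set b]) = (2%:R^-1)%:E),
      (forall x n s, measurable (rk x n @^-1` [set s]) /\
                     P (rk x n @^-1` [set s]) = ((F`!)%:R^-1)%:E)
    & mutually_independent P mark_events].

Definition evtime (x : int) (n : nat) (w : Omega) : R := \sum_(k < n) tau x k w.

(** [deffuant_path theta w eta]: the trajectory [eta : R -> int -> opinion F]
    is the one produced by the graphical construction from the marks at w:
    it starts from eta0, the opinion at x only changes at the rings of the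
    clock of x, and at the (n+1)-th ring x looks at the neighbour y chosen by
    [dir x n] and performs the Deffuant update using the opinions just
    before the ring (left limits). *)
Definition deffuant_path (theta : nat) (w : Omega) (eta : R -> int -> opinion F) : Prop :=
  [/\ forall x, eta 0 x = eta0 x w,
      forall x n t, evtime x n w <= t < evtime x n.+1 w ->
                    eta t x = eta (evtime x n w) x
    & forall x n m, let y := nbr (dir x n w) x in
        evtime y m w < evtime x n.+1 w <= evtime y m.+1 w ->
        eta (evtime x n.+1 w) x =
          deff_update theta (rk x n w) (eta (evtime x n w) x) (eta (evtime y m w) y)].

End Graphical.

(* Main.v *)
(** Each coordinate on which neighbours disagree is a particle on the edge between them. A move
carries a particle across a site or annihilates two particles of the same level, so by translation
invariance the expected number of particles per edge decreases, and the decrease pays for all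
annihilations. Hence a configuration of a finite window from which finitely many moves force an
annihilation has probability tending to 0. Since F = theta + 1, an edge is blocked only when it
carries a particle at every level.

Blocked edges disappear: if the opinion at the origin stayed fixed forever with positive probability,
then, by mixing and by invariance under flipping coordinates, two distant sites would be frozen with
opinions neither equal nor complementary. Some edge between them is then active, and moving one of
its particles towards the frozen site gives an annihilation or changes the frozen opinion. So every
opinion keeps changing, and a blocked edge can only be freed by an annihilation.

Without blocked edges two particles of the same level can be moved together, so two given edges
simultaneously carry one with probability tending to 0. As the density of each level is the same at
all edges, it tends to 0, and so does the probability that two given sites disagree.

All events are compared with those of the dynamics in a finite box, which depends on finitely many
marks and agrees with the infinite system up to a probability that vanishes as the box grows. *)
Require Import Defs.
From HB Require Import structures.
From mathcomp Require Import all_boot all_order all_algebra all_fingroup.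
From mathcomp Require Import all_classical all_reals all_analysis.
From mathcomp Require Import measurable_realfun.
From mathcomp Require Import ring lra zify.
Set Implicit Arguments. Unset Strict Implicit. Unset Printing Implicit Defensive.
Import Order.TTheory GRing.Theory Num.Theory.
Import numFieldNormedType.Exports.
Local Open Scope classical_set_scope.
Local Open Scope ring_scope.

(** The process is not constructed: [eta] is any measurable family of trajectories obeying the local
    rules. A site whose clock stays silent up to time [T] cuts the line, and between two such sites
    the trajectory is forced to agree with the dynamics of a finite box; for fixed [T] a long enough
    block contains a silent site with probability close to 1. Translation invariance, invariance
    under flips and decorrelation of the trajectory all come from this.

    Time is observed at integers. By the memoryless property, whatever happened up to time [k], a
    prescribed ring is the only one in a window during the next unit of time with probability at
    least a constant depending on the window size. So if a forced move leads to a configuration of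
    vanishing probability, the configuration before the move has vanishing probability too, and this
    propagates backwards along finitely many moves.

    Equal and opposite opinions are set aside in the freezing argument because a chain of empty and
    blocked edges can join only such opinions; [F >= 2] supplies opinions of a third kind. *)

Section RealProbability.
Context {R : realType} {d : measure_display} {T : measurableType d}.
Variable P : probability T R.

(** * Real-valued probabilities and comparison of events *)

Definition pr (A : set T) : R := fine (P A).

Lemma prE A : measurable A -> P A = (pr A)%:E.
Proof. by move=> mA; rewrite /pr fineK// fin_num_measure. Qed.

Lemma pr_ge0 A : 0 <= pr A.
Proof. exact: fine_ge0. Qed.

Lemma pr0 : pr set0 = 0.
Proof. by rewrite /pr measure0. Qed.

Lemma prT : pr setT = 1.
Proof. by rewrite /pr probability_setT. Qed.

Lemma pr_le A B : measurable A -> measurable B -> A `<=` B -> pr A <= pr B.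
Proof.
by move=> mA mB AB; rewrite -lee_fin -!prE//; apply: le_measure; rewrite ?inE.
Qed.

Lemma pr_le1 A : measurable A -> pr A <= 1.
Proof. by move=> mA; rewrite -prT; apply: pr_le. Qed.

Lemma prU A B : measurable A -> measurable B -> A `&` B = set0 ->
  pr (A `|` B) = pr A + pr B.
Proof.
move=> mA mB AB; apply: EFin_inj; rewrite EFinD -!prE ?measureU//.
exact: measurableU.
Qed.

Lemma prID A B : measurable A -> measurable B ->
  pr A = pr (A `&` B) + pr (A `\` B).
Proof.
move=> mA mB; rewrite -prU ?setUIDK//; [exact: measurableI|exact: measurableD|].
by rewrite setDE setIACA setICr setI0.
Qed.

Lemma prC A : measurable A -> pr (~` A) = 1 - pr A.
Proof.
move=> mA; have := prID measurableT mA; rewrite prT setTI setTD => ->; ring.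
Qed.

Lemma prU_le A B : measurable A -> measurable B -> pr (A `|` B) <= pr A + pr B.
Proof.
move=> mA mB; rewrite -lee_fin EFinD -!prE ?measureU2//; exact: measurableU.
Qed.

Lemma pr_bigU_le (I : Type) (s : seq I) (Q : pred I) (F : I -> set T) :
  (forall i, measurable (F i)) ->
  pr (\big[setU/set0]_(i <- s | Q i) F i) <= \sum_(i <- s | Q i) pr (F i).
Proof.
move=> mF; elim: s => [|i s IH]; first by rewrite !big_nil pr0.
rewrite !big_cons; case: ifP => // _.
by rewrite (le_trans (prU_le _ _))// ?lerD2l//; apply: bigsetU_measurable.
Qed.

Lemma pr_le_ae A B N : measurable A -> measurable B -> measurable N ->
  pr N = 0 -> A `<=` B `|` N -> pr A <= pr B.
Proof.
move=> mA mB mN N0 AB; have := prU_le mB mN; rewrite N0 addr0.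
by apply: le_trans; apply: pr_le => //; exact: measurableU.
Qed.

Lemma pr_eq_ae A B N : measurable A -> measurable B -> measurable N ->
  pr N = 0 -> A `<=` B `|` N -> B `<=` A `|` N -> pr A = pr B.
Proof.
by move=> *; apply/eqP; rewrite eq_le (pr_le_ae (N := N))// (pr_le_ae (N := N)).
Qed.

Lemma pr_bigcup (F : (set T)^nat) : (forall n, measurable (F n)) ->
  trivIset setT F -> (fun n => \sum_(0 <= k < n) pr (F k)) @ \oo --> pr (\bigcup_n F n).
Proof.
move=> mF tF; have h : (fun n => \sum_(0 <= k < n) P (F k))%E @ \oo --> P (\bigcup_n F n).
  by apply: measure_semi_sigma_additive => //; exact: bigcupT_measurable.
move: h; rewrite prE; last exact: bigcupT_measurable.
move/fine_cvgP => [_]; apply: cvg_trans.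
apply: near_eq_cvg; near=> n => /=.
by rewrite (eq_bigr (fun k => (pr (F k))%:E)) ?sumEFin// => k _; exact: prE.
Unshelve. all: by end_near. Qed.

Lemma pr_bigcup0 (F : (set T)^nat) : (forall n, measurable (F n)) ->
  (forall n, pr (F n) = 0) -> pr (\bigcup_n F n) = 0.
Proof.
move=> mF F0; have : P.-negligible (\bigcup_n F n).
  apply: negligible_bigcup => n; apply/negligibleP; first exact: mF.
  by have := prE (mF n); rewrite F0.
move/negligibleP => /(_ (bigcupT_measurable _ mF)) h.
by rewrite /pr; apply: EFin_inj; rewrite [X in fine X]h.
Qed.

Lemma pr_nondecr (F : (set T)^nat) : (forall n, measurable (F n)) ->
  (forall n, F n `<=` F n.+1) -> (fun n => pr (F n)) @ \oo --> pr (\bigcup_n F n).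
Proof.
move=> mF incF.
have ndF : {homo F : n m / (n <= m)%N >-> (n <= m)%O}.
  by apply/nondecreasing_seqP => n; apply/subsetPset.
have h : (P \o F) @ \oo --> P (\bigcup_n F n).
  by apply: nondecreasing_cvg_mu => //; exact: bigcupT_measurable.
move: h; rewrite prE; last exact: bigcupT_measurable.
by move/fine_cvgP => [_].
Qed.

Lemma pr_bigcap0 (F : (set T)^nat) (u : nat -> R) A : measurable A ->
  (forall n, measurable (F n)) -> (forall n, A `<=` F n) ->
  (forall n, pr (F n) <= u n) -> u @ \oo --> (0 : R) -> pr A = 0.
Proof.
move=> mA mF AF Fu u0; apply/eqP; rewrite eq_le pr_ge0 andbT.
apply: (cvgr_to_ge u0); near=> n.
by rewrite (le_trans _ (Fu n))// pr_le.
Unshelve. all: by end_near. Qed.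

(** A lower bound on conditional probabilities passes from the pieces to the union; the pieces will
    be indexed by words of past rings. The index type is enumerated through [pickle], and integers
    that code nothing give the empty set. *)
Lemma pr_countable_partition (C : countType) (E E' : C -> set T) (c : R) :
  (forall w, measurable (E w)) -> (forall w, measurable (E' w)) ->
  (forall w1 w2, w1 != w2 -> E w1 `&` E w2 = set0) ->
  (forall w1 w2, w1 != w2 -> E' w1 `&` E' w2 = set0) ->
  (forall w, c * pr (E w) <= pr (E' w)) ->
  c * pr (\bigcup_w E w) <= pr (\bigcup_w E' w).
Proof.
move=> mE mE' dE dE' EE'.
pose G (H : C -> set T) n := if @pickle_inv C n is Some w then H w else set0.
have GU H : \bigcup_w H w = \bigcup_n G H n.
  apply/seteqP; split=> x [w _ Hx].
    by exists (pickle w) => //; rewrite /G pickleK_inv.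
  by move: Hx; rewrite /G; case: pickle_inv => // v Hv; exists v.
have GM H : (forall w, measurable (H w)) -> forall n, measurable (G H n).
  by move=> mH n; rewrite /G; case: pickle_inv.
have GD H : (forall w1 w2, w1 != w2 -> H w1 `&` H w2 = set0) -> trivIset setT (G H).
  move=> dH; apply/trivIsetP => i j _ _ ij; rewrite /G.
  case Ei : (pickle_inv i) => [w|]; case Ej : (pickle_inv j) => [v|];
    rewrite ?set0I ?setI0//.
  apply: dH; apply: contra ij => /eqP wv.
  have := @pickle_invK C i; have := @pickle_invK C j; rewrite /oapp Ei Ej wv.
  by move=> -> ->.
rewrite !GU.
have h1 := pr_bigcup (GM _ mE) (GD _ dE).
have h2 := pr_bigcup (GM _ mE') (GD _ dE').
have h3 : (fun n => c * \sum_(0 <= k < n) pr (G E k)) @ \oo --> c * pr (\bigcup_n G E n).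
  exact: cvgMl_tmp.
apply: (ler_cvg_to h3 h2); near=> n.
rewrite mulr_sumr ler_sum// => k _; rewrite /G; case: pickle_inv => //.
by rewrite pr0 mulr0.
Unshelve. all: by end_near. Qed.

(** Integration of a pointwise inequality between counts: it turns the bookkeeping of disagreements
    in one realization into an inequality between expectations. *)
Lemma pr_sum_indic (I J : Type) (s : seq I) (t : seq J) (A : I -> set T)
    (B : J -> set T) (N : set T) :
  (forall i, measurable (A i)) -> (forall j, measurable (B j)) ->
  measurable N -> pr N = 0 ->
  (forall x, ~ N x -> \sum_(i <- s) (x \in A i : nat) <=
                      \sum_(j <- t) (x \in B j : nat))%N ->
  \sum_(i <- s) pr (A i) <= \sum_(j <- t) pr (B j).
Proof.
move=> mA mB mN N0 AB.
have iE (K : Type) (r : seq K) (C : K -> set T) : (forall k, measurable (C k)) ->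
    (\int[P]_x (\sum_(k <- r) (x \in C k : nat))%:R%:E)%E = (\sum_(k <- r) pr (C k))%:E.
  move=> mC.
  transitivity (\int[P]_x (\sum_(k <- r) (\1_(C k) x)%:E))%E.
    by apply: eq_integral => x _; rewrite natr_sum -sumEFin.
  have mI k : measurable_fun setT (fun x => (\1_(C k) x)%:E : \bar R).
    by apply/measurable_EFinP; exact: measurable_indic.
  have I0 k x : setT x -> (0 <= (\1_(C k) x)%:E :> \bar R)%E by rewrite lee_fin.
  rewrite (ge0_integral_sum P measurableT mI I0)//.
  rewrite -sumEFin; apply: eq_bigr => k _.
  by rewrite -prE// -[X in P X]setIT -integral_indic.
rewrite -lee_fin -!iE//; apply: ae_ge0_le_integral => //.
- apply/measurable_EFinP; under eq_fun do rewrite natr_sum.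
  by apply: measurable_sum => k; exact: measurable_indic.
- apply/measurable_EFinP; under eq_fun do rewrite natr_sum.
  by apply: measurable_sum => k; exact: measurable_indic.
- exists N; split => //; first by have := prE mN; rewrite N0.
  move=> x /= xn; apply: contrapT => /AB h; apply: xn => _.
  by rewrite lee_fin ler_nat.
Qed.

End RealProbability.

(** * Events depending on a set of coordinates: independence and invariance *)

Section ProductSigma.
Context {R : realType} {I : choiceType}.
Implicit Types (J : set I) (B : I -> set R).

(** The carrier is always the full space [I -> R]; only the sigma-algebra varies with [J]. That an
    event depends on the marks in [J] alone is expressed by its measurability for this
    sigma-algebra, so events about different sets of marks can be intersected directly. *)
Definition coord_gen J : set (set (I -> R)) :=
  [set A | exists i, exists2 B : set R, J i /\ measurable B & A = [set w | B (w i)]].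

Definition cylinder_gen J : set (set (I -> R)) :=
  [set A | exists B, exists2 s : seq I, (forall i, measurable (B i)) &
    [/\ uniq s, (forall i, i \in s -> J i) &
     A = [set w | forall i, i \in s -> B i (w i)]]].

Local Notation pspace J := (g_sigma_algebraType (coord_gen J)).

Lemma coord_measurable J i (B : set R) : J i -> measurable B ->
  measurable ([set w | B (w i)] : set (pspace J)).
Proof. by move=> Ji mB; apply: sub_sigma_algebra; exists i, B. Qed.

Lemma measurable_coord J i : J i ->
  measurable_fun setT (fun w : pspace J => w i : R).
Proof. by move=> Ji _ B mB; rewrite setTI; exact: coord_measurable. Qed.

Lemma measurable_coords J (s : seq I) B : (forall i, measurable (B i)) ->
  (forall i, i \in s -> J i) ->
  measurable ([set w | forall i, i \in s -> B i (w i)] : set (pspace J)).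
Proof.
move=> mB; elim: s => [|a s IH] sJ.
  by rewrite (_ : [set _ | _] = setT)//; apply/seteqP; split.
rewrite (_ : [set _ | _] = [set w | B a (w a)] `&`
   [set w | forall i, i \in s -> B i (w i)]); last first.
  apply/seteqP; split=> w /=.
    by move=> h; split=> [|i si]; apply: h; rewrite inE ?eqxx// si orbT.
  by move=> [h1 h2] i; rewrite inE => /predU1P[->//|]; exact: h2.
apply: measurableI; first by apply: coord_measurable => //; exact/sJ/mem_head.
by apply: IH => i si; apply: sJ; rewrite inE si orbT.
Qed.

Lemma cylinder_genE J : <<s coord_gen J >> = <<s cylinder_gen J >>.
Proof.
apply/seteqP; split; (apply: smallest_sub; [exact: smallest_sigma_algebra|]).
- move=> _ [i [B [Ji mB] ->]]; apply: sub_sigma_algebra.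
  exists (fun=> B), [:: i] => //; split => //.
    by move=> j; rewrite inE => /eqP ->.
  apply/seteqP; split=> w /=; first by move=> h j; rewrite inE => /eqP->.
  by apply; rewrite inE.
- by move=> _ [B [s mB [us sJ ->]]]; exact: measurable_coords.
Qed.

Lemma cylinder_genI J : setI_closed (cylinder_gen J).
Proof.
move=> _ _ [B1 [s1 mB1 [u1 sJ1 ->]]] [B2 [s2 mB2 [u2 sJ2 ->]]].
exists (fun i => (if i \in s1 then B1 i else setT) `&` (if i \in s2 then B2 i else setT)).
exists (undup (s1 ++ s2)).
  by move=> i; apply: measurableI; case: ifP.
split; first exact: undup_uniq.
  by move=> i; rewrite mem_undup mem_cat => /orP[/sJ1|/sJ2].
apply/seteqP; split=> w /=.
  by move=> [h1 h2] i _; split; [case: ifP => // /h1|case: ifP => // /h2].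
by move=> h; split=> i si; have := h i; rewrite mem_undup mem_cat si ?orbT/= => /(_ isT)[].
Qed.

Lemma sub_space J1 J2 (A : set (I -> R)) : J1 `<=` J2 ->
  measurable (A : set (pspace J1)) -> measurable (A : set (pspace J2)).
Proof.
move=> J12; apply: sub_sigma_algebra2 => _ [i [B [Ji mB] ->]].
by exists i, B => //; split => //; exact: J12.
Qed.

Lemma measurable_sub_space J1 J2 d (U : measurableType d) (f : (I -> R) -> U) :
  J1 `<=` J2 -> measurable_fun setT (f : pspace J1 -> U) ->
  measurable_fun setT (f : pspace J2 -> U).
Proof.
move=> J12 mf _ B mB; rewrite setTI; apply: (sub_space J12).
by rewrite -[X in measurable X]setTI; exact: mf.
Qed.

Lemma measurable_to_space d (U : measurableType d) J (g : U -> pspace J) :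
  (forall i, J i -> measurable_fun setT (fun w => g w i : R)) ->
  measurable_fun setT g.
Proof.
move=> mg; apply: (@measurability _ _ U (pspace J) setT g (coord_gen J)) => //.
move=> _ [_ [i [B [Ji mB] ->]] <-].
by have := mg i Ji measurableT B mB.
Qed.

Variable mu : probability (pspace setT) R.
Hypothesis mu_indep : forall (s : seq I) B, uniq s -> (forall i, measurable (B i)) ->
  pr mu [set w | forall i, i \in s -> B i (w i)] =
  \prod_(i <- s) pr mu [set w | B i (w i)].

Let mT (J : set I) (A : set (I -> R)) : measurable (A : set (pspace J)) ->
  measurable (A : set (pspace setT)).
Proof. exact: sub_space. Qed.

Lemma cylinder_indep J1 J2 (A1 A2 : set (I -> R)) : J1 `&` J2 = set0 ->
  cylinder_gen J1 A1 -> cylinder_gen J2 A2 -> pr mu (A1 `&` A2) = pr mu A1 * pr mu A2.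
Proof.
move=> J12 [B1 [s1 mB1 [u1 sJ1 ->]]] [B2 [s2 mB2 [u2 sJ2 ->]]].
have dis i : i \in s1 -> i \in s2 -> False.
  move=> /sJ1 h1 /sJ2 h2; have : (J1 `&` J2) i by [].
  by rewrite J12.
have mB i : measurable ((if i \in s1 then B1 i else B2 i) : set R) by case: ifP.
transitivity (pr mu [set w | forall i, i \in s1 ++ s2 ->
    (if i \in s1 then B1 i else B2 i) (w i)]).
  congr (pr mu _); apply/seteqP; split=> w /=.
    by move=> [h1 h2] i; rewrite mem_cat; case: ifP => [/h1//|_ /= /h2].
  move=> h; split=> i si; have := h i; rewrite mem_cat si ?orbT/= => /(_ isT)//.
  by case: ifP => // /dis /(_ si).
rewrite (mu_indep _ mB); last first.
  rewrite cat_uniq u1 u2 andbT/=; apply/hasPn => i h2.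
  by apply/negP => h1; exact: (dis i h1 h2).
rewrite big_cat/= !mu_indep//; congr (_ * _); apply: eq_big_seq => i si; rewrite ?si//.
by case: ifP => // /dis /(_ si).
Qed.

Lemma space_ind J (Q : set (I -> R) -> Prop) : Q setT ->
  (forall A, cylinder_gen J A -> Q A) ->
  (forall A, measurable (A : set (pspace J)) -> Q A -> Q (~` A)) ->
  (forall F : (set (I -> R))^nat, (forall n, measurable (F n : set (pspace J))) ->
     trivIset setT F -> (forall n, Q (F n)) -> Q (\bigcup_k F k)) ->
  forall A, measurable (A : set (pspace J)) -> Q A.
Proof.
move=> QT Qcyl QC QU A mA.
apply: (@dynkin_induction _ (pspace J) (cylinder_gen J) Q) => //.
- exact: cylinder_genE.
- exact: cylinder_genI.
- by rewrite -cylinder_genE.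
Qed.

(** Independence is extended from cylinders to the sigma-algebra in one factor while the other is
    fixed; a second use exchanges the roles. *)
Let indep_aux J (A2 : set (I -> R)) : measurable (A2 : set (pspace setT)) ->
  (forall A, cylinder_gen J A -> pr mu (A `&` A2) = pr mu A * pr mu A2) ->
  forall A, measurable (A : set (pspace J)) -> pr mu (A `&` A2) = pr mu A * pr mu A2.
Proof.
move=> mA2 h; apply: space_ind => //.
- by rewrite setTI prT mul1r.
- move=> A /mT mA IH; rewrite prC// mulrBl mul1r -IH.
  rewrite (prID (A := A2) mu mA2 mA) [A2 `&` A]setIC addrC addKr.
  by rewrite setDE setIC.
- move=> F mF tF IH; rewrite setI_bigcupl.
  have mF' n := mT (mF n).
  have c1 : (fun n => \sum_(0 <= k < n) pr mu (F k `&` A2)) @ \oo --> pr mu (\bigcup_k (F k `&` A2)).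
    apply: (@pr_bigcup _ _ (pspace setT)); first by move=> n; exact: measurableI.
    apply/trivIsetP => i j _ _ ij; rewrite setIACA.
    by move/trivIsetP : tF => /(_ i j Logic.I Logic.I ij) ->; rewrite set0I.
  have c2 := cvgMr_tmp (FF := eventually_filter) (b := pr mu A2)
    (@pr_bigcup _ _ (pspace setT) mu _ mF' tF).
  have e : (fun n => \sum_(0 <= k < n) pr mu (F k `&` A2)) =
           (fun n => (\sum_(0 <= k < n) pr mu (F k)) * pr mu A2).
    by apply/funext => n; rewrite mulr_suml; apply: eq_bigr => i _; rewrite IH.
  by move: c1; rewrite e => c1; exact: (cvg_unique (@Rhausdorff R) c1 c2).
Qed.

Lemma space_indep J1 J2 (A1 A2 : set (I -> R)) : J1 `&` J2 = set0 ->
  measurable (A1 : set (pspace J1)) -> measurable (A2 : set (pspace J2)) ->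
  pr mu (A1 `&` A2) = pr mu A1 * pr mu A2.
Proof.
move=> J12 mA1 mA2; move: (A1) mA1; apply: indep_aux; first exact: (mT mA2).
move=> A cA.
have mA : measurable (A : set (pspace J1)).
  by case: cA => B [s mB [_ sJ ->]]; exact: measurable_coords.
rewrite setIC mulrC; move: (A2) mA2; apply: indep_aux; first exact: (mT mA).
by move=> C cC; apply: cylinder_indep cC cA; rewrite setIC.
Qed.

(** Covers both symmetries: for translations [g] is the identity and [sigma] moves the sites, for
    flips [sigma] is the identity and [g] acts on the initial marks. *)
Lemma space_law_eq (sigma : I -> I) (g : I -> R -> R) : injective sigma ->
  (forall i, measurable_fun setT (g i)) ->
  (forall i (B : set R), measurable B ->
     pr mu [set w | B (g i (w (sigma i)))] = pr mu [set w | B (w i)]) ->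
  forall A : set (I -> R), measurable (A : set (pspace setT)) ->
    pr mu ((fun w i => g i (w (sigma i))) @^-1` A) = pr mu A.
Proof.
move=> inj mg law.
pose G : pspace setT -> pspace setT := fun w i => g i (w (sigma i)).
have mG : measurable_fun setT G.
  by apply: measurable_to_space => i _; apply: measurableT_comp => //; exact: measurable_coord.
have mpre (A : set (I -> R)) : measurable (A : set (pspace setT)) ->
    measurable (G @^-1` A : set (pspace setT)).
  by move=> mA; rewrite -[X in measurable X]setTI; exact: mG.
apply: (@space_ind setT).
- by rewrite preimage_setT.
- move=> _ [B [s mB [us _ ->]]].
  have mgB i : measurable (g i @^-1` B i).
    by rewrite -[X in measurable X]setTI; exact: mg.
  (* The constraint transported to coordinate [j]: injectivity of [sigma] leaves at most one term,
     and writing an intersection spares an inverse of [sigma]. *)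
  pose B' j := \bigcap_(i in [set i | i \in s /\ sigma i = j]) (g i @^-1` B i).
  have mB' j : measurable (B' j).
    apply: fin_bigcap_measurable => //.
    apply: (sub_finite_set (B := [set` s])) => //; first by move=> i [].
  rewrite mu_indep//.
  transitivity (pr mu [set w | forall j, j \in map sigma s -> B' j (w j)]).
    congr (pr mu _); apply/seteqP; split=> w /= h.
      by move=> _ /mapP[i si ->] k [ks /inj kE]; rewrite /= kE; exact: h.
    by move=> i si; have := h (sigma i) (map_f _ si) i; apply.
  rewrite mu_indep ?map_inj_uniq// big_map; apply: eq_big_seq => i si.
  rewrite -(law i (B i))//.
  congr (pr mu _); apply/seteqP; split=> w /=.
    by move=> h; apply: (h i).
  by move=> h k [ks /inj ->].
- move=> A mA h; rewrite preimage_setC !(@prC _ _ (pspace setT))// ?h//.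
  exact: mpre.
- move=> F mF tF h; rewrite preimage_bigcup.
  have c1 := @pr_bigcup _ _ (pspace setT) mu _ mF tF.
  have c2 : (fun n => \sum_(0 <= k < n) pr mu (G @^-1` F k)) @ \oo --> pr mu (\bigcup_k (G @^-1` F k)).
    apply: (@pr_bigcup _ _ (pspace setT)); first by move=> n; exact: mpre.
    apply/trivIsetP => i j _ _ ij; rewrite -preimage_setI.
    by move/trivIsetP : tF => /(_ i j Logic.I Logic.I ij) ->; rewrite preimage_set0.
  have e : (fun n => \sum_(0 <= k < n) pr mu (G @^-1` F k)) =
           (fun n => \sum_(0 <= k < n) pr mu (F k)).
    by apply/funext => n; apply: eq_bigr => i _; rewrite h.
  by move: c2; rewrite e => c2; exact: (cvg_unique (@Rhausdorff R) c2 c1).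
Qed.

End ProductSigma.

Notation pspace R J := (g_sigma_algebraType (@coord_gen R _ J)).

(** * The memoryless property at a random threshold read off other marks *)

Section Memoryless.
Context {R : realType} {I : choiceType}.
Variable mu : probability (pspace R [set: I]) R.
Hypothesis mu_indep : forall (s : seq I) (B : I -> set R), uniq s ->
  (forall i, measurable (B i)) ->
  pr mu [set w | forall i, i \in s -> B i (w i)] =
  \prod_(i <- s) pr mu [set w | B i (w i)].
Variables (J : set I) (i : I).
Hypothesis Ji : ~ J i.
Hypothesis exp_i : forall s : R, 0 <= s -> pr mu [set w | s < w i] = expR (- s).
Variables (E : set (I -> R)) (V : (I -> R) -> R).
Hypothesis mE : measurable (E : set (pspace R J)).
Hypothesis mV : measurable_fun setT (V : pspace R J -> R).
Hypothesis V0 : forall w, E w -> 0 <= V w.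

(** [V] is rounded up to the dyadic grid of mesh [2^-m]. On a cell the threshold is a constant, so
    the exponential law applies exactly; as [m] grows the events [G m r] increase to the event with
    threshold [V + r], because the inequality is strict. *)
Let cell m k : set (I -> R) := [set w | E w /\ k%:R <= V w * 2 ^+ m < k.+1%:R].
Let G m (r : R) : set (I -> R) :=
  \bigcup_k (cell m k `&` [set w | k.+1%:R / 2 ^+ m + r < w i]).

Let mcell m k : measurable (cell m k : set (pspace R J)).
Proof.
rewrite (_ : cell m k = E `&` ((fun w => V w * 2 ^+ m) @^-1` `[k%:R, k.+1%:R[)).
  apply: measurableI => //.
  rewrite -[X in measurable X]setTI.
  have : measurable_fun setT (fun w : pspace R J => V w * 2 ^+ m) by exact: measurable_funM.
  by apply.
by apply/seteqP; split=> w /=; rewrite in_itv.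
Qed.

Let mgt (s : R) : measurable ([set w | s < w i] : set (pspace R [set i])).
Proof.
rewrite (_ : [set w | s < w i] = [set w | `]s, +oo[%classic (w i)]).
  by apply: coord_measurable.
by apply/seteqP; split=> w /=; rewrite in_itv/= andbT.
Qed.

Let mgtT (s : R) : measurable ([set w | s < w i] : set (pspace R setT)).
Proof. exact: sub_space (mgt s). Qed.

Let mcellT m k : measurable (cell m k : set (pspace R setT)).
Proof. exact: sub_space (mcell m k). Qed.

Let mG m r : measurable (G m r : set (pspace R setT)).
Proof. by apply: bigcupT_measurable => k; exact: measurableI. Qed.

Let pr_cell m k (s : R) : 0 <= s ->
  pr mu (cell m k `&` [set w | s < w i]) = pr mu (cell m k) * expR (- s).
Proof.
move=> s0; rewrite (space_indep mu_indep (J1 := J) (J2 := [set i])) ?exp_i//.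
by apply/seteqP; split=> // j [/= Jj ji]; apply: Ji; rewrite -ji.
Qed.

Let pr_G m (r : R) : 0 <= r -> pr mu (G m r) = expR (- r) * pr mu (G m 0).
Proof.
move=> r0.
have tr s (F := fun k => cell m k `&` [set w | k.+1%:R / 2 ^+ m + s < w i]) :
    trivIset setT F.
  apply/trivIsetP => a b _ _ ab; apply/seteqP; split=> // w [[[Ew aw] _] [[_ bw] _]] /=.
  have /andP[a1 a2] := aw; have /andP[b1 b2] := bw.
  have := le_lt_trans a1 b2; have := le_lt_trans b1 a2; rewrite !ltr_nat.
  by move: ab; clear; lia.
have cvG s := @pr_bigcup _ _ (pspace R setT) mu _
  (fun k => measurableI _ _ (mcellT m k) (mgtT (k.+1%:R / 2 ^+ m + s))) (tr s).
have c1 := cvgMl_tmp (FF := eventually_filter) (a := expR (- r)) (cvG 0).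
have e : (fun n => \sum_(0 <= k < n) pr mu (cell m k `&` [set w | k.+1%:R / 2 ^+ m + r < w i])) =
  (fun n => expR (- r) * \sum_(0 <= k < n) pr mu (cell m k `&` [set w | k.+1%:R / 2 ^+ m + 0 < w i])).
  apply/funext => n; rewrite mulr_sumr; apply: eq_bigr => k _.
  have k0 : 0 <= k.+1%:R / 2 ^+ m :> R by rewrite divr_ge0// exprn_ge0.
  by rewrite !pr_cell ?addr_ge0// addr0 opprD expRD; ring.
have := cvG r; rewrite e => c2; exact: (cvg_unique (@Rhausdorff R) c2 c1).
Qed.

Let G_incr (r : R) m : G m r `<=` G m.+1 r.
Proof.
move=> w [k _ [[Ew /andP[k1 k2]]] /= kw].
have p0 : 0 < 2 ^+ m :> R by rewrite exprn_gt0.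
(* Cell [k] splits into the cells [2k] and [2k + 1] of the finer grid, whose rounded thresholds are
   no larger. *)
have : (V w * 2 ^+ m.+1 < k.*2.+1%:R) || (k.*2.+1%:R <= V w * 2 ^+ m.+1) by rewrite ltNge orNb.
have V2 : V w * 2 ^+ m.+1 = V w * 2 ^+ m * 2 by rewrite exprS; ring.
have k2E : k.*2%:R = k%:R * 2 :> R by rewrite -muln2 natrM.
have e (x : R) : x / 2 ^+ m.+1 = (x / 2) / 2 ^+ m.
  by rewrite exprS invfM mulrA.
have kSE : k.+1%:R = k%:R + 1 :> R by rewrite -natr1.
have kSE1 : k.*2.+1%:R = k%:R * 2 + 1 :> R by rewrite -natr1 k2E.
have kSE2 : k.*2.+2%:R = k%:R * 2 + 2 :> R by rewrite -natr1 kSE1; ring.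
case/orP => h.
- exists k.*2 => //; split => /=.
    by split => //; apply/andP; split => //; rewrite V2 k2E; lra.
  rewrite (le_lt_trans _ kw)// lerD2r e ler_pM2r ?invr_gt0//.
  by rewrite kSE1 kSE; lra.
- exists k.*2.+1 => //; split => /=.
    by split => //; apply/andP; split => //; rewrite V2 kSE2; move: k2; rewrite kSE; lra.
  rewrite (le_lt_trans _ kw)// lerD2r e ler_pM2r ?invr_gt0//.
  by rewrite kSE2 kSE; lra.
Qed.

Let G_union (r : R) : \bigcup_m G m r = E `&` [set w | V w + r < w i].
Proof.
apply/seteqP; split=> w.
  move=> [m _ [k _ [[Ew /andP[k1 k2]]] /= kw]]; split => //=.
  rewrite (le_lt_trans _ kw)// lerD2r ler_pdivlMr ?exprn_gt0//.
  exact: ltW.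
move=> [Ew /= Vw]; pose e := w i - r - V w.
have e0 : 0 < e by rewrite /e; lra.
have [m me] : exists m, 2 ^- m < e.
  have [m _ /(_ m (leqnn m)) /= h] := near_infty_natSinv_expn_lt (PosNum e0).
  by exists m; rewrite -div1r.
exists m => //; exists (Num.truncn (V w * 2 ^+ m)) => //.
have p0 : 0 < 2 ^+ m :> R by rewrite exprn_gt0.
have /truncn_itv/andP[t1 t2] : 0 <= V w * 2 ^+ m by rewrite mulr_ge0 ?V0// ltW.
split => /=; first by split => //; rewrite t1 t2.
rewrite -natr1 mulrDl div1r.
have : (Num.truncn (V w * 2 ^+ m))%:R / 2 ^+ m <= V w by rewrite ler_pdivrMr.
by move: me; rewrite /e; lra.
Qed.

Lemma memoryless (r : R) : 0 <= r ->
  pr mu (E `&` [set w | V w + r < w i]) =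
  expR (- r) * pr mu (E `&` [set w | V w < w i]).
Proof.
move=> r0.
have cv s := @pr_nondecr _ _ (pspace R setT) mu _ (mG ^~ s) (fun n => @G_incr s n).
have c1 := cvgMl_tmp (FF := eventually_filter) (a := expR (- r)) (cv 0).
have e : (fun n => pr mu (G n r)) = (fun n => expR (- r) * pr mu (G n 0)).
  by apply/funext => n; rewrite pr_G.
have := cv r; rewrite e => c2.
have := cvg_unique (@Rhausdorff R) c2 c1; rewrite !G_union => ->.
by under [in RHS]eq_set => w do rewrite -[V w]addr0.
Qed.

End Memoryless.

(** * One update and its effect on the two adjacent edges *)

Section Updates.
Variables (F theta : nat).
Implicit Types (u v : opinion F) (eta : int -> opinion F) (i : 'I_F).

Definition set_issue u i (b : bool) : opinion F := [ffun j => if j == i then b else u j].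

Definition local_step (b : bool) (s : {perm 'I_F}) (z : int) eta : int -> opinion F :=
  fun x => if x == z then deff_update theta s (eta z) (eta (nbr b z)) else eta x.

Definition edge_dist eta (x : int) : nat := hamming (eta x) (eta (x + 1)).

Lemma hammingE u v : hamming u v = (\sum_i (u i != v i))%N.
Proof.
rewrite /hamming -sum1_card big_mkcond; apply: eq_bigr => i _.
rewrite (_ : (i \in _) = (u i != v i)); first by case: ifP.
by apply/idP/idP; rewrite inE.
Qed.

Lemma hammingC u v : hamming u v = hamming v u.
Proof. by rewrite !hammingE; apply: eq_bigr => i _; rewrite eq_sym. Qed.

Lemma hamming_leF u v : (hamming u v <= F)%N.
Proof. by rewrite /hamming -[X in (_ <= X)%N]card_ord max_card. Qed.

Lemma hamming_full u v : hamming u v = F -> forall i, u i != v i.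
Proof.
rewrite hammingE => h i; case: (boolP (u i != v i)) => // ui.
have hF : (\sum_(j < F) 1 = F)%N by rewrite sum1_card card_ord.
have le1 : (\sum_(j < F | j != i) (u j != v j) <= \sum_(j < F | j != i) 1)%N.
  by apply: leq_sum => j _; apply: leq_b1.
have : (\sum_(j < F) 1 <= \sum_(j < F) (u j != v j))%N by rewrite hF h.
rewrite (bigD1 i)//= [X in (_ <= X)%N -> _](bigD1 i)//= (negbTE ui) add0n.
by move=> /leq_trans/(_ le1); rewrite add1n ltnn.
Qed.

Lemma hamming_set_issue u v i (b : bool) : u i != b ->
  (hamming (set_issue u i b) v + (v i == b) = hamming u v + (v i != b))%N.
Proof.
move=> ub; rewrite !hammingE (bigD1 i)//= [in RHS](bigD1 i)//= ffunE eqxx.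
rewrite (eq_bigr (fun j => (u j != v j : nat))); last first.
  by move=> j ji; rewrite ffunE (negbTE ji).
by move: ub; case: (u i); case: (v i); case: b => //= _; rewrite ?addn0 ?add0n ?add1n ?addn1.
Qed.

Lemma pick_issueP (s : {perm 'I_F}) u v i : pick_issue s u v = Some i ->
  u i != v i /\ forall k, u k != v k -> (s i <= s k)%N.
Proof.
rewrite /pick_issue; case: pickP => // j /andP[uv /forallP h] [<-]; split => // k.
by have := h k => /implyP.
Qed.

Lemma local_step_cases b s z eta : local_step b s z eta = eta \/
  exists i, [/\ (hamming (eta z) (eta (nbr b z)) <= theta)%N,
    eta z i != eta (nbr b z) i &
    local_step b s z eta =
      fun x => if x == z then set_issue (eta z) i (eta (nbr b z) i) else eta x].
Proof.
rewrite /local_step /deff_update; case: ifP => [/andP[h1 h2]|_]; last first.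
  by left; apply/funext => x; case: eqP => // ->.
case E: pick_issue => [i|]; last by left; apply/funext => x; case: eqP => // ->.
have [ui _] := pick_issueP E; right; exists i; split => //.
apply/funext => x; case: ifP => // _; apply/ffunP => j; rewrite !ffunE.
by case: eqP => // ->.
Qed.

Lemma nbrK b z : nbr b z != z.
Proof. by case: b => /=; apply/eqP; lia. Qed.

(** Changing coordinate [i] at [z] toggles the disagreement at level [i] on both edges at [z]. It
    disappears from the edge to the copied neighbour; on the other edge it either appears, which is
    a move, or disappears, which is an annihilation. *)
Lemma local_step_edges b s z eta (eta' := local_step b s z eta) :
  (edge_dist eta' (z - 1) + edge_dist eta' z =
   edge_dist eta (z - 1) + edge_dist eta z \/
   edge_dist eta' (z - 1) + edge_dist eta' z + 2 =
   edge_dist eta (z - 1) + edge_dist eta z)%N.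
Proof.
rewrite /eta'; have [->|[i [_ ui ->]]] := local_step_cases b s z eta; first by left.
rewrite /edge_dist subrK eqxx.
have -> : (z + 1 == z) = false by apply/eqP; lia.
have -> : (z - 1 == z) = false by apply/eqP; lia.
set c := eta (nbr b z) i in ui *.
have := hamming_set_issue (eta (z - 1)) ui; have := hamming_set_issue (eta (z + 1)) ui.
rewrite ![hamming (eta (z - 1)) _]hammingC.
have : (eta (z + 1) i == c) || (eta (z - 1) i == c).
  by rewrite /c; case: (b) => /=; rewrite eqxx ?orbT.
by case: (eta (z + 1) i == c); case: (eta (z - 1) i == c) => //= _; lia.
Qed.

Lemma local_step_other b s z eta x : x != z -> local_step b s z eta x = eta x.
Proof. by rewrite /local_step => /negbTE ->. Qed.

Lemma edge_dist_other b s z eta x : x != z -> x + 1 != z ->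
  edge_dist (local_step b s z eta) x = edge_dist eta x.
Proof. by move=> h1 h2; rewrite /edge_dist !local_step_other. Qed.

(** Since [theta < F], nothing is copied across a full edge. A particle coming from the other side
    of [z] lands on the full edge, where its level is occupied, and annihilates; so a step without
    annihilation does nothing. *)
Lemma local_step_blocked b s z eta : (theta < F)%N ->
  edge_dist eta z = F \/ edge_dist eta (z - 1) = F ->
  ~~ (edge_dist (local_step b s z eta) (z - 1) + edge_dist (local_step b s z eta) z <
   edge_dist eta (z - 1) + edge_dist eta z)%N -> local_step b s z eta = eta.
Proof.
move=> tF blk; have [->//|[i [h ui E]]] := local_step_cases b s z eta.
move=> /negP[]; rewrite E /edge_dist subrK eqxx.
have -> : (z + 1 == z) = false by apply/eqP; lia.
have -> : (z - 1 == z) = false by apply/eqP; lia.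
have := hamming_set_issue (eta (z - 1)) ui; have := hamming_set_issue (eta (z + 1)) ui.
rewrite ![hamming (eta (z - 1)) _]hammingC.
have : (eta (z + 1) i == eta (nbr b z) i) && (eta (z - 1) i == eta (nbr b z) i).
  case: blk; rewrite /edge_dist ?subrK => /[dup] blk /hamming_full/(_ i).
    move: h ui; case: (b) => /= h ui; first by move: h; rewrite blk leqNgt tF.
    by move: ui; case: (eta z i); case: (eta (z - 1) i); case: (eta (z + 1) i).
  move: h ui; case: (b) => /= h ui; last by move: h; rewrite hammingC blk leqNgt tF.
  by move: ui; case: (eta z i); case: (eta (z - 1) i); case: (eta (z + 1) i).
by move=> /andP[-> ->] /=; lia.
Qed.

(** One ranking singles out [i] for all pairs of opinions at once, so a chosen move is forced by a
    single value of the ranking mark. *)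
Lemma rank_first i : exists s : {perm 'I_F}, forall u v, u i != v i ->
  pick_issue s u v = Some i.
Proof.
case: F i => [[]//|f] i; exists (tperm i ord0) => u v uv.
rewrite /pick_issue; case: pickP => [j /andP[uj /forallP/(_ i)]|/(_ i)]; last first.
  by rewrite uv tpermL /= => /forallP h; case: h => k; apply/implyP.
rewrite uv /= tpermL leqn0 => /eqP h; congr Some.
by apply: (@perm_inj _ (tperm i ord0)); rewrite tpermL; apply: val_inj.
Qed.

(** This carries the disagreement on issue [i] from the edge [(z - 1, z)] to the edge [(z, z + 1)]. *)
Lemma move_right i : exists s : {perm 'I_F}, forall (z : int) eta,
  (hamming (eta (z - 1)%R) (eta z) <= theta)%N -> eta (z - 1) i != eta z i ->
  local_step false s z eta =
  fun x => if x == z then set_issue (eta z) i (eta (z - 1) i) else eta x.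
Proof.
have [s hs] := rank_first i; exists s => z eta h ui.
apply/funext => x; rewrite /local_step /=; case: ifP => // _.
rewrite /deff_update hammingC h andbT hs; last by rewrite eq_sym.
have -> : (1 <= hamming (eta (z - 1)%R) (eta z))%N.
  by rewrite hammingE (bigD1 i)//= ui.
by apply/ffunP => j; rewrite !ffunE; case: eqP => // ->.
Qed.

End Updates.

(** * Marks coded as reals *)

HB.instance Definition _ := gen_eqMixin mark.
HB.instance Definition _ := gen_choiceMixin mark.

(** All marks are coded as reals, so that a mark configuration is a point of [mark -> R]. *)
Definition encode_fin {R : realType} {T : finType} (t : T) : R := (enum_rank t)%:R.

Definition decode_fin {R : realType} {T : finType} (t0 : T) (r : R) : T :=
  odflt t0 [pick t | encode_fin t == r].

Lemma encode_finK {R : realType} {T : finType} (t0 : T) : cancel (@encode_fin R T) (decode_fin t0).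
Proof.
move=> t; rewrite /decode_fin; case: pickP => [t' /eqP|/(_ t)]; last by rewrite eqxx.
by rewrite /encode_fin => /eqP; rewrite eqr_nat => /eqP /val_inj /enum_rank_inj ->.
Qed.

Lemma measurable_decode {R : realType} {T : finType} (t0 : T) (A : set T) :
  measurable ((decode_fin t0 : R -> T) @^-1` A).
Proof.
pose C := range (@encode_fin R T).
have fC (D : set R) : D `<=` C -> measurable D.
  move=> DC; apply: countable_measurable => //.
  by apply: finite_set_countable; apply: sub_finite_set DC _; exact: finite_image.
have dC r : ~ C r -> decode_fin t0 r = t0.
  by rewrite /decode_fin; case: pickP => // t /eqP <- []; exists t.
case: (pselect (A t0)) => At0.
- rewrite -[X in measurable X]setCK; apply: measurableC; apply: fC => r /= Ar.
  by apply: contrapT => /dC h; apply: Ar; rewrite h.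
- by apply: fC => r /= Ar; apply: contrapT => /dC h; apply: At0; rewrite -h.
Qed.

(** * Words of rings and the dynamics in a finite box *)

Section Words.
Variables (R : realType) (F theta : nat).
Implicit Types (om : mark -> R) (B w : seq int) (t : R) (x y z : int).

Definition ini om x : opinion F := decode_fin [ffun=> false] (om (MInit x)).
Definition dirn om x n : bool := decode_fin false (om (MDir x n)).
Definition rank om x n : {perm 'I_F} := decode_fin 1%g (om (MRank x n)).
Definition ring_time om x n : R := \sum_(k < n) om (MTime x k).

Definition positive_times om := forall x n, 0 < om (MTime x n).

(** A word lists the sites whose clocks ring, the latest ring first. *)
Fixpoint chron B om w : Prop :=
  if w is z :: w' then
    [/\ z \in B,
        forall y, y \in B -> y != z ->
          ring_time om y (count_mem y w') < ring_time om z (count_mem z w').+1 <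
          ring_time om y (count_mem y w').+1
      & chron B om w']
  else True.

Definition history B om t w : Prop :=
  chron B om w /\ forall y, y \in B ->
    ring_time om y (count_mem y w) <= t < ring_time om y (count_mem y w).+1.

Fixpoint run om w : int -> opinion F :=
  if w is z :: w' then
    local_step theta (dirn om z (count_mem z w')) (rank om z (count_mem z w')) z (run om w')
  else ini om.

Definition regular om : Prop :=
  [/\ forall x n, 0 < om (MTime x n),
      forall x t, exists n, t < ring_time om x n
    & forall x y n m, x != y -> ring_time om x n.+1 != ring_time om y m.+1].

Lemma ring_time0 om x : ring_time om x 0 = 0.
Proof. exact: big_ord0. Qed.

Lemma ring_timeS om x n : ring_time om x n.+1 = ring_time om x n + om (MTime x n).
Proof. by rewrite /ring_time big_ord_recr. Qed.

Lemma ring_time_lt om x n m : positive_times om -> (n < m)%N ->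
  ring_time om x n < ring_time om x m.
Proof.
move=> pos; elim: m => // m IH; rewrite ltnS leq_eqVlt => /orP[/eqP ->|/IH h].
  by rewrite ring_timeS ltrDl.
by rewrite (lt_trans h)// ring_timeS ltrDl.
Qed.

Lemma ring_time_le om x n m : positive_times om -> (n <= m)%N ->
  ring_time om x n <= ring_time om x m.
Proof.
by move=> pos; rewrite leq_eqVlt => /predU1P[->//|/(ring_time_lt x pos)/ltW].
Qed.

(** The counts determine the latest ring: if the two words began with different sites, each of these
    rings would have to precede the other. *)
Lemma chron_uniq B om w1 w2 : chron B om w1 -> chron B om w2 ->
  (forall y, y \in B -> count_mem y w1 = count_mem y w2) -> w1 = w2.
Proof.
have notnil z w : z \in B -> (forall y, y \in B -> count_mem y (z :: w) = count_mem y [::]) -> False.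
  by move=> zB /(_ z zB) /=; rewrite eqxx.
elim: w1 w2 => [|z1 w1 IH] [|z2 w2] //=.
- by move=> _ [zB _ _] h; have [] := notnil _ w2 zB => y /h.
- by move=> [zB _ _] _ h; have [] := notnil _ w1 zB => y /h.
move=> [z1B h1 c1] [z2B h2 c2] h.
have zE : z1 = z2.
  apply/eqP/negPn/negP => ne.
  have /andP[a1 _] : ring_time om z2 (count_mem z2 w1) <
      ring_time om z1 (count_mem z1 w1).+1 < ring_time om z2 (count_mem z2 w1).+1.
    by apply: h1 => //; rewrite eq_sym.
  have /andP[a2 _] := h2 _ z1B ne.
  have := h _ z1B; have := h _ z2B.
  rewrite !eqxx (negbTE ne) eq_sym (negbTE ne) !add1n !add0n => e2 e1.
  by rewrite e1 in a1; have := lt_trans a1 a2; rewrite e2 ltxx.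
rewrite zE; congr (_ :: _); apply: IH => // y /h.
by rewrite zE => /addnI.
Qed.

Lemma history_count B om t w1 w2 y : positive_times om ->
  history B om t w1 -> history B om t w2 -> y \in B -> count_mem y w1 = count_mem y w2.
Proof.
move=> pos [_ h1] [_ h2] yB.
have /andP[a1 b1] := h1 y yB; have /andP[a2 b2] := h2 y yB.
have [l|l|//] := ltngtP (count_mem y w1) (count_mem y w2).
- have := le_lt_trans (le_trans (ring_time_le y pos l) a2) b1; by rewrite ltxx.
- have := le_lt_trans (le_trans (ring_time_le y pos l) a1) b2; by rewrite ltxx.
Qed.

Lemma history_uniq B om t w1 w2 : positive_times om ->
  history B om t w1 -> history B om t w2 -> w1 = w2.
Proof.
move=> pos H1 H2; apply: (chron_uniq H1.1 H2.1) => y yB.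
exact: (history_count pos H1 H2).
Qed.

Lemma chron_mem B om w z : chron B om w -> z \in w -> z \in B.
Proof.
by elim: w => // a w IH [aB _ cw]; rewrite inE => /predU1P[->//|]; exact: IH.
Qed.

Lemma chron_exists B om (n : int -> nat) t : regular om -> uniq B ->
  (forall y, y \in B -> ring_time om y (n y) <= t < ring_time om y (n y).+1) ->
  exists2 w, chron B om w & forall y, y \in B -> count_mem y w = n y.
Proof.
move=> [pos _ ties] uB.
have [k] := ubnP (\sum_(y <- B) n y)%N.
elim: k n t => // k IH n t; rewrite ltnS => nk nt.
case: (pselect (exists2 y, y \in B & n y != 0%N)) => [[y0 y0B ny0]|none]; last first.
  exists [::] => // y yB; case: (eqVneq (n y) 0%N) => [->//|ny].
  by case: none; exists y.
have [z [zB nz zmax]] : exists z, [/\ z \in B, n z != 0%N &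
    forall y, y \in B -> ring_time om y (n y) <= ring_time om z (n z)].
  have : exists2 z, z \in B & forall y, y \in B -> ring_time om y (n y) <= ring_time om z (n z).
    case: (B) y0B => // a s _; elim: s a => [|b s IHs] a.
      by exists a; rewrite ?inE// => y; rewrite inE => /eqP ->.
    have [z zs hz] := IHs b.
    have [le|/ltW le] := leP (ring_time om z (n z)) (ring_time om a (n a)).
      exists a; rewrite ?mem_head// => y; rewrite inE => /predU1P[->//|/hz h].
      exact: le_trans h le.
    by exists z => [|y]; rewrite [_ \in a :: _]inE ?zs ?orbT// => /predU1P[->//|/hz].
  move=> [z zB hz]; exists z; split => //; apply/eqP => nz0.
  have := hz _ y0B; rewrite nz0 ring_time0 leNgt => /negP; apply.
  by rewrite -(ring_time0 om y0); apply: ring_time_lt => //; rewrite lt0n.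
pose n' y := if y == z then (n z).-1 else n y.
have nzS : (n z).-1.+1 = n z by rewrite prednK// lt0n.
have lt_z y : y \in B -> ring_time om y (n' y) < ring_time om z (n z).
  move=> yB; rewrite /n'; case: eqVneq => [->|yz].
    by apply: ring_time_lt => //; rewrite prednK// lt0n.
  have [n0|n0] := eqVneq (n y) 0%N.
    rewrite n0 ring_time0 -(ring_time0 om z); apply: ring_time_lt => //.
    by rewrite lt0n.
  rewrite lt_neqAle zmax// andbT -[n y]prednK ?lt0n// -nzS.
  by apply: ties.
(* The induction hypothesis needs a time at which the counts [n'] are current; the latest of the
   remaining rings is one, and it is 0 if none remains. *)
pose t' := \big[Order.max/0]_(y <- B) ring_time om y (n' y).
have t'z : t' < ring_time om z (n z).
  rewrite /t' big_seq; elim/big_ind: _ => //.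
  - by rewrite -(ring_time0 om z); apply: ring_time_lt => //; rewrite lt0n.
  - by move=> a b a1 b1; rewrite gt_max a1 b1.
have z_next y : y \in B -> y != z -> ring_time om z (n z) < ring_time om y (n' y).+1.
  move=> yB yz; rewrite /n' (negbTE yz).
  have /andP[h1 _] := nt z zB; have /andP[_ h2] := nt y yB.
  exact: le_lt_trans h1 h2.
have [||w' cw' cnt'] := IH n' t'.
- rewrite (leq_trans _ nk)// (bigD1_seq z)//= [X in (_ < X)%N](bigD1_seq z)//=.
  rewrite {1}/n' eqxx -[X in (_ < X + _)%N]nzS addSn ltnS leq_add2l leq_sum//.
  by move=> y yz; rewrite /n' (negbTE yz).
- move=> y yB; apply/andP; split.
    rewrite /t'; elim: (B) yB => // a s IHs; rewrite inE big_cons le_max.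
    by move=> /predU1P[->|/IHs ->]; rewrite ?lexx ?orbT.
  rewrite (lt_le_trans t'z)//; have [->|yz] := eqVneq y z.
    by rewrite /n' eqxx nzS.
  by apply/ltW/z_next.
exists (z :: w') => /=.
  have n'z : (n' z).+1 = n z by rewrite /n' eqxx.
  by split=> // y yB yz; rewrite !cnt'// n'z lt_z// z_next.
move=> y yB /=; rewrite cnt'// /n'; case: (eqVneq y z) => [->|yz].
  by rewrite add1n nzS.
by rewrite add0n.
Qed.

Lemma history_exists B om t : regular om -> uniq B -> 0 <= t ->
  exists w, history B om t w.
Proof.
move=> reg uB t0; have [pos unb _] := reg.
have ex y : exists n, ring_time om y n <= t < ring_time om y n.+1.
  have [m tm] := unb y t; elim: m tm => [|m IH].
    by rewrite ring_time0 => /(le_lt_trans t0); rewrite ltxx.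
  by have [/IH//|h1 h2] := ltP t (ring_time om y m); exists m; rewrite h1.
have [n hn] := choice ex.
have [w cw cnt] := chron_exists reg uB (fun y _ => hn y).
by exists w; split=> // y yB; rewrite cnt.
Qed.

Lemma chron_le_head B om z w y : positive_times om ->
  chron B om (z :: w) -> y \in B ->
  ring_time om y (count_mem y (z :: w)) <= ring_time om z (count_mem z (z :: w)).
Proof.
move=> pos [zB h _] yB; have [->//|yz] := eqVneq y z.
have /andP[a _] := h y yB yz.
by rewrite /= eqxx eq_sym (negbTE yz) add0n add1n ltW.
Qed.

Lemma history_suffix B om s t w W : positive_times om -> s <= t ->
  history B om s w -> history B om t W -> exists v, W = v ++ w.
Proof.
move=> pos st Hw [cW HW].
(* Only this consequence survives the removal of the latest ring of [W]; the induction removes rings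
   until time [s] is reached. *)
have {HW st} : forall y, y \in B -> s < ring_time om y (count_mem y W).+1.
  by move=> y /HW /andP[_]; exact: le_lt_trans.
elim: W cW => [|z W IH] cW HW.
  exists [::]; apply: history_uniq (pos) _ (Hw); split=> // y yB; rewrite HW// andbT.
  have := Hw.2 y yB; rewrite ring_time0 => /andP[+ _]; apply: le_trans.
  by rewrite -(ring_time0 om y); apply: ring_time_le.
have [le|gt] := leP (ring_time om z (count_mem z (z :: W))) s.
  exists [::]; apply: history_uniq (pos) _ (Hw); split=> // y yB; rewrite HW// andbT.
  exact: le_trans (chron_le_head pos cW yB) le.
case: (cW) => zB hz cW'; have [//||v ->] := IH; last by exists (z :: v).
move=> y yB; have [->|yz] := eqVneq y z; first by move: gt; rewrite /= eqxx.
by have := HW y yB; rewrite /= eq_sym (negbTE yz).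
Qed.

Lemma count_filter_mem B w y : y \in B ->
  count_mem y [seq x <- w | x \in B] = count_mem y w.
Proof.
move=> yB; rewrite count_filter; apply: eq_count => x /=.
by case: eqP => // ->.
Qed.

Lemma chron_filter B B' om w : {subset B' <= B} -> chron B om w ->
  chron B' om [seq x <- w | x \in B'].
Proof.
move=> sub; elim: w => // z w IH [zB h cw] /=; case: ifP => zB'; last exact: IH.
split=> //; last exact: IH.
by move=> y yB' yz; rewrite !count_filter_mem//; apply: h => //; exact: sub.
Qed.

Lemma history_filter B B' om t w : {subset B' <= B} -> history B om t w ->
  history B' om t [seq x <- w | x \in B'].
Proof.
move=> sub [c h]; split; first exact: chron_filter c.
by move=> y yB'; rewrite count_filter_mem//; apply: h; exact: sub.
Qed.

(** Both configurations carry the same information up to time [s]. The disjunction makes the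
    relation symmetric: neither may have a ring up to [s] that the other lacks. *)
Definition agree (s : R) om om' : Prop :=
  (forall x, om (MInit x) = om' (MInit x)) /\
  forall x n, ring_time om x n.+1 <= s \/ ring_time om' x n.+1 <= s ->
    [/\ om (MTime x n) = om' (MTime x n), om (MDir x n) = om' (MDir x n) &
        om (MRank x n) = om' (MRank x n)].

Lemma agreeC s om om' : agree s om om' -> agree s om' om.
Proof.
move=> [h1 h2]; split=> [x|x n h]; first by rewrite h1.
by have [|-> -> ->] := h2 x n; first by case: h; [right|left].
Qed.

Lemma agree_ring_time s om om' x n : positive_times om ->
  agree s om om' -> ring_time om x n <= s -> ring_time om' x n = ring_time om x n.
Proof.
move=> pos [_ ag]; elim: n => [|n IH] h; first by rewrite !ring_time0.
have hn : ring_time om x n <= s by apply: le_trans h; exact: ring_time_le.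
by rewrite !ring_timeS IH//; have [|-> _ _] := ag x n; first by left.
Qed.

Lemma agree_lt s t om om' x n : positive_times om ->
  positive_times om' -> t <= s ->
  agree s om om' -> (t < ring_time om x n) = (t < ring_time om' x n).
Proof.
move=> pos pos' ts ag; rewrite !ltNge; congr (~~ _); apply/idP/idP => h.
  by rewrite (agree_ring_time pos ag)// (le_trans h).
by rewrite (agree_ring_time pos' (agreeC ag))// (le_trans h).
Qed.

Lemma agree_chron B s om om' w : positive_times om ->
  positive_times om' -> agree s om om' ->
  (forall y, y \in B -> ring_time om y (count_mem y w) <= s) ->
  chron B om w -> chron B om' w.
Proof.
move=> pos pos' ag; elim: w => // z w IH le [zB h cw].
have lez := le z zB; rewrite /= eqxx add1n in lez.
split=> //.
- move=> y yB yz; have /andP[h1 h2] := h y yB yz.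
  rewrite (agree_ring_time pos ag lez) -(agree_lt _ _ pos pos' lez ag) h2 andbT.
  by rewrite (agree_ring_time pos ag)// (le_trans (ltW h1)).
- apply: IH => // y yB; apply: le_trans (le y yB); apply: ring_time_le => //=.
  exact: leq_addl.
Qed.

Lemma agree_history B s t om om' w : positive_times om ->
  positive_times om' -> t <= s -> agree s om om' ->
  history B om t w -> history B om' t w.
Proof.
move=> pos pos' ts ag [c h].
have le y : y \in B -> ring_time om y (count_mem y w) <= s.
  by move=> /h /andP[+ _] => /le_trans; apply.
split; first exact: agree_chron ag le c.
move=> y yB; rewrite (agree_ring_time pos ag (le y yB)).
by rewrite -(agree_lt _ _ pos pos' ts ag); exact: h.
Qed.

Lemma agree_run B s om om' w : positive_times om ->
  agree s om om' ->
  (forall y, y \in B -> ring_time om y (count_mem y w) <= s) -> {subset w <= B} ->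
  run om' w = run om w.
Proof.
move=> pos ag; elim: w => [|z w IH] le sub.
  by apply/funext => x; rewrite /= /ini ag.1.
have zB : z \in B by apply: sub; exact: mem_head.
have lez := le z zB; rewrite /= eqxx add1n in lez.
rewrite /= IH; last 2 first.
- move=> y yB; apply: le_trans (le y yB); apply: ring_time_le => //=.
  exact: leq_addl.
- by move=> y yw; apply: sub; rewrite inE yw orbT.
by rewrite /dirn /rank; have [|_ -> ->] := ag.2 z (count_mem z w); first by left.
Qed.

(** Requiring uniqueness makes [word] measurable in [om]. *)
Definition word B om t : seq int :=
  xget [::] [set w | history B om t w /\ forall v, history B om t v -> v = w].

(** The dynamics in which only the sites of [B] are updated. *)
Definition box_path B om t : int -> opinion F := run om (word B om t).

Lemma wordP B om t w : positive_times om ->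
  history B om t w -> word B om t = w.
Proof.
move=> pos h; rewrite /word; case: xgetP => [v _ [hv _]|/(_ w)[]].
  exact: history_uniq hv h.
by split=> // v hv; exact: history_uniq hv h.
Qed.

Lemma word_history B om t : regular om -> uniq B -> 0 <= t -> history B om t (word B om t).
Proof.
move=> reg uB t0; have [w h] := history_exists reg uB t0.
by rewrite (wordP _ h)//; case: reg.
Qed.

Lemma agree_word B s t om om' : positive_times om ->
  positive_times om' -> t <= s -> agree s om om' ->
  word B om' t = word B om t.
Proof.
move=> pos pos' ts ag; have e w : history B om' t w <-> history B om t w.
  split; [exact: agree_history (agreeC ag)|exact: agree_history ag].
by rewrite /word; congr xget; apply/seteqP; split=> w [/e h1 h2]; split=> // v /e /h2.
Qed.

Lemma agree_box_path B s t om om' : positive_times om ->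
  positive_times om' -> t <= s -> agree s om om' ->
  box_path B om' t = box_path B om t.
Proof.
move=> pos pos' ts ag; rewrite /box_path (agree_word _ pos pos' ts ag).
rewrite /word; case: xgetP => [w _ [[c h] _]|_].
  apply: (agree_run pos ag (B := B)); last by move=> x; exact: chron_mem c.
  by move=> y /h /andP[+ _] => /le_trans; apply.
by apply/funext => x; rewrite /= /ini ag.1.
Qed.

End Words.

(** * Trajectories, annihilation counts and symmetries of the runs *)

Section WordPaths.
Variables (R : realType) (F theta : nat).
Implicit Types (om : mark -> R) (B w : seq int) (t : R) (x y z : int).

Local Notation run := (@run R F theta).
Local Notation box_path := (@box_path R F theta).
Local Notation ini := (@ini R F).

Definition path_of om (eta : R -> int -> opinion F) : Prop :=
  [/\ forall x, eta 0 x = ini om x,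
      forall x n t, ring_time om x n <= t < ring_time om x n.+1 ->
                    eta t x = eta (ring_time om x n) x
    & forall x n m, let y := nbr (dirn om x n) x in
        ring_time om y m < ring_time om x n.+1 <= ring_time om y m.+1 ->
        eta (ring_time om x n.+1) x =
          deff_update theta (rank F om x n) (eta (ring_time om x n) x)
                      (eta (ring_time om y m) y)].

(** No ring of [w] is at [a] or [b], so every ring inside [[a, b]] consults a neighbour inside
    [[a, b]]: the rest of the line, where the trajectory is not controlled, is never read. *)
Lemma path_run B om eta w a b : path_of om eta -> chron B om w ->
  (forall x, a <= x <= b -> x \in B) -> a \notin w -> b \notin w ->
  forall x, a <= x <= b -> eta (ring_time om x (count_mem x w)) x = run om w x.
Proof.
move=> [p0 p1 p2] + abB; elim: w => [|z w IH] /= c aw bw x xab.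
  by rewrite ring_time0 p0.
move: c => [zB h cw].
move: aw bw; rewrite !inE !negb_or => /andP[az aw] /andP[bz bw].
have [xz|xz] := eqVneq x z; last first.
  by rewrite add0n local_step_other// IH.
subst x; rewrite add1n /local_step eqxx.
have yab : a <= nbr (dirn om z (count_mem z w)) z <= b.
  by move: az bz xab; case: dirn => /= /eqP ? /eqP ?; lia.
rewrite (p2 z (count_mem z w) (count_mem (nbr (dirn om z (count_mem z w)) z) w)).
  by rewrite !IH.
have /andP[h1 h2] := h _ (abB _ yab) (nbrK _ _).
by rewrite h1 ltW.
Qed.

Lemma silent_notin B om t w a : positive_times om ->
  history B om t w -> a \in B -> t < ring_time om a 1 -> a \notin w.
Proof.
move=> pos [_ h] aB ta; have /andP[le _] := h a aB.
rewrite -has_pred1 has_count -leqNgt leqNgt; apply/negP => c0.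
have := lt_le_trans ta (le_trans (ring_time_le a pos c0) le).
by rewrite ltxx.
Qed.

Lemma path_box_path B om eta t a b : regular om -> path_of om eta -> uniq B -> 0 <= t ->
  (forall x, a <= x <= b -> x \in B) -> a <= b ->
  t < ring_time om a 1 -> t < ring_time om b 1 ->
  forall x, a <= x <= b -> eta t x = box_path B om t x.
Proof.
move=> reg pe uB t0 abB ab ta tb x xab; have [pos _ _] := reg.
have h := word_history reg uB t0; have [c hc] := h.
have aB : a \in B by apply: abB; rewrite lexx.
have bB : b \in B by apply: abB; rewrite lexx andbT.
rewrite /box_path -(path_run pe c abB _ _ xab).
- by have [_ p1 _] := pe; apply: p1; apply: hc; exact: abB.
- exact: (silent_notin pos h aB ta).
- exact: (silent_notin pos h bB tb).
Qed.

Definition annihilates om z w : bool :=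
  (edge_dist (run om (z :: w)) (z - 1)%R + edge_dist (run om (z :: w)) z <
   edge_dist (run om w) (z - 1)%R + edge_dist (run om w) z)%N.

Fixpoint annihilations om y v w : nat :=
  if v is z :: v' then ((z == y) && annihilates om z (v' ++ w) + annihilations om y v' w)%N
  else 0%N.

(** The index is shifted so that the [n + 1] edges from [(-1, 0)] to [(n - 1, n)] are exactly those
    touched by the sites [0] to [n - 1]. *)
Definition total_dist n (eta : int -> opinion F) : nat :=
  (\sum_(0 <= k < n.+1) edge_dist eta (k%:Z - 1)%R)%N.

Definition sites_below n : seq int := map Posz (iota 0 n).

Lemma mem_sites_below n x : (x \in sites_below n) = (0 <= x < n%:Z).
Proof.
apply/mapP/idP => [[k + ->]|]; first by rewrite mem_iota /= add0n ltz_nat.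
by case: x => // k; rewrite /= ltz_nat => kn; exists k; rewrite ?mem_iota.
Qed.

Lemma sites_below_uniq n : uniq (sites_below n).
Proof. by rewrite map_inj_uniq ?iota_uniq// => ? ? []. Qed.

Lemma total_dist_step n om z w : z \in sites_below n ->
  (total_dist n (run om (z :: w)) + 2 * annihilates om z w = total_dist n (run om w))%N.
Proof.
rewrite mem_sites_below /total_dist => /andP[]; case: z => // k _; rewrite ltz_nat => kn.
have kn1 : (k <= n.+1)%N := leqW (ltnW kn).
rewrite (big_cat_nat (n := k) (leq0n k) kn1)//= [RHS](big_cat_nat (n := k) (leq0n k) kn1)//=.
rewrite !(big_ltn (m := k)) ?ltnS ?(ltnW kn)// !(big_ltn (m := k.+1)) ?ltnS//.
have e1 : (\sum_(0 <= i < k) edge_dist (run om (k%:Z :: w)) (i%:Z - 1)%R =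
           \sum_(0 <= i < k) edge_dist (run om w) (i%:Z - 1)%R)%N.
  rewrite !big_nat; apply: eq_bigr => i /andP[_ ik].
  by apply: edge_dist_other; apply/eqP; lia.
have e2 : (\sum_(k.+2 <= i < n.+1) edge_dist (run om (k%:Z :: w)) (i%:Z - 1)%R =
           \sum_(k.+2 <= i < n.+1) edge_dist (run om w) (i%:Z - 1)%R)%N.
  rewrite !big_nat; apply: eq_bigr => i /andP[ki _].
  by apply: edge_dist_other; apply/eqP; lia.
rewrite e1 e2.
have -> : k.+1%:Z - 1 = k%:Z by lia.
have := @local_step_edges F theta (dirn om k (count_mem k%:Z w))
  (rank F om k (count_mem k%:Z w)) k (run om w).
rewrite /annihilates -/(run om (k%:Z :: w)) /=.
set A := edge_dist _ _; set A' := edge_dist _ _.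
set C := edge_dist _ _; set C' := edge_dist _ _.
by case=> h; [have -> : (A + A' < C + C')%N = false|have -> : (A + A' < C + C')%N = true];
  rewrite /=; lia.
Qed.

(** The balance is exact, without boundary terms, because every edge that an update in the box can
    change is counted. *)
Lemma total_dist_run n om v w : {subset v <= sites_below n} ->
  (total_dist n (run om (v ++ w)) +
   2 * \sum_(y <- sites_below n) annihilations om y v w = total_dist n (run om w))%N.
Proof.
elim: v => [|z v IH] sub; first by rewrite /= big1 ?muln0 ?addn0.
have zi : z \in sites_below n by apply: sub; exact: mem_head.
rewrite -IH; last by move=> y yv; apply: sub; rewrite inE yv orbT.
rewrite -[in RHS](total_dist_step om (v ++ w) zi) /= big_split/=.
rewrite (bigD1_seq z) ?sites_below_uniq//= eqxx/= big1; last first.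
  by move=> y yz; rewrite eq_sym (negbTE yz).
by lia.
Qed.

Lemma annihilations_gt0 om y v1 v2 w : annihilates om y (v2 ++ w) ->
  (0 < annihilations om y (v1 ++ y :: v2) w)%N.
Proof.
move=> a; elim: v1 => [|z v1 IH] /=; first by rewrite eqxx a.
by rewrite addn_gt0 IH orbT.
Qed.

(** As long as the edge is blocked, a ring at one of its ends either annihilates or changes nothing,
    so without annihilations the edge stays blocked and both opinions stay. *)
Lemma blocked_run om v w x : (theta < F)%N -> edge_dist (run om w) x = F ->
  annihilations om x v w = 0%N -> annihilations om (x + 1) v w = 0%N ->
  run om (v ++ w) x = run om w x /\ run om (v ++ w) (x + 1) = run om w (x + 1).
Proof.
move=> tF blk; elim: v => //= z v IH /eqP + /eqP.
rewrite !addn_eq0 !eqb0 => /andP[z1 /eqP a1] /andP[z2 /eqP a2].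
have [e1 e2] := IH a1 a2; rewrite -e1 -e2.
have blk' : edge_dist (run om (v ++ w)) x = F by rewrite /edge_dist e1 e2.
have [zx|zx] := eqVneq z x.
  move: z1; rewrite zx eqxx /= => na.
  by rewrite (local_step_blocked tF (or_introl blk') na).
have [zx1|zx1] := eqVneq z (x + 1).
  move: z2; rewrite zx1 eqxx /= => na.
  have blk2 : edge_dist (run om (v ++ w)) (x + 1 - 1) = F by rewrite addrK.
  by rewrite (local_step_blocked tF (or_intror blk2) na).
by rewrite !local_step_other// eq_sym.
Qed.


Definition shift_mark (a : int) (i : mark) : mark :=
  match i with
  | MInit x => MInit (x + a)
  | MTime x n => MTime (x + a) n
  | MDir x n => MDir (x + a) n
  | MRank x n => MRank (x + a) n
  end.

Lemma shift_mark_inj a : injective (shift_mark a).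
Proof. by move=> [x|x n|x n|x n] [y|y m|y m|y m] //= []; do ?[move/addIr ->|move=> ->]. Qed.

Definition shift_marks a om : mark -> R := om \o shift_mark a.

Local Notation tr a := (map (fun x : int => x + a)).

Lemma count_tr a w y : count_mem (y + a) (tr a w) = count_mem y w.
Proof.
rewrite count_map; apply: eq_count => x /=.
by rewrite (inj_eq (addIr a)).
Qed.

Lemma mem_tr a w y : (y + a \in tr a w) = (y \in w).
Proof. exact: (mem_map (@addIr _ a)). Qed.

Lemma trP a w y : y \in tr a w -> exists2 x, x \in w & y = x + a.
Proof. by move/mapP. Qed.

Lemma chron_shift a B om w :
  chron B (shift_marks a om) w <-> chron (tr a B) om (tr a w).
Proof.
elim: w => //= z w IH; split => -[zB h c]; split.
- by rewrite mem_tr.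
- move=> _ /trP[y yB ->] yz; rewrite !count_tr; apply: h => //.
  by apply: contra yz => /eqP ->.
- exact/IH.
- by rewrite -(mem_tr a).
- move=> y yB yz; have := h (y + a); rewrite mem_tr !count_tr; apply=> //.
  by rewrite (inj_eq (addIr a)).
- exact/IH.
Qed.

Lemma history_shift a B om t w :
  history B (shift_marks a om) t w <-> history (tr a B) om t (tr a w).
Proof.
split=> -[c h]; split; try exact/chron_shift.
- by move=> _ /trP[y yB ->]; rewrite count_tr; exact: h.
- by move=> y yB; have := h (y + a); rewrite mem_tr count_tr; exact.
Qed.

Lemma run_shift a om w x : run (shift_marks a om) w x = run om (tr a w) (x + a).
Proof.
elim: w x => //= z w IH x; rewrite /local_step (inj_eq (addIr a)) !IH count_tr.
case: ifP => // _; congr (deff_update _ _ _ (run _ _ _)).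
have -> : dirn (shift_marks a om) z (count_mem z w) = dirn om (z + a) (count_mem z w) by [].
by case: (dirn _ _ _) => /=; rewrite addrAC.
Qed.

Lemma word_shift a B om t : regular om -> uniq B -> 0 <= t ->
  tr a (word B (shift_marks a om) t) = word (tr a B) om t.
Proof.
move=> [pos unb ties] uB t0; apply/esym/wordP => //.
apply/history_shift/word_history => //.
split=> [x n|x s|x y n m xy]; first exact: pos.
  exact: unb (x + a) s.
by apply: (ties (x + a) (y + a)); rewrite (inj_eq (addIr a)).
Qed.

Lemma box_path_shift a B om t x : regular om -> uniq B -> 0 <= t ->
  box_path B (shift_marks a om) t x = box_path (tr a B) om t (x + a).
Proof.
by move=> reg uB t0; rewrite /box_path run_shift word_shift.
Qed.

Definition opinion_xor (u v : opinion F) : opinion F := [ffun i => u i (+) v i].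

(** Only initial opinions are flipped: an update depends on where two opinions differ, so the
    dynamics commutes with flipping the same coordinates at all sites. *)
Definition xor_coord (u : opinion F) (i : mark) (r : R) : R :=
  if i is MInit _ then encode_fin (opinion_xor (decode_fin ([ffun=> false] : opinion F) r) u) else r.

Definition xor_marks u om : mark -> R := fun i => xor_coord u i (om i).

Lemma xor_neq (u v p : opinion F) i :
  (opinion_xor v u i != opinion_xor p u i) = (v i != p i).
Proof. by rewrite !ffunE (inj_eq (@addIb _)). Qed.

Lemma deff_update_xor s u v p :
  deff_update theta s (opinion_xor v u) (opinion_xor p u) =
  opinion_xor (deff_update theta s v p) u.
Proof.
rewrite /deff_update.
have -> : hamming (opinion_xor v u) (opinion_xor p u) = hamming v p.
  by rewrite !hammingE; apply: eq_bigr => i _; rewrite xor_neq.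
have -> : pick_issue s (opinion_xor v u) (opinion_xor p u) = pick_issue s v p.
  rewrite /pick_issue; apply: eq_pick => i /=; rewrite xor_neq; congr (_ && _).
  by apply: eq_forallb => k; rewrite xor_neq.
case: ifP => // _; case: pick_issue => // i.
by apply/ffunP => j; rewrite !ffunE; case: ifP.
Qed.

Lemma run_xor u om w x : run (xor_marks u om) w x = opinion_xor (run om w x) u.
Proof.
elim: w x => [x|z w IH x] /=; first by rewrite /ini /= encode_finK.
rewrite /local_step !IH; case: ifP => // _; exact: deff_update_xor.
Qed.

Lemma history_xor u B om t w : history B (xor_marks u om) t w = history B om t w.
Proof.
rewrite /history; congr (_ /\ _).
by elim: w => //= z w ->.
Qed.

Lemma box_path_xor u B om t x :
  box_path B (xor_marks u om) t x = opinion_xor (box_path B om t x) u.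
Proof.
rewrite /box_path run_xor; congr (opinion_xor (run _ _ _) _).
rewrite /word; congr xget; apply/seteqP; split=> w [h1 h2]; split=> [|v];
  by move: h1 (h2); rewrite ?history_xor// => h1 /(_ v); rewrite ?history_xor.
Qed.

(** Overwriting the marks outside [J] by a constant is a measurable map for the sigma-algebra of
    [J]; an event invariant under it is therefore measurable for that sigma-algebra. *)
Definition restrict_marks (J : set mark) (c : R) om : mark -> R :=
  fun i => if i \in J then om i else c.

Definition site_marks (A : set int) : set mark := fun i =>
  match i with
  | MInit x | MTime x _ | MDir x _ | MRank x _ => A x
  end.

(** [A] contains the neighbours of [B] as well: they never ring in the box dynamics, but their
    initial opinions are read. *)
Lemma box_path_restrict A B om c t x : (forall y, y \in B -> A y /\ forall b, A (nbr b y)) ->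
  A x -> box_path B (restrict_marks (site_marks A) c om) t x = box_path B om t x.
Proof.
move=> AB; have inA i : site_marks A i -> restrict_marks (site_marks A) c om i = om i.
  by move=> Ai; rewrite /restrict_marks mem_set.
have rt y n : y \in B -> ring_time (restrict_marks (site_marks A) c om) y n = ring_time om y n.
  by move=> /AB[Ay _]; apply: eq_bigr => k _; apply: inA.
have ch w : chron B (restrict_marks (site_marks A) c om) w <-> chron B om w.
  elim: w => //= z w IH; split=> -[zB h cw]; (split; [by []| |exact/IH]) => y yB yz;
  by have := h y yB yz; rewrite !rt.
have hi w : history B (restrict_marks (site_marks A) c om) t w <-> history B om t w.
  split=> -[cw h]; (split; [exact/ch|]) => y yB; by have := h y yB; rewrite !rt.
rewrite /box_path.
have -> : word B (restrict_marks (site_marks A) c om) t = word B om t.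
  by rewrite /word; congr xget; apply/seteqP; split=> w [/hi h1 h2]; split=> // v /hi /h2.
have : {subset word B om t <= B}.
  rewrite /word; case: xgetP => [w _ [[cw _] _]|_] // z; exact: chron_mem cw.
elim: (word B om t) x => [|z w IH] x sub Ax; first by rewrite /= /ini inA.
have [Az Anz] := AB z (sub z (mem_head _ _)).
have sub' : {subset w <= B} by move=> y yw; apply: sub; rewrite inE yw orbT.
rewrite /= /local_step /dirn /rank !inA// !IH//.
Qed.

End WordPaths.

(** * Measurability of finitely and countably determined events *)

Section Measurability.
Context {d : measure_display} {T : measurableType d}.

Lemma measurable_seq_all (C : eqType) (s : seq C) (A : C -> set T) :
  (forall y, y \in s -> measurable (A y)) ->
  measurable [set om | forall y, y \in s -> A y om].
Proof.
elim: s => [_|a s IH mA].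
  by rewrite (_ : [set _ | _] = setT)//; apply/seteqP; split.
rewrite (_ : [set _ | _] = A a `&` [set om | forall y, y \in s -> A y om]).
  apply: measurableI; first exact/mA/mem_head.
  by apply: IH => y ys; apply: mA; rewrite inE ys orbT.
apply/seteqP; split=> om /=.
  by move=> h; split=> [|y ys]; apply: h; rewrite inE ?eqxx// ys orbT.
by move=> [h1 h2] y; rewrite inE => /predU1P[->//|]; exact: h2.
Qed.

Lemma measurable_fin_all (C : finType) (A : C -> set T) :
  (forall y, measurable (A y)) -> measurable [set om | forall y, A y om].
Proof.
move=> mA; rewrite (_ : [set _ | _] = [set om | forall y, y \in enum C -> A y om]).
  exact: measurable_seq_all.
by apply/seteqP; split=> om h y; [|apply: h; rewrite mem_enum].
Qed.

Lemma measurable_count_ex (C : countType) (A : C -> set T) :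
  (forall y, measurable (A y)) -> measurable [set om | exists y, A y om].
Proof.
move=> mA; rewrite (_ : [set _ | _] = \bigcup_(y in [set: C]) A y).
  by apply: countable_bigcupT_measurable => //; exact: countableP.
by apply/seteqP; split=> om [y]; [exists y|exists y].
Qed.

Lemma measurable_count_all (C : countType) (A : C -> set T) :
  (forall y, measurable (A y)) -> measurable [set om | forall y, A y om].
Proof.
move=> mA; rewrite -[X in measurable X]setCK; apply: measurableC.
rewrite (_ : ~` _ = [set om | exists y, (~` A y) om]).
  by apply: measurable_count_ex => y; exact: measurableC.
by apply/seteqP; split=> om /= /existsNP.
Qed.

Lemma measurable_finite_fun (C D : finType) (X : C -> T -> D) (Q : {ffun C -> D} -> Prop) :
  (forall p y, measurable [set om | X p om = y]) ->
  measurable [set om | Q [ffun p => X p om]].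
Proof.
move=> mX.
rewrite (_ : [set _ | _] =
  [set om | exists g, (if `[< Q g >] then [set om | forall p, X p om = g p] else set0) om]).
  by apply: measurable_count_ex => g; case: ifP => // _; exact: (measurable_fin_all (fun p => mX p (g p))).
apply/seteqP; split=> om /=.
  move=> h; exists [ffun p => X p om]; rewrite asboolT//= => p; by rewrite ffunE.
move=> [g]; case: ifP => // /asboolP Qg /= e.
by rewrite (_ : [ffun p => X p om] = g)//; apply/ffunP => p; rewrite ffunE.
Qed.

Lemma measurable_finite_law (C : finType) (X : T -> C) (Q : set C) :
  (forall y, measurable [set om | X om = y]) -> measurable [set om | Q (X om)].
Proof.
move=> mX.
rewrite (_ : [set _ | _] =
  [set om | exists g, (if `[< Q g >] then [set om | X om = g] else set0) om]).
  by apply: measurable_count_ex => g; case: ifP.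
apply/seteqP; split=> om /=; first by move=> h; exists (X om); rewrite asboolT.
by move=> [g]; case: ifP => // /asboolP Qg /= ->.
Qed.

End Measurability.

Section LocalEvents.
Variable F : nat.
Implicit Type S : (nat -> int -> opinion F) -> Prop.

(** The first argument of [f] is the index of a sampling time, so [S] looks at finitely many times
    and at the [m] sites from [a] on. Finitely many opinions decide it, and an arbitrary predicate
    of this kind yields a measurable event. *)
Definition local_event (k : nat) (a : int) (m : nat) S : Prop :=
  forall f g, (forall j x, (j <= k)%N -> a <= x < a + m%:Z -> f j x = g j x) -> S f -> S g.

Lemma measurable_local {d : measure_display} {T : measurableType d}
    (f : T -> nat -> int -> opinion F) k a m S :
  local_event k a m S ->
  (forall j x u, (j <= k)%N -> a <= x < a + m%:Z -> measurable [set w | f w j x = u]) ->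
  measurable [set w | S (f w)].
Proof.
move=> loc mf.
pose X (p : 'I_k.+1 * 'I_m) w : opinion F := f w p.1 (a + (p.2 : nat)%:Z).
pose ext (g : {ffun 'I_k.+1 * 'I_m -> opinion F}) (j : nat) (x : int) : opinion F :=
  if insub j is Some j' then
    if insub `|x - a|%N is Some x' then g (j', x') else [ffun=> false]
  else [ffun=> false].
have extE w j x : (j <= k)%N -> a <= x < a + m%:Z ->
    ext [ffun p => X p w] j x = f w j x.
  move=> jk xa; have jk' : (j < k.+1)%N by rewrite ltnS.
  rewrite /ext (insubT (fun i => i < k.+1)%N jk').
  have xm : (`|(x - a)%R|%N < m)%N by lia.
  rewrite (insubT (fun i => i < m)%N xm).
  by rewrite ffunE /X/=; congr (f w _ _); lia.
rewrite (_ : [set w | S (f w)] = [set w | S (ext [ffun p => X p w])]).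
  apply: (measurable_finite_fun (fun g => S (ext g))) => -[j i] y.
  apply: mf => /=; first by rewrite -ltnS ltn_ord.
  by move: (nat_of_ord i) (ltn_ord i) => n; lia.
apply/seteqP; split=> w /=; apply: loc => j x jk xa; by rewrite extE.
Qed.

End LocalEvents.

(** * Measurability of words, runs and the box dynamics *)

Section MarkMeasurability.
Variables (R : realType) (F theta : nat).
Implicit Types (B w : seq int) (x y z : int) (J : set mark).

Local Notation W J := (pspace R J).
Local Notation rtime x n := (fun om : mark -> R => ring_time om x n).

Lemma measurable_ring_time J x n : (forall k, (k < n)%N -> J (MTime x k)) ->
  measurable_fun setT (rtime x n : W J -> R).
Proof.
move=> Jx; elim: n Jx => [|n IH] Jx.
  by rewrite (_ : rtime x 0 = cst 0)//; apply/funext => om; rewrite ring_time0.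
rewrite (_ : rtime x n.+1 = fun om => ring_time om x n + om (MTime x n)); last first.
  by apply/funext => om; rewrite ring_timeS.
apply: measurable_funD; first by apply: IH => k kn; apply: Jx; rewrite ltnS ltnW.
by apply: measurable_coord; exact: Jx.
Qed.

Lemma measurable_lt J (f g : (mark -> R) -> R) :
  measurable_fun setT (f : W J -> R) -> measurable_fun setT (g : W J -> R) ->
  measurable ([set om | f om < g om] : set (W J)).
Proof.
move=> mf mg; rewrite (_ : [set om | _] = (fun om => g om - f om) @^-1` `]0, +oo[).
  by rewrite -[X in measurable X]setTI; apply: (measurable_funB mg mf).
by apply/seteqP; split=> om /=; rewrite in_itv/= andbT subr_gt0.
Qed.

Lemma measurable_le J (f g : (mark -> R) -> R) :
  measurable_fun setT (f : W J -> R) -> measurable_fun setT (g : W J -> R) ->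
  measurable ([set om | f om <= g om] : set (W J)).
Proof.
move=> mf mg; rewrite (_ : [set om | _] = (fun om => g om - f om) @^-1` `[0, +oo[).
  by rewrite -[X in measurable X]setTI; apply: (measurable_funB mg mf).
by apply/seteqP; split=> om /=; rewrite in_itv/= andbT subr_ge0.
Qed.

Let mrt x n : measurable_fun setT (rtime x n : W [set: mark] -> R).
Proof. exact: measurable_ring_time. Qed.

Lemma measurable_chron B w : measurable ([set om | chron B om w] : set (W [set: mark])).
Proof.
elim: w => [|z w IH] /=.
  by rewrite (_ : [set _ | _] = setT)//; apply/seteqP; split.
rewrite (_ : [set _ | _] = (if z \in B then setT else set0) `&`
  ([set om | forall y, y \in B -> (if y != z then
     [set om | rtime y (count_mem y w) om < rtime z (count_mem z w).+1 om] `&`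
     [set om | rtime z (count_mem z w).+1 om < rtime y (count_mem y w).+1 om] else setT) om]
   `&` [set om | chron B om w])).
  apply: measurableI; first by case: ifP.
  apply: measurableI => //; apply: measurable_seq_all => y _.
  by case: ifP => // _; apply: measurableI; apply: measurable_lt; exact: mrt.
apply/seteqP; split=> om /=.
  move=> [zB h c]; rewrite zB; split=> //; split=> // y yB; case: ifP => // yz.
  by have /andP[] := h y yB yz.
move=> [+ [h c]]; case: ifP => // zB _; split=> // y yB yz.
by have := h y yB; rewrite yz => -[-> ->].
Qed.

Lemma measurable_history B t w : measurable ([set om | history B om t w] : set (W [set: mark])).
Proof.
rewrite (_ : [set _ | _] = [set om | chron B om w] `&`
  [set om | forall y, y \in B ->
     ([set om | rtime y (count_mem y w) om <= t] `&`
     [set om | t < rtime y (count_mem y w).+1 om]) om]).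
  apply: measurableI; first exact: measurable_chron.
  apply: measurable_seq_all => y _; apply: measurableI.
    by apply: measurable_le => //; exact: mrt.
  by apply: measurable_lt => //; exact: mrt.
apply/seteqP; split=> om /=.
  by move=> [c h]; split=> // y yB; have /andP[] := h y yB.
by move=> [c h]; split=> // y yB; have [-> ->] := h y yB.
Qed.

Lemma measurable_decode_coord (C : finType) (t0 : C) (u : C) (i : mark) :
  measurable ([set om | decode_fin t0 (om i) = u] : set (W [set: mark])).
Proof.
have -> : [set om | decode_fin t0 (om i) = u] = [set om : mark -> R | (decode_fin t0 @^-1` [set u]) (om i)] by [].
by apply: coord_measurable => //; exact: measurable_decode.
Qed.

Lemma measurable_run w x (u : opinion F) :
  measurable ([set om | run F theta om w x = u] : set (W [set: mark])).
Proof.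
elim: w x u => [|z w IH] x u; first exact: measurable_decode_coord.
rewrite /= /local_step; case: (x == z); last exact: IH.
pose G : (bool * {perm 'I_F} * opinion F * opinion F * opinion F)%type -> opinion F :=
  fun p => let: (b, s, a, l, r) := p in deff_update theta s a (if b then r else l).
pose X (om : W [set: mark]) := (dirn om z (count_mem z w), rank F om z (count_mem z w),
  run F theta om w z, run F theta om w (z - 1), run F theta om w (z + 1)).
rewrite (_ : [set _ | _] = [set om | (G @^-1` [set u]) (X om)]).
  apply: (measurable_finite_law (X := X)) => -[[[[b s] a] l] r].
  rewrite (_ : [set _ | _] = [set om | dirn om z (count_mem z w) = b] `&`
    [set om | rank F om z (count_mem z w) = s] `&` [set om | run F theta om w z = a] `&`
    [set om | run F theta om w (z - 1) = l] `&` [set om | run F theta om w (z + 1) = r]).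
    by do !apply: measurableI; [exact: measurable_decode_coord|
      exact: measurable_decode_coord|exact: IH|exact: IH|exact: IH].
  apply/seteqP; split=> om /=; first by move=> [-> -> -> -> ->].
  by move=> [[[[<- <-] <-] <-] <-].
by apply/seteqP; split=> om /=; rewrite /nbr; case: dirn.
Qed.

Lemma measurable_word B t w : measurable ([set om | word B om t = w] : set (W [set: mark])).
Proof.
pose A v := [set om : W [set: mark] | history B om t v].
have mA v : measurable (A v) by exact: measurable_history.
pose U v := A v `&` [set om | forall v', (if v' == v then setT else ~` A v') om].
have mU v : measurable (U v).
  apply: measurableI => //; apply: measurable_count_all => v'.
  by case: ifP => // _; exact: measurableC.
have UP v om : U v om <-> history B om t v /\ forall v', history B om t v' -> v' = v.
  split=> -[h1 h2]; split=> // v'.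
    by move=> h; have := h2 v'; case: eqVneq => // _ /(_ h).
  by case: eqVneq => // ne /h2 e; move: ne; rewrite e eqxx.
rewrite (_ : [set _ | _] = U w `|`
   ((if w == [::] then setT else set0) `&` [set om | forall v, (~` U v) om])).
  apply: measurableU => //; apply: measurableI; first by case: ifP.
  by apply: measurable_count_all => v; exact: measurableC.
apply/seteqP; split=> om /=; rewrite /word.
  case: xgetP => [v _ /UP Uv <-|none <-]; first by left.
  by right; split=> //= v /UP; exact: none.
case=> [/UP Uw|[]].
  by case: xgetP => [v _ [hv _]|/(_ w)//]; apply: Uw.2.
by case: eqP => // -> _ none; case: xgetP => // v _ /UP /none.
Qed.

Lemma measurable_box_path B t x (u : opinion F) :
  measurable ([set om | box_path F theta B om t x = u] : set (W [set: mark])).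
Proof.
rewrite (_ : [set _ | _] = [set om | exists w,
   ([set om | word B om t = w] `&` [set om | run F theta om w x = u]) om]).
  apply: measurable_count_ex => w; apply: measurableI.
    exact: measurable_word.
  exact: measurable_run.
apply/seteqP; split=> om /=; rewrite /box_path.
  by move=> h; exists (word B om t).
by move=> [w [->]].
Qed.

End MarkMeasurability.

(** * Almost sure regularity of the clocks *)

Section AlmostSure.
Context {R : realType} {d : measure_display} {T : measurableType d}.
Variable P : probability T R.

Definition almost_sure (A : set T) : Prop := measurable A /\ pr P (~` A) = 0.

Lemma almost_sureI A B : almost_sure A -> almost_sure B -> almost_sure (A `&` B).
Proof.
move=> [mA A0] [mB B0]; split; first exact: measurableI.
apply/eqP; rewrite eq_le pr_ge0 andbT setCI.
by rewrite (le_trans (prU_le _ _ _))// ?A0 ?B0 ?addr0//; exact: measurableC.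
Qed.

Lemma almost_sure_all (C : countType) (A : C -> set T) :
  (forall y, almost_sure (A y)) -> almost_sure [set om | forall y, A y om].
Proof.
move=> hA; split; first by apply: measurable_count_all => y; case: (hA y).
pose G n := if @pickle_inv C n is Some w then ~` A w else set0.
have hG n : measurable (G n) /\ pr P (G n) = 0.
  rewrite /G; case: pickle_inv => [w|]; last by rewrite pr0.
  by have [mA A0] := hA w; split=> //; exact: measurableC.
rewrite (_ : ~` _ = \bigcup_n G n).
  by apply: pr_bigcup0 => n; case: (hG n).
apply/seteqP; split=> om.
  move=> /existsNP[w nw]; exists (pickle w) => //.
  by rewrite /G pickleK_inv.
by move=> [n _]; rewrite /G; case: pickle_inv => // w /= nw h; exact: nw.
Qed.

Lemma pr_almost_sureI A B : almost_sure A -> measurable B -> pr P (B `&` A) = pr P B.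
Proof.
move=> [mA A0] mB; apply: (pr_eq_ae (N := ~` A)) => //.
- exact: measurableI.
- exact: measurableC.
- by move=> x [Bx _]; left.
- by move=> x Bx; have [|] := pselect (A x); [left|right].
Qed.

End AlmostSure.

(** The initial opinions enter through independence and two invariances, under translation and under
    flipping coordinates; this is how the uniform product measure is used. *)
Definition mark_law {R : realType} F (mu : probability (pspace R [set: mark]) R) : Prop :=
  [/\ forall (s : seq mark) (B : mark -> set R), uniq s ->
        (forall i, measurable (B i)) ->
        pr mu [set w | forall i, i \in s -> B i (w i)] =
        \prod_(i <- s) pr mu [set w | B i (w i)],
      forall x n (s : R), 0 <= s -> pr mu [set w | s < w (MTime x n)] = expR (- s),
      forall x n b, pr mu [set w | dirn w x n = b] = 2^-1,
      forall x n s, pr mu [set w | rank F w x n = s] = (F`!)%:R^-1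
    & (forall a i (B : set R), measurable B ->
        pr mu [set w | B (w (shift_mark a i))] = pr mu [set w | B (w i)]) /\
      (forall u i (B : set R), measurable B ->
        pr mu [set w | B (@xor_coord R F u i (w i))] = pr mu [set w | B (w i)])].

Section Law.
Variables (R : realType) (F theta : nat).
Implicit Types (B w : seq int) (x y z : int) (J : set mark).
Local Notation W J := (pspace R J).
Local Notation rtime x n := (fun om : mark -> R => ring_time om x n).
Variable mu : probability (W [set: mark]) R.
Hypothesis mu_law : mark_law F mu.

Let mu_indep := let: And5 h _ _ _ _ := mu_law in h.
Let mu_exp := let: And5 _ h _ _ _ := mu_law in h.

Let mT J (A : set (mark -> R)) : measurable (A : set (W J)) ->
  measurable (A : set (W [set: mark])).
Proof. exact: sub_space. Qed.

Let mrt x n : measurable_fun setT (rtime x n : W [set: mark] -> R).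
Proof. exact: measurable_ring_time. Qed.

Let mtau i : measurable_fun setT (fun om : W [set: mark] => om i).
Proof. exact: measurable_coord. Qed.

Lemma almost_sure_positive : almost_sure mu (@positive_times R).
Proof.
apply: (almost_sure_all (A := fun x => [set om : W setT | forall n, 0 < om (MTime x n)])) => x.
apply: (almost_sure_all (A := fun n => [set om : W setT | 0 < om (MTime x n)])) => n.
have m : measurable ([set om | 0 < om (MTime x n)] : set (W [set: mark])).
  exact: measurable_lt.
by split=> //; rewrite prC// mu_exp// oppr0 expR0 subrr.
Qed.

Lemma almost_sure_unbounded x (t : R) :
  almost_sure mu [set om | exists n, t < ring_time om x n].
Proof.
have mU : measurable ([set om | exists n, t < ring_time om x n] : set (W [set: mark])).
  by apply: measurable_count_ex => n; apply: measurable_lt => //; exact: mrt.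
split=> //.
rewrite -(pr_almost_sureI almost_sure_positive); last exact: measurableC.
have [t0|t0] := ltP t 0.
  rewrite (_ : _ `&` _ = set0) ?pr0//; apply/seteqP; split=> // om [nt _]; apply: nt.
  by exists 0%N; rewrite ring_time0.
pose S n : seq mark := map (MTime x) (iota 0 n).
(* If no ring comes after [t], each waiting time is at most [t]; for the first [n] of them this has
   probability [(1 - expR (- t)) ^+ n]. *)
pose G n := [set om : mark -> R | forall i, i \in S n -> [set r : R | r <= t] (om i)].
apply: (@pr_bigcap0 _ _ (W [set: mark]) mu G (fun n => (1 - expR (- t)) ^+ n)).
- apply: measurableI; first exact: measurableC.
  by case: almost_sure_positive.
- move=> n; apply: (measurable_coords (B := fun=> [set r : R | r <= t])) => // i.
  by rewrite (_ : [set r | _] = `]-oo, t]%classic).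
- move=> n om [nt pos] _ /mapP[k + ->] /=; rewrite mem_iota /= add0n => kn.
  have : ring_time om x k.+1 <= t.
    by rewrite leNgt; apply/negP => h; apply: nt; exists k.+1.
  apply: le_trans; rewrite ring_timeS lerDr.
  by rewrite -(ring_time0 om x); exact: ring_time_le.
- move=> n; rewrite (mu_indep (s := S n) (B := fun=> [set r : R | r <= t])); last 2 first.
  + by rewrite map_inj_uniq ?iota_uniq// => a b [].
  + by move=> i; rewrite (_ : [set r | _] = `]-oo, t]%classic).
  rewrite big_map (eq_bigr (fun=> 1 - expR (- t))) ?big_const_seq ?count_predT ?size_iota.
    by rewrite iter_mulr mulr1.
  move=> k _; rewrite -(mu_exp x k t0) -(prC (T := W [set: mark])); last exact: measurable_lt.
  by congr (pr mu _); apply/seteqP; split=> om /=; rewrite leNgt => /negP.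
- apply: cvg_expr; rewrite ger0_norm ?subr_ge0 ?expR_le1 ?oppr_le0//.
  by rewrite ltrBlDr ltrDl expR_gt0.
Qed.

(** A tie pins the mark [i] to a value [V] computed from other marks. Where [V - r] is nonnegative,
    the events that [om i] exceeds [V] and that it exceeds [V - r] have probabilities in ratio
    [expR (- r)], and a tie lies in the second but not in the first; then [r] tends to 0. *)
Lemma almost_sure_no_tie x y n m : x != y ->
  almost_sure mu [set om | ring_time om x n.+1 != ring_time om y m.+1].
Proof.
move=> xy; pose i := MTime x n; pose J := [set j | j <> i].
pose V (om : mark -> R) := ring_time om y m.+1 - ring_time om x n.
have mV : measurable_fun setT (V : W J -> R).
  apply: measurable_funB; apply: measurable_ring_time => k kn; rewrite /J/= /i.
    by move=> [yx _]; move: xy; rewrite yx eqxx.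
  by move=> [kE]; move: kn; rewrite kE ltnn.
(* On [E k] the lowered threshold [V - r] stays nonnegative for small [r], as [memoryless] requires;
   the events [E k] exhaust [V > 0]. *)
pose E k := [set om | k.+1%:R^-1 <= V om].
have mE k : measurable (E k : set (W J)) by exact: measurable_le.
pose tie := [set om : mark -> R | om i = V om].
have mtie : measurable (tie : set (W [set: mark])).
  have mVT := measurable_sub_space (@subsetT _ J) mV.
  rewrite (_ : tie = [set om | om i <= V om] `&` [set om | V om <= om i]).
    by apply: measurableI; exact: measurable_le.
  by apply/seteqP; split=> om /=; [rewrite /tie/= => ->|move=> [a b]; apply/le_anti; rewrite a b].
have tie0 k : pr mu (E k `&` tie) = 0.
  apply: (@pr_bigcap0 _ _ (W [set: mark]) mu (fun=> E k `&` tie) (fun j => (j + k).+1%:R^-1)) => //.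
  - by apply: measurableI => //; exact: mT (mE k).
  - by move=> _; apply: measurableI => //; exact: mT (mE k).
  - by move=> _.
  - move=> j /=; pose r : R := (j + k).+1%:R^-1; rewrite -/r; have r0 : 0 < r by rewrite invr_gt0.
    have mV' : measurable_fun setT ((fun om => V om - r) : W J -> R).
      exact: measurable_funB.
    have E0 om : E k om -> 0 <= V om - r.
      move=> /= h; rewrite subr_ge0 (le_trans _ h)// lef_pV2 ?posrE// ler_nat ltnS leq_addl//.
    have nJ : ~ J i by rewrite /J/= => /(_ erefl).
    have := memoryless mu_indep nJ (mu_exp x n) (mE k) mV' E0 (ltW r0).
    set A := E k `&` [set om | V om - r < om i].
    have -> : E k `&` [set om | V om - r + r < om i] = E k `&` [set om | V om < om i].
      by congr (_ `&` _); apply/seteqP; split=> om /=; rewrite subrK.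
    set A' := E k `&` _ => AE.
    have mVT := measurable_sub_space (@subsetT _ J) mV.
    have mVT' := measurable_sub_space (@subsetT _ J) mV'.
    have mA : measurable (A : set (W [set: mark])).
      by apply: measurableI; [exact: mT (mE k)|exact: measurable_lt].
    have mA' : measurable (A' : set (W [set: mark])).
      by apply: measurableI; [exact: mT (mE k)|exact: measurable_lt].
    have mEt : measurable (E k `&` tie : set (W [set: mark])).
      by apply: measurableI; [exact: mT (mE k)|].
    have : pr mu (E k `&` tie) + pr mu A' <= pr mu A.
      rewrite -(prU (T := W [set: mark]))//; last first.
        by apply/seteqP; split=> // om [[_ /= t1] [_ /=]]; rewrite t1 ltxx.
      apply: pr_le => //; first exact: measurableU.
      move=> om [[Ek /= tt]|[Ek /= h]]; split=> //=.
        by rewrite tt ltrBlDr ltrDl.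
      by rewrite (lt_trans _ h)// ltrBlDr ltrDl.
    rewrite AE => h; have a1 : pr mu A <= 1 by exact: pr_le1.
    have a0 := pr_ge0 mu A; have e1 := expR_ge1Dx (- r).
    have {}h : pr mu (E k `&` tie) <= (1 - expR (- r)) * pr mu A.
      by rewrite mulrBl mul1r lerBrDr.
    apply: (le_trans h); apply: (@le_trans _ _ (r * pr mu A)).
      by rewrite ler_wpM2r//; move: e1; lra.
    by rewrite ler_piMr// ltW.
  - by rewrite (cvg_shiftn k (@harmonic R)); exact: cvg_harmonic.
have mne : measurable ([set om | ring_time om x n.+1 != ring_time om y m.+1] : set (W [set: mark])).
  rewrite -[X in measurable X]setCK; apply: measurableC.
  rewrite (_ : ~` _ = tie)//; apply/seteqP; split=> om /=.
    by move=> /negP; rewrite negbK ring_timeS /tie/V/= => /eqP <-; rewrite addrAC subrr add0r.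
  by rewrite /tie/V/= => h; apply/negP; rewrite negbK ring_timeS h addrC subrK.
split=> //.
rewrite -(pr_almost_sureI almost_sure_positive); last exact: measurableC.
have U0 : pr mu (\bigcup_k (E k `&` tie)) = 0.
  apply: (pr_bigcup0 (T := W [set: mark])) => k//.
  by apply: measurableI => //; exact: mT (mE k).
apply/eqP; rewrite eq_le pr_ge0 andbT -U0; apply: pr_le.
- by apply: measurableI; [exact: measurableC|case: almost_sure_positive].
- by apply: bigcupT_measurable => k; apply: measurableI => //; exact: mT (mE k).
- move=> om [/= /negP + pos]; rewrite negbK ring_timeS => /eqP h.
  have Vt : V om = om i by rewrite /V -h addrAC subrr add0r.
  have V0 : 0 < V om by rewrite Vt; exact: pos.
  have [k _ /(_ k (leqnn k)) /= hk] := near_infty_natSinv_lt (PosNum V0).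
  by exists k => //; split=> //=; apply: ltW.
Qed.

Lemma almost_sure_regular : almost_sure mu (@regular R).
Proof.
rewrite (_ : (@regular R : set _) = @positive_times R `&`
  ([set om | forall x (t : nat), exists n, t%:R < ring_time om x n] `&`
   [set om | forall p : int * int * nat * nat, (if p.1.1.1 != p.1.1.2 then
      [set om | ring_time om p.1.1.1 p.1.2.+1 != ring_time om p.1.1.2 p.2.+1] else setT) om])).
  apply: almost_sureI; first exact: almost_sure_positive.
  apply: almost_sureI.
    apply: (almost_sure_all (A := fun x => [set om : W [set: mark] |
      forall t : nat, exists n, t%:R < ring_time om x n])) => x.
    apply: (almost_sure_all (A := fun t : nat =>
      [set om : W [set: mark] | exists n, t%:R < ring_time om x n])) => t.
    exact: almost_sure_unbounded.
  apply: almost_sure_all => -[[[x y] n] m] /=; case: ifP => xy.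
    exact: almost_sure_no_tie.
  by split; rewrite ?setCT ?pr0.
apply/seteqP; split=> om.
  move=> [pos unb ties]; split=> //; split=> [x t|[[[x y] n] m]] /=; first exact: unb.
  by case: ifP => // xy; exact: ties.
move=> [pos [unb ties]]; split=> // [x t|x y n m xy].
  have [n] := unb x (Num.truncn t).+1.
  move=> h; exists n; apply: le_lt_trans h.
  have [t0|/ltW t0] := leP 0 t; last by rewrite (le_trans t0).
  by have /andP[_ /ltW] := truncn_itv t0.
by have := ties (x, y, n, m); rewrite /= xy.
Qed.

End Law.

(** * Lower bound for a prescribed single ring in a window *)

Section Kernel.
Variables (R : realType) (F : nat).
Implicit Types (B w : seq int) (x y z : int) (J : set mark).
Local Notation W J := (pspace R J).
Local Notation rtime x n := (fun om : mark -> R => ring_time om x n).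
Local Notation positive_times := (@positive_times R).
Variable mu : probability (W [set: mark]) R.
Hypothesis mu_law : mark_law F mu.

Let mu_indep := let: And5 h _ _ _ _ := mu_law in h.
Let mu_exp := let: And5 _ h _ _ _ := mu_law in h.
Let mu_dir := let: And5 _ _ h _ _ := mu_law in h.
Let mu_rank := let: And5 _ _ _ h _ := mu_law in h.

Let mT J (A : set (mark -> R)) : measurable (A : set (W J)) ->
  measurable (A : set (W [set: mark])).
Proof. exact: sub_space. Qed.

Let m_after J (V : (mark -> R) -> R) (r : R) (i : mark) :
  measurable_fun setT (V : W J -> R) -> J i ->
  measurable ([set om | V om + r < om i] : set (W J)).
Proof.
by move=> mV Ji; apply: measurable_lt; [exact: measurable_funD|exact: measurable_coord].
Qed.

Let m_next J (L : seq int) (nn : int -> nat) (V : int -> (mark -> R) -> R) (r : R) :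
  (forall y, measurable_fun setT (V y : W J -> R)) ->
  measurable ([set om | forall y, y \in L -> V y om + r < om (MTime y (nn y))] :
    set (W (J `|` [set MTime y (nn y) | y in [set` L]]))).
Proof.
move=> mV; apply: (@measurable_seq_all _ (W (J `|` [set MTime y (nn y) | y in [set` L]]))
  _ L (fun y => [set om : mark -> R | V y om + r < om (MTime y (nn y))])) => y yL.
apply: m_after; last by right; exists y.
by apply: measurable_sub_space (mV y); left.
Qed.

(** One site is treated at a time: its waiting mark joins [J], while the marks of the other sites of
    [L] stay outside. *)
Lemma memoryless_seq J (E : set (mark -> R)) (L : seq int) (nn : int -> nat)
    (V : int -> (mark -> R) -> R) : uniq L ->
  measurable (E : set (W J)) ->
  (forall y, measurable_fun setT (V y : W J -> R)) ->
  (forall y om, y \in L -> E om -> 0 <= V y om) ->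
  (forall y, y \in L -> ~ J (MTime y (nn y))) ->
  pr mu (E `&` [set om | forall y, y \in L -> V y om + 1 < om (MTime y (nn y))]) =
  expR (- 1) ^+ size L *
  pr mu (E `&` [set om | forall y, y \in L -> V y om + 0 < om (MTime y (nn y))]).
Proof.
pose N (L : seq int) (r : R) := [set om : mark -> R | forall y, y \in L -> V y om + r < om (MTime y (nn y))].
elim: L J E => [|a L IH] J E; first by
  move=> *; rewrite expr0 mul1r; congr (pr mu (_ `&` _)); apply/seteqP; split.
move=> /= /andP[aL uL] mE mV V0 nJ.
pose T (r : R) := [set om : mark -> R | V a om + r < om (MTime a (nn a))].
have NS (r : R) : N (a :: L) r = T r `&` N L r.
  apply/seteqP; split=> om /=.
    by move=> h; split=> [|y yL]; apply: h; rewrite inE ?eqxx// yL orbT.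
  by move=> [h1 h2] y; rewrite inE => /predU1P[->//|]; exact: h2.
rewrite -/(N (a :: L) 1) -/(N (a :: L) 0) !NS.
have [J1 J1E] : exists J1 : set mark, J1 = J `|` [set MTime a (nn a)] by eexists.
have JJ1 : J `<=` J1 by rewrite J1E; left.
rewrite setIA (IH J1); first last.
- move=> y yL; rewrite J1E => -[/(nJ y)|/= [ya _]]; last by move: aL; rewrite -ya yL.
  by apply; rewrite inE yL orbT.
- by move=> y om yL [Eom _]; apply: V0; rewrite ?inE ?yL ?orbT.
- by move=> y; apply: measurable_sub_space (mV y).
- apply: measurableI; first exact: sub_space mE.
  by apply: m_after; [exact: measurable_sub_space (mV a)|rewrite J1E; right].
- by [].
rewrite -/(N L 0) exprSr -mulrA; congr (_ * _).
have mN (r : R) : measurable (N L r : set (W (J `|` [set MTime y (nn y) | y in [set` L]]))).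
  exact: m_next.
have mE2 : measurable (E `&` N L 0 : set (W (J `|` [set MTime y (nn y) | y in [set` L]]))).
  by apply: measurableI => //; apply: sub_space mE; left.
rewrite setIAC (memoryless mu_indep _ (mu_exp a (nn a)) mE2)//.
- congr (_ * pr mu _); apply/seteqP; split=> om; rewrite /T /= addr0.
    by move=> [[Eom Nom] h].
  by move=> [Eom [h Nom]].
- by move=> [/(nJ a (mem_head _ _))//|/= [y yL [ya _]]]; move: aL; rewrite -ya yL.
- by apply: measurable_sub_space (mV a); left.
- by move=> om [Eom _]; apply: V0 => //; exact: mem_head.
Qed.

(** The past up to time [s], which contains a random number of rings, expressed by invariance under
    [agree] instead of a sigma-algebra. *)
Definition adapted (s : R) (E : set (mark -> R)) : Prop :=
  forall om om', positive_times om -> positive_times om' -> agree s om om' ->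
  E om -> E om'.

(** Exactly one ring occurs in [B] during [(s, s + 1]]: at [z], with direction [b] and ranking [rho]. *)
Definition single_ring B (s : R) z (b : bool) (rho : {perm 'I_F}) (w : seq int) om : Prop :=
  [/\ history B om s w, history B om (s + 1) (z :: w),
      dirn om z (count_mem z w) = b & rank F om z (count_mem z w) = rho].

(** The factors are, in order: the direction, the ranking, a waiting time above 1 after the ring of
    [z] so that it does not ring twice, a ring of [z] within the unit of time, and silence of the
    other [m - 1] sites. *)
Definition kernel_cst (m : nat) : R :=
  2^-1 * (F`!)%:R^-1 * expR (- 1) * (1 - expR (- 1)) * expR (- 1) ^+ m.-1.

Lemma kernel_cst_gt0 m : 0 < kernel_cst m.
Proof.
have e1 : expR (- 1) < 1 :> R by rewrite expR_lt1// ltrN10.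
rewrite /kernel_cst !mulr_gt0 ?expR_gt0 ?exprn_gt0 ?expR_gt0 ?subr_gt0 ?invr_gt0 ?ltr0n ?fact_gt0//.
Qed.

(** The marks read by the time the word of [B] is [w]. Sites outside [B] keep all their marks, so
    that an event of the past may look at a box larger than [B]. *)
Definition used_marks B w : set mark := fun i =>
  match i with
  | MInit _ => True
  | MTime x n | MDir x n | MRank x n => x \in B -> (n < count_mem x w)%N
  end.

Lemma measurable_restrict_marks J (c : R) :
  measurable_fun setT (restrict_marks J c : W J -> W [set: mark]).
Proof.
apply: measurable_to_space => i _; rewrite /restrict_marks.
by case: (boolP (i \in J)) => [/set_mem|] Ji; [exact: measurable_coord|exact: measurable_cst].
Qed.

Lemma positive_restrict J (c : R) om : 0 < c -> positive_times om ->
  positive_times (restrict_marks J c om).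
Proof. by move=> c0 pos x n; rewrite /restrict_marks; case: ifP. Qed.

Lemma agree_restrict B (s : R) w om : 0 <= s -> positive_times om ->
  (forall y, y \in B -> s < ring_time om y (count_mem y w).+1) ->
  agree s om (restrict_marks (used_marks B w) (s + 1) om).
Proof.
move=> s0 pos nxt; set om' := restrict_marks _ _ _.
have pos' : positive_times om' by apply: positive_restrict => //; rewrite ltr_wpDl.
have inU i : used_marks B w i -> om' i = om i.
  by move=> Ui; rewrite /om' /restrict_marks mem_set.
split=> [x|x n h]; first by rewrite inU.
suff : x \in B -> (n < count_mem x w)%N by move=> lt; rewrite !inU.
move=> xB; rewrite ltnNge; apply/negP => cn; case: h => h.
- have := lt_le_trans (nxt x xB) (le_trans (ring_time_le x pos (n := (count_mem x w).+1) (m := n.+1) cn) h).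
  by rewrite ltxx.
- have om's : om' (MTime x n) = s + 1.
    by rewrite /om' /restrict_marks memNset// => /(_ xB); rewrite ltnNge cn.
  have := ring_time_le x pos' (leq0n n); rewrite ring_time0.
  by move: h; rewrite ring_timeS om's; lra.
Qed.

Lemma ring_time_restrict B (c : R) w om y n : (y \in B -> n <= count_mem y w)%N ->
  ring_time (restrict_marks (used_marks B w) c om) y n = ring_time om y n.
Proof.
move=> h; apply: eq_bigr => k _; rewrite /restrict_marks mem_set// => /h.
exact: leq_trans.
Qed.

Section OneRing.
Variables (B : seq int) (z : int) (b : bool) (rho : {perm 'I_F}) (s : R).
Hypotheses (uB : uniq B) (zB : z \in B) (s0 : 0 <= s).
Variable w : seq int.
Variable E : set (mark -> R).
Hypothesis mE : measurable (E : set (W [set: mark])).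
Hypothesis aE : adapted s E.
Hypothesis Ew : E `<=` [set om | history B om s w /\ positive_times om].

Let U := used_marks B w.
(** [E] splits into a part [E2] read off the used marks and the condition that no further ring of
    [B] has occurred by time [s]. Here [V y] is the time elapsed since the last ring of [y], and
    [N L r] says that the sites of [L] stay silent from [s] to [s + r]. *)
Let E2 : set (mark -> R) := restrict_marks U (s + 1) @^-1` E.
Let nn y := count_mem y w.
Let V y (om : mark -> R) := s - ring_time om y (nn y).
Let N (L : seq int) (r : R) := [set om : mark -> R |
  forall y, y \in L -> V y om + r < om (MTime y (nn y))].

Let mE2 : measurable (E2 : set (W U)).
Proof. by rewrite -[X in measurable X]setTI; exact: measurable_restrict_marks. Qed.

Let s1 : 0 < s + 1. Proof. by rewrite ltr_wpDl. Qed.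

Let E_split : E = E2 `&` N B 0 `&` positive_times.
Proof.
apply/seteqP; split=> om.
- move=> Eom; have [h pos] := Ew Eom.
  have nxt y : y \in B -> s < ring_time om y (nn y).+1 by move=> /h.2 /andP[].
  split=> //; split.
    apply: aE Eom => //; first exact: positive_restrict.
    exact: agree_restrict.
  by move=> y yB; have := nxt y yB; rewrite ring_timeS /V addr0 ltrBlDl.
- move=> [[E2om Nom] pos]; have [h pos'] := Ew E2om.
  apply: aE E2om => //; apply: agreeC; apply: agree_restrict => // y yB.
  by have := Nom y yB; rewrite ring_timeS /V addr0 ltrBlDl.
Qed.

Let V0 y om : y \in B -> E2 om -> 0 <= V y om.
Proof.
move=> yB E2om; have [h _] := Ew E2om; have /andP[h1 _] := h.2 y yB.
by rewrite /V subr_ge0; move: h1; rewrite ring_time_restrict.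
Qed.

Let mV y : measurable_fun setT (V y : W U -> R).
Proof.
apply: measurable_funB => //; apply: measurable_ring_time => k kn.
by rewrite /U /used_marks.
Qed.

Let nU y : y \in B -> ~ U (MTime y (nn y)).
Proof. by move=> yB /(_ yB); rewrite ltnn. Qed.

Let L := rem z B.
Let fresh : set (mark -> R) := [set om | dirn om z (nn z) = b] `&`
  ([set om | rank F om z (nn z) = rho] `&` [set om | 1 < om (MTime z (nn z).+1)]).
Let fresh_marks : set mark :=
  [set MDir z (nn z)] `|` ([set MRank z (nn z)] `|` [set MTime z (nn z).+1]).

Let uL : uniq L. Proof. exact: rem_uniq. Qed.

Let LB y : y \in L -> y \in B. Proof. by rewrite mem_rem_uniq// => /andP[]. Qed.

Let Lz y : y \in L -> y != z. Proof. by rewrite mem_rem_uniq// => /andP[]. Qed.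

Let mdec (C : finType) (t0 u : C) (i : mark) :
  measurable ([set om | decode_fin t0 (om i) = u] : set (W [set i])).
Proof.
have -> : [set om | decode_fin t0 (om i) = u] =
          [set om : mark -> R | (decode_fin t0 @^-1` [set u]) (om i)] by [].
by apply: coord_measurable => //; exact: measurable_decode.
Qed.

Let mtime (i : mark) : measurable ([set om | 1 < om i] : set (W [set i])).
Proof. by apply: measurable_lt => //; exact: measurable_coord. Qed.

Let mfresh : measurable (fresh : set (W fresh_marks)).
Proof.
have h1 : [set MDir z (nn z)] `<=` fresh_marks by move=> i ->; left.
have h2 : [set MRank z (nn z)] `<=` fresh_marks by move=> i ->; right; left.
have h3 : [set MTime z (nn z).+1] `<=` fresh_marks by move=> i ->; right; right.
apply: measurableI; first exact: (sub_space h1 (mdec false b (i := MDir z (nn z)))).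
by apply: measurableI; [exact: (sub_space h2 (mdec 1%g rho (i := MRank z (nn z))))|exact: (sub_space h3 (@mtime (MTime z (nn z).+1)))].
Qed.

Let pr_fresh : pr mu fresh = 2^-1 * (F`!)%:R^-1 * expR (- 1).
Proof.
rewrite /fresh -mulrA -(mu_exp z (nn z).+1 ler01) -(mu_rank z (nn z) rho) -(mu_dir z (nn z) b).
rewrite -(@space_indep _ _ mu mu_indep [set MRank z (nn z)] [set MTime z (nn z).+1])//.
- rewrite -(@space_indep _ _ mu mu_indep [set MDir z (nn z)]
    ([set MRank z (nn z)] `|` [set MTime z (nn z).+1]))//.
  + by apply/seteqP; split=> // i [/= -> [|]] /= e; discriminate e.
  + exact: (mdec false b (i := MDir z (nn z))).
  + have h2 : [set MRank z (nn z)] `<=` [set MRank z (nn z)] `|` [set MTime z (nn z).+1].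
      by left.
    have h3 : [set MTime z (nn z).+1] `<=` [set MRank z (nn z)] `|` [set MTime z (nn z).+1].
      by right.
    by apply: measurableI; [exact: (sub_space h2 (mdec 1%g rho (i := MRank z (nn z))))|exact: (sub_space h3 (@mtime (MTime z (nn z).+1)))].
- by apply/seteqP; split=> // i [/= ->] e; discriminate e.
- exact: (mdec 1%g rho (i := MRank z (nn z))).
Qed.

Let target := N L 1 `&` ([set om | V z om < om (MTime z (nn z))] `&`
   ~` [set om | V z om + 1 < om (MTime z (nn z))]) `&` fresh.

Let target_sub : E2 `&` target `&` positive_times `<=` E `&` single_ring B s z b rho w.
Proof.
move=> om [[E2om [[NL [/= z1 z2]] [bE [rE fz]]]] pos].
have NB : N B 0 om.
  move=> y yB; rewrite addr0; have [->//|yz] := eqVneq y z.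
  have yL : y \in L by rewrite mem_rem_uniq// inE yz.
  by apply: lt_trans (NL y yL); rewrite ltrDl.
have Eom : E om by rewrite E_split.
have [[cw hw] _] := Ew Eom.
have ltL y : y \in B -> y != z -> s + 1 < ring_time om y (nn y).+1.
  move=> yB yz; have yL : y \in L by rewrite mem_rem_uniq// inE yz.
  by have := NL y yL; rewrite ring_timeS /V; lra.
have zs : ring_time om z (nn z).+1 <= s + 1.
  by move/negP : z2; rewrite -leNgt ring_timeS /V; lra.
have sz : s < ring_time om z (nn z).+1.
  by move: z1; rewrite ring_timeS /V; lra.
split=> //; split=> //; split=> /=.
- split=> // y yB yz; have /andP[h _] := hw y yB; apply/andP; split.
    exact: le_lt_trans h sz.
  exact: le_lt_trans zs (ltL y yB yz).
- move=> y yB; have [->|yz] := eqVneq y z.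
    rewrite ?eqxx add1n zs ring_timeS -/(nn z).
    by move: sz fz => /=; lra.
  rewrite ?[z == y]eq_sym ?(negbTE yz) add0n ltL// andbT.
  by have /andP[h _] := hw y yB; rewrite (le_trans h)// lerDl.
Qed.

Let JL : set mark := U `|` [set MTime y (nn y) | y in [set` L]].
Let JLz : set mark := JL `|` [set MTime z (nn z)].

Let pr_target : pr mu (E2 `&` target) = kernel_cst (size B) * pr mu (E2 `&` N B 0).
Proof.
have nUz := nU zB.
have nJL : ~ JL (MTime z (nn z)).
  by move=> [//|/= [y yL [yz _]]]; have := Lz yL; rewrite yz eqxx.
have [mE2L mNL _] : [/\ measurable (E2 : set (W JL)),
    forall r, measurable (N L r : set (W JL)) & True].
  split=> // [|r]; first by apply: sub_space mE2; left.
  exact: m_next.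
have mVL : measurable_fun setT (V z : W JL -> R).
  by apply: measurable_sub_space (mV z); left.
pose A r := E2 `&` N L 1 `&` [set om | V z om + r < om (MTime z (nn z))].
have mA r : measurable (A r : set (W JLz)).
  apply: measurableI.
    by apply: (sub_space (J1 := JL)); [left|apply: measurableI].
  apply: m_after; last by right.
  by apply: measurable_sub_space mVL; left.
have e1 : expR (- 1) < 1 :> R by rewrite expR_lt1// ltrN10.
have pA1 : pr mu (A 1) = expR (- 1) * pr mu (A 0).
  have := memoryless mu_indep nJL (mu_exp z (nn z)) (measurableI _ _ mE2L (mNL 1)) mVL
    (fun om h => V0 zB h.1) ler01.
  move=> ->; congr (_ * pr mu (_ `&` _)); apply/seteqP; split=> om /=; by rewrite addr0.
have pA0 : pr mu (A 0) = expR (- 1) ^+ (size B).-1 * pr mu (E2 `&` N B 0).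
  pose Uz : set mark := U `|` [set MTime z (nn z)].
  have mVz y : measurable_fun setT (V y : W Uz -> R).
    by apply: measurable_sub_space (mV y); left.
  pose Ez := E2 `&` [set om | V z om + 0 < om (MTime z (nn z))].
  have mEz : measurable (Ez : set (W Uz)).
    apply: measurableI; first by apply: sub_space mE2; left.
    by apply: m_after; [exact: mVz|right].
  have vz y om : y \in L -> Ez om -> 0 <= V y om.
    by move=> yL [E2om _]; apply: V0 => //; exact: LB.
  have nz y : y \in L -> ~ Uz (MTime y (nn y)).
    by move=> yL [/(nU (LB yL))//|/= [yz]]; have := Lz yL; rewrite yz eqxx.
  rewrite -(size_rem zB) -/L /A setIAC (memoryless_seq uL mEz mVz vz nz) /Ez.
  congr (_ * pr mu _); apply/seteqP; split=> om /=.
    move=> [[E2om h] NL]; split=> // y yB; have [->//|yz] := eqVneq y z.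
    by apply: NL; rewrite mem_rem_uniq// inE yz.
  move=> [E2om NB]; split; first by split=> //; exact: NB.
  by move=> y yL; apply: NB; exact: LB.
have -> : E2 `&` target = (A 0 `\` A 1) `&` fresh.
  apply/seteqP; split=> om; rewrite /target /A /= ?addr0.
    by move=> [E2om [[NL [h1 h2]] fr]]; split=> //; split=> // -[_].
  move=> [[[[E2om NL] h1] h2] fr]; split=> //; split=> //; split=> //; split=> //.
  by move=> h; apply: h2.
rewrite (space_indep mu_indep (J1 := JLz) (J2 := fresh_marks))//; last first.
- by apply: measurableD.
- apply/seteqP; split=> // i [Ji Fi].
  have nUf : fresh_marks i -> ~ U i.
    by move=> [/= ->|[/= ->|/= ->]] /(_ zB); rewrite /nn ?ltnn// ltnNge leqnSn.
  case: Ji => [[Ui|/= [y yL yi]]|/= iz]; first exact: nUf Fi Ui.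
  + case: Fi => [/= E1|[/= E1|/= E1]]; rewrite -yi in E1; try discriminate E1.
    by case: E1 => yz _; have := Lz yL; rewrite yz eqxx.
  + case: Fi => [/= E1|[/= E1|/= E1]]; rewrite iz in E1; try discriminate E1.
    by case: E1 => /eqP; rewrite ltn_eqF.
have mAT r : measurable (A r : set (W [set: mark])) := mT (mA r).
have A10 : A 0 `&` A 1 = A 1.
  by apply/setIidr => om [h1 /= h2]; split=> //=; lra.
have := prID mu (mAT 0) (mAT 1); rewrite A10 pA1 => h.
have -> : pr mu (A 0 `\` A 1) = (1 - expR (- 1)) * pr mu (A 0) by move: h; lra.
by rewrite pr_fresh pA0 /kernel_cst; ring.
Qed.

Lemma one_ring_word :
  measurable ([set om | single_ring B s z b rho w om] : set (W [set: mark])) ->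
  kernel_cst (size B) * pr mu E <= pr mu (E `&` single_ring B s z b rho w).
Proof.
move=> mS; have apos := almost_sure_positive mu_law.
have [mpos _] := apos.
have mN (L' : seq int) (r : R) : measurable (N L' r : set (W [set: mark])).
  apply: (@sub_space _ _ (U `|` [set MTime y (nn y) | y in [set` L']])) => //.
  exact: m_next.
have mtarget : measurable (target : set (W [set: mark])).
  apply: measurableI; last exact: (mT mfresh).
  apply: measurableI; first exact: mN.
  have mVT := measurable_sub_space (@subsetT _ U) (mV z).
  apply: measurableI; last apply: measurableC; apply: measurable_lt => //.
  - exact: measurable_coord.
  - exact: measurable_funD.
  - exact: measurable_coord.
rewrite {1}E_split pr_almost_sureI//; last by apply: measurableI => //; exact: mT mE2.
rewrite -pr_target -(pr_almost_sureI apos); last by apply: measurableI => //; exact: mT mE2.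
apply: pr_le => //.
- by apply: measurableI => //; apply: measurableI => //; exact: mT mE2.
- exact: measurableI.
Qed.

End OneRing.

Lemma measurable_single_ring B (s : R) z (b : bool) (rho : {perm 'I_F}) w :
  measurable ([set om | single_ring B s z b rho w om] : set (W [set: mark])).
Proof.
rewrite (_ : [set _ | _] = [set om | history B om s w] `&`
  [set om | history B om (s + 1) (z :: w)] `&`
  [set om | decode_fin false (om (MDir z (count_mem z w))) = b] `&`
  [set om | decode_fin 1%g (om (MRank z (count_mem z w))) = rho]).
  apply: measurableI; last exact: measurable_decode_coord.
  apply: measurableI; last exact: measurable_decode_coord.
  by apply: measurableI; exact: measurable_history.
by apply/seteqP; split=> om /= [] => [h1 h2 h3 h4|[[h1 h2] h3] h4].
Qed.

(** The word at time [s] is random: the bound is proved for each word separately and summed over the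
    countably many words. *)
Lemma kernel_bound B (s : R) z (b : bool) (rho : {perm 'I_F}) (E : set (mark -> R)) :
  uniq B -> z \in B -> 0 <= s ->
  measurable (E : set (W [set: mark])) -> adapted s E ->
  kernel_cst (size B) * pr mu E <=
  pr mu (E `&` [set om | exists w, single_ring B s z b rho w om]).
Proof.
move=> uB zB s0 mE aE.
have apos := almost_sure_positive mu_law; have [mpos _] := apos.
have areg := almost_sure_regular mu_law; have [mreg _] := areg.
pose Ew w := E `&` [set om | history B om s w] `&` positive_times.
have mEw w : measurable (Ew w : set (W [set: mark])).
  by apply: measurableI => //; apply: measurableI => //; exact: measurable_history.
have mS w : measurable ([set om | single_ring B s z b rho w om] : set (W [set: mark])).
  exact: measurable_single_ring.
have dEw w1 w2 : w1 != w2 -> Ew w1 `&` Ew w2 = set0.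
  move=> ne; apply/seteqP; split=> // om [[[_ h1] pos] [[_ h2] _]].
  by move: ne; rewrite (history_uniq pos h1 h2) eqxx.
have mU : measurable (\bigcup_w Ew w : set (W [set: mark])).
  by apply: countable_bigcupT_measurable => //; exact: countableP.
apply: (@le_trans _ _ (kernel_cst (size B) * pr mu (\bigcup_w Ew w))).
  rewrite ler_pM2l ?kernel_cst_gt0// -(pr_almost_sureI areg mE).
  apply: pr_le => //; first exact: measurableI.
  move=> om [Eom reg]; have [w hw] := history_exists reg uB s0.
  by exists w => //; split=> //; case: reg.
apply: (@le_trans _ _ (pr mu (\bigcup_w (Ew w `&` single_ring B s z b rho w)))).
  apply: (@pr_countable_partition _ _ (W [set: mark])) => //.
  - by move=> w; apply: measurableI => //; exact: mS.
  - move=> w1 w2 ne; apply/seteqP; split=> // om [[h1 _] [h2 _]].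
    by rewrite -(dEw _ _ ne).
  - move=> w; apply: one_ring_word => //.
      move=> om om' pos pos' ag [[Eom h] _]; split=> //; split; first exact: (aE om).
      exact: (agree_history pos pos' (lexx s) ag h).
    by move=> om [[_ h] pos].
apply: pr_le.
- by apply: countable_bigcupT_measurable => [|w]; [exact: countableP|by apply: measurableI => //; exact: mS].
- by apply: measurableI => //; apply: measurable_count_ex => w; exact: mS.
- by move=> om [w _ [[[Eom _] _] h]]; split=> //; exists w.
Qed.

End Kernel.

(** * Determining laws from elementary events *)

Section FiniteLaws.
Context {R : realType} {d : measure_display} {T : measurableType d}.
Variable P : probability T R.

Lemma finite_law_sum (C : finType) (Y : T -> C) (U : set C) (E : set T) :
  measurable E -> (forall u, measurable [set w | Y w = u]) ->
  pr P ([set w | U (Y w)] `&` E) = \sum_(u | `[< U u >]) pr P ([set w | Y w = u] `&` E).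
Proof.
move=> mE mY; have mS s : measurable ([set w | Y w \in (s : seq C)] `&` E).
  by apply: measurableI => //; exact: (measurable_finite_law [set u | u \in s]).
have h (s : seq C) : uniq s ->
    pr P ([set w | Y w \in s] `&` E) = \sum_(u <- s) pr P ([set w | Y w = u] `&` E).
  elim: s => [_|u s IHs /= /andP[us ss]].
    by rewrite big_nil -(pr0 P); congr (pr P _); apply/seteqP; split=> w [].
  rewrite big_cons -IHs// -prU//; [congr (pr P _)|exact: measurableI|].
    rewrite -setIUl; congr (_ `&` E); apply/seteqP; split=> w /=; rewrite inE.
      by move=> /orP[/eqP|]; [left|right].
    by move=> [->|->]; rewrite ?eqxx ?orbT.
  by apply/seteqP; split=> // w [[/= -> _] [/= ws _]]; rewrite ws in us.
rewrite -big_filter -h ?filter_uniq ?index_enum_uniq//; congr (pr P (_ `&` E)).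
by apply/seteqP; split=> w /=; rewrite mem_filter mem_index_enum andbT asboolE.
Qed.

Lemma finite_law_eq (C : finType) (Y1 Y2 : T -> C) (U : set C) :
  (forall u, measurable [set w | Y1 w = u]) -> (forall u, measurable [set w | Y2 w = u]) ->
  (forall u, pr P [set w | Y1 w = u] = pr P [set w | Y2 w = u]) ->
  pr P [set w | U (Y1 w)] = pr P [set w | U (Y2 w)].
Proof.
move=> m1 m2 e; rewrite -[X in pr P X]setIT -[X in _ = pr P X]setIT !finite_law_sum//.
by apply: eq_bigr => u _; rewrite !setIT.
Qed.

Lemma finite_law_indep (C : finType) (Y : T -> C) (U : set C) (E : set T) :
  measurable E -> (forall u, measurable [set w | Y w = u]) ->
  (forall u, pr P ([set w | Y w = u] `&` E) = pr P [set w | Y w = u] * pr P E) ->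
  pr P ([set w | U (Y w)] `&` E) = pr P [set w | U (Y w)] * pr P E.
Proof.
move=> mE mY e; rewrite -[X in _ = pr P X * _]setIT !finite_law_sum// mulr_suml.
by apply: eq_bigr => u _; rewrite setIT.
Qed.

Lemma ray_law_eq (X1 X2 : T -> R) (B : set R) :
  measurable_fun setT X1 -> measurable_fun setT X2 ->
  (forall s, pr P [set w | s < X1 w] = pr P [set w | s < X2 w]) ->
  measurable B -> pr P [set w | B (X1 w)] = pr P [set w | B (X2 w)].
Proof.
move=> m1 m2 e mB.
have mp (X : T -> R) (A : set R) : measurable_fun setT X -> measurable A -> measurable (X @^-1` A).
  by move=> mX mA; rewrite -[Y in measurable Y]setTI; apply: mX.
have ray (X : T -> R) (s : R) : X @^-1` `]s, +oo[ = [set w | s < X w].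
  by apply/seteqP; split=> w /=; rewrite in_itv/= andbT.
pose Q (A : set R) := pr P [set w | A (X1 w)] = pr P [set w | A (X2 w)].
have mE : (measurable : set (set R)) = <<s @RGenOInfty.G R >>.
  exact: RGenOInfty.measurableE.
suff : forall A, <<s @RGenOInfty.G R >> A -> Q A by apply; rewrite -mE.
apply: (@dynkin_induction _ _ (@RGenOInfty.G R) Q).
- exact: mE.
- move=> _ _ [x ->] [y ->]; exists (Order.max x y).
  apply/seteqP; split=> r /=; rewrite !in_itv/= !andbT gt_max.
    by move=> [-> ->].
  by move=> /andP[].
- by [].
- by move=> _ [x ->]; have := e x; rewrite -(ray X1) -(ray X2).
- move=> A mA h.
  have h' : pr P (X1 @^-1` A) = pr P (X2 @^-1` A) by exact: h.
  suff : pr P (~` (X1 @^-1` A)) = pr P (~` (X2 @^-1` A)) by [].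
  by rewrite !prC ?h'//; exact: mp.
- move=> G mG tG h.
  have c (X : T -> R) : measurable_fun setT X ->
      (fun n => \sum_(0 <= k < n) pr P (X @^-1` G k)) @ \oo --> pr P (X @^-1` (\bigcup_k G k)).
    move=> mX; rewrite preimage_bigcup; apply: pr_bigcup; first by move=> n; exact: mp.
    apply/trivIsetP => i j _ _ ij; rewrite -preimage_setI.
    by move/trivIsetP : tG => /(_ i j Logic.I Logic.I ij) ->; rewrite preimage_set0.
  have c1 := c _ m1; have c2 := c _ m2.
  have e' : (fun n => \sum_(0 <= k < n) pr P (X1 @^-1` G k)) =
            (fun n => \sum_(0 <= k < n) pr P (X2 @^-1` G k)).
    by apply/funext => n; apply: eq_bigr => k _; exact: h.
  by move: c1; rewrite e' => c1; exact: (cvg_unique (@Rhausdorff R) c1 c2).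
Qed.

End FiniteLaws.

(** * The law of the coded marks *)

Section MarksLaw.
Variables (F : nat) (R : realType) (d : measure_display) (Omega : measurableType d).
Variable P : probability Omega R.
Variables (eta0 : int -> Omega -> opinion F) (tau : int -> nat -> Omega -> R)
  (dir : int -> nat -> Omega -> bool) (rk : int -> nat -> Omega -> {perm 'I_F}).
Hypothesis marks : graphical_marks eta0 tau dir rk P.

Definition marks_of (w : Omega) : mark -> R := fun i =>
  match i with
  | MInit x => encode_fin (eta0 x w)
  | MTime x n => tau x n w
  | MDir x n => encode_fin (dir x n w)
  | MRank x n => encode_fin (rk x n w)
  end.

Let X i w := marks_of w i.

Let m_ini x u : measurable [set w | eta0 x w = u].
Proof. by have [h _ _ _ _] := marks; have [] := h x u. Qed.
Let m_dir x n u : measurable [set w | dir x n w = u].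
Proof. by have [_ _ h _ _] := marks; have [] := h x n u. Qed.
Let m_rk x n u : measurable [set w | rk x n w = u].
Proof. by have [_ _ _ h _] := marks; have [] := h x n u. Qed.
Let m_tau x n : measurable_fun setT (tau x n).
Proof. by have [_ h _ _ _] := marks; have [] := h x n. Qed.

Let mX i (B : set R) : measurable B -> measurable [set w | B (X i w)].
Proof.
move=> mB; case: i => [x|x n|x n|x n].
- exact: (measurable_finite_law (encode_fin @^-1` B) (m_ini x)).
- by rewrite -[Y in measurable Y]setTI; exact: m_tau.
- exact: (measurable_finite_law (encode_fin @^-1` B) (m_dir x n)).
- exact: (measurable_finite_law (encode_fin @^-1` B) (m_rk x n)).
Qed.

Lemma measurable_marks_of :
  measurable_fun setT (marks_of : Omega -> pspace R [set: mark]).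
Proof.
apply: measurable_to_space => i _ _ B mB; rewrite setTI; exact: mX.
Qed.

Let ev i := mark_events eta0 tau dir rk i.

Let mev i E : ev i E -> measurable E.
Proof.
case: i => [x|x n|x n|x n] [u] /= hu <-.
- exact: m_ini.
- by rewrite -[Y in measurable Y]setTI; exact: m_tau.
- exact: m_dir.
- exact: m_rk.
Qed.

Let pr_seq (s : seq mark) (C : mark -> set Omega) : uniq s ->
  (forall i, i \in s -> ev i (C i)) ->
  pr P [set w | forall i, i \in s -> C i w] = \prod_(i <- s) pr P (C i).
Proof.
move=> us hC; have [_ _ _ _ ind] := marks.
have inj : injective (tnth (in_tuple s)).
  by apply/tuple_uniqP.
have hE k : ev (tnth (in_tuple s) k) (C (tnth (in_tuple s) k)).
  by apply: hC; exact: mem_tnth.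
have := ind _ _ inj (fun k => C (tnth (in_tuple s) k)) hE.
have -> : \bigcap_(k in [set: 'I_(size s)]) C (tnth (in_tuple s) k) =
          [set w | forall i, i \in s -> C i w].
  apply/seteqP; split=> w /=.
    by move=> h i si; have /tnthP[k ->] : i \in in_tuple s by []; exact: h.
  by move=> h k _; apply: h; exact: mem_tnth.
rewrite -(big_tnth _ _ _ xpredT (fun i => P (C i))) => h.
have hP i : i \in s -> P (C i) = (pr P (C i))%:E by move=> /hC /mev /prE ->.
have prodE : (\prod_(i <- s) P (C i) = (\prod_(i <- s) pr P (C i))%:E)%E.
  elim: (s) hP => [|a l IH] hl; first by rewrite !big_nil.
  rewrite !big_cons hl ?mem_head// IH ?EFinM// => i il.
  by apply: hl; rewrite inE il orbT.
by rewrite /pr h prodE.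
Qed.

Let upd (C : mark -> set Omega) i (E : set Omega) j := if j == i then E else C j.

Let mseq (s : seq mark) (C : mark -> set Omega) : (forall i, i \in s -> measurable (C i)) ->
  measurable [set w | forall i, i \in s -> C i w].
Proof. exact: measurable_seq_all. Qed.

(** The given independence concerns single values of the discrete marks. General Borel conditions
    are introduced one mark at a time: the marks in [s1] already carry them, those in [s2] still
    carry elementary events. *)
Let indep2 (B : mark -> set R) (s1 s2 : seq mark) (C : mark -> set Omega) :
  (forall i, measurable (B i)) -> uniq (s1 ++ s2) ->
  (forall i, i \in s2 -> ev i (C i)) ->
  pr P ([set w | forall i, i \in s1 -> B i (X i w)] `&`
        [set w | forall i, i \in s2 -> C i w]) =
  \prod_(i <- s1) pr P [set w | B i (X i w)] * \prod_(i <- s2) pr P (C i).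
Proof.
move=> mB; elim: s1 s2 C => [|a s1 IH] s2 C.
  move=> /= u hC; rewrite big_nil mul1r -pr_seq//; congr (pr P _).
  by apply/seteqP; split=> w //= [].
rewrite /= mem_cat negb_or => /andP[/andP[as1 as2] us] hC.
have swap E : ev a E ->
    pr P (E `&` ([set w | forall i, i \in s1 -> B i (X i w)] `&`
                 [set w | forall i, i \in s2 -> C i w])) =
    pr P E * pr P ([set w | forall i, i \in s1 -> B i (X i w)] `&`
                 [set w | forall i, i \in s2 -> C i w]).
  move=> hE; rewrite IH//; transitivity (pr P ([set w | forall i, i \in s1 -> B i (X i w)] `&`
      [set w | forall i, i \in a :: s2 -> upd C a E i w])).
    congr (pr P _); apply/seteqP; split=> w /=.
      move=> [Ew [h1 h2]]; split=> // i; rewrite inE /upd => /predU1P[->|is2]; first by rewrite eqxx.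
      by case: eqP => // _; exact: h2.
    move=> [h1 h2]; split; first by have := h2 a (mem_head _ _); rewrite /upd eqxx.
    split=> // i is2; have := h2 i; rewrite inE is2 orbT /upd => /(_ isT).
    by case: eqP => // ia; move: as2; rewrite -ia is2.
  rewrite IH.
  - rewrite big_cons {1}/upd eqxx mulrCA; congr (_ * (_ * _)).
    apply: eq_big_seq => i is2; rewrite /upd; case: eqP => // ia.
    by move: as2; rewrite -ia is2.
  - by rewrite uniq_catC /= mem_cat negb_or as1 as2 uniq_catC.
  - move=> i; rewrite inE /upd => /predU1P[->|is2]; first by rewrite eqxx.
    by case: eqP => [->|_]; [exact: hE|exact: hC].
rewrite big_cons -mulrA -IH//.
have mE : measurable ([set w | forall i, i \in s1 -> B i (X i w)] `&`
                 [set w | forall i, i \in s2 -> C i w]).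
  apply: measurableI; first by apply: mseq => i _; exact: mX.
  by apply: mseq => i /hC h; exact: mev h.
transitivity (pr P ([set w | B a (X a w)] `&` ([set w | forall i, i \in s1 -> B i (X i w)] `&`
                 [set w | forall i, i \in s2 -> C i w]))).
  congr (pr P _); apply/seteqP; split=> w /=.
    move=> [h1 h2]; split; first by apply: h1; exact: mem_head.
    by split=> // i is1; apply: h1; rewrite inE is1 orbT.
  move=> [h0 [h1 h2]]; split=> // i; rewrite inE => /predU1P[->//|]; exact: h1.
case: (a) swap => [x|x n|x n|x n] swap.
- apply: (finite_law_indep (Y := eta0 x) (encode_fin @^-1` B (MInit x)) mE (m_ini x)) => u.
  by apply: swap; exists u.
- by apply: swap; exists (B (MTime x n)); first exact: mB.
- apply: (finite_law_indep (Y := dir x n) (encode_fin @^-1` B (MDir x n)) mE (m_dir x n)) => u.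
  by apply: swap; exists u.
- apply: (finite_law_indep (Y := rk x n) (encode_fin @^-1` B (MRank x n)) mE (m_rk x n)) => u.
  by apply: swap; exists u.
Qed.

Let tau_gt x n s : pr P [set w | s < tau x n w] = if 0 <= s then expR (- s) else 1.
Proof.
have [_ h _ _ _] := marks; have [mt ht] := h x n.
case: ifP => s0; first by rewrite /pr ht.
have ms r : measurable [set w | r < tau x n w].
  rewrite (_ : [set w | _] = tau x n @^-1` `]r, +oo[).
    by rewrite -[Y in measurable Y]setTI; exact: mt.
  by apply/seteqP; split=> w /=; rewrite in_itv/= andbT.
apply/eqP; rewrite eq_le pr_le1//=.
have <- : pr P [set w | 0 < tau x n w] = 1 by rewrite /pr ht// oppr0 expR0.
apply: pr_le => // w /= h0; apply: lt_trans h0; by rewrite ltNge s0.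
Qed.

Let pr_ini x u : pr P [set w | eta0 x w = u] = (2 ^+ F)%:R^-1.
Proof. by have [h _ _ _ _] := marks; rewrite /pr (h x u).2. Qed.

Lemma mark_law_exists : exists mu : probability (pspace R [set: mark]) R,
  mark_law F mu /\ forall A, pr mu A = pr P (marks_of @^-1` A).
Proof.
pose XX : {mfun Omega >-> pspace R [set: mark]} := mfun_Sub (mem_set measurable_marks_of).
pose mu : probability (pspace R [set: mark]) R := distribution P XX.
have muE A : pr mu A = pr P (marks_of @^-1` A).
  by rewrite /pr /mu /= /distribution /pushforward mfun_valP.
exists mu; split=> //; split.
- move=> s B us mB; rewrite muE.
  transitivity (pr P ([set w | forall i, i \in s -> B i (X i w)] `&`
      [set w | forall i : mark, i \in [::] -> (fun=> setT : set Omega) i w])).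
    by congr (pr P _); apply/seteqP; split=> w //= [].
  rewrite indep2 ?cats0// big_nil mulr1; apply: eq_bigr => i _.
  by rewrite muE.
- by move=> x n s s0; rewrite muE /= tau_gt s0.
- move=> x n b; rewrite muE.
  have [_ _ h _ _] := marks; rewrite /preimage /= /dirn.
  under eq_set => w do rewrite /= encode_finK.
  by rewrite /pr (h x n b).2.
- move=> x n s; rewrite muE.
  have [_ _ _ h _] := marks; rewrite /preimage /= /rank.
  under eq_set => w do rewrite /= encode_finK.
  by rewrite /pr (h x n s).2.
- split=> [a|u] i B mB; rewrite !muE /preimage /=.
    case: i => [x|x n|x n|x n] /=.
    + apply: (finite_law_eq (Y1 := eta0 (x + a)) (Y2 := eta0 x) (encode_fin @^-1` B)) => // v.
      by rewrite !pr_ini.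
    + by apply: ray_law_eq => // s; rewrite !tau_gt.
    + apply: (finite_law_eq (Y1 := dir (x + a) n) (Y2 := dir x n) (encode_fin @^-1` B)) => // v.
      by have [_ _ h _ _] := marks; rewrite /pr (h (x + a) n v).2 (h x n v).2.
    + apply: (finite_law_eq (Y1 := rk (x + a) n) (Y2 := rk x n) (encode_fin @^-1` B)) => // v.
      by have [_ _ _ h _] := marks; rewrite /pr (h (x + a) n v).2 (h x n v).2.
  case: i => [x|x n|x n|x n] //=.
  under eq_set => w do rewrite encode_finK.
  have xorE v w : (opinion_xor (eta0 x w) u = v) = (eta0 x w = opinion_xor v u).
    apply/propext; split=> [<-|->]; apply/ffunP => j; rewrite !ffunE; by case: (_ j) (u j) => [] [].
  apply: (finite_law_eq (Y1 := fun w => opinion_xor (eta0 x w) u) (Y2 := eta0 x)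
    (encode_fin @^-1` B)) => // v.
    by under eq_set => w do rewrite xorE.
  under eq_set => w do rewrite xorE.
  by rewrite !pr_ini.
Qed.

End MarksLaw.

(** * A single ring in a window, seen from a larger box *)

Section WindowSteps.
Variables (R : realType) (F theta : nat).
Implicit Types (om : mark -> R) (B w v : seq int) (x y z : int).
Local Notation run := (@run R F theta).
Local Notation box_path := (@box_path R F theta).

Lemma run_outside om (Win v w : seq int) x : [seq y <- v | y \in Win] = [::] -> x \in Win ->
  run om (v ++ w) x = run om w x.
Proof.
move=> + xW; elim: v => //= y v IH; case: ifP => // yW h.
rewrite local_step_other ?IH//; by apply: contraFneq yW => <-.
Qed.

Lemma filter_single (Win v : seq int) z : [seq y <- v | y \in Win] = [:: z] ->
  exists v1 v2, [/\ v = v1 ++ z :: v2, [seq y <- v1 | y \in Win] = [::] &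
                    [seq y <- v2 | y \in Win] = [::]].
Proof.
elim: v => //= y v IH; case: ifP => yW.
  by move=> [-> h]; exists [::], v.
by move=> /IH[v1 [v2 [-> h1 h2]]]; exists (y :: v1), v2; rewrite /= yW.
Qed.

(** Filtering the words of [B] by [Win] gives the words of [Win], so exactly one letter of [Win] is
    added during the unit of time; rings outside [Win] may come before and after it. *)
Lemma single_ring_split om B Win (s : R) z b (rho : {perm 'I_F}) w : regular om ->
  uniq B -> {subset Win <= B} -> 0 <= s -> z \in Win ->
  single_ring Win s z b rho w om ->
  exists v1 v2, [/\ word B om (s + 1) = v1 ++ z :: v2 ++ word B om s,
    [seq y <- v1 | y \in Win] = [::], [seq y <- v2 | y \in Win] = [::],
    dirn om z (count_mem z (v2 ++ word B om s)) = b &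
    rank F om z (count_mem z (v2 ++ word B om s)) = rho].
Proof.
move=> reg uB WB s0 zW [h0 h1 hb hr]; have [pos _ _] := reg.
have H0 := word_history reg uB s0.
have s10 : 0 <= s + 1 by rewrite addr_ge0.
have H1 := word_history reg uB s10.
have ss1 : s <= s + 1 by rewrite lerDl.
have [v vE] := history_suffix pos ss1 H0 H1.
have e0 := history_uniq pos (history_filter WB H0) h0.
have e1 := history_uniq pos (history_filter WB H1) h1.
have : [seq y <- v | y \in Win] = [:: z].
  move: e1; rewrite vE filter_cat e0 => h.
  have sz : size [seq x <- v | x \in Win] = 1%N.
    by move/(congr1 size): (h); rewrite size_cat /=; lia.
  by case: [seq x <- v | x \in Win] sz h => [|y []]//= _ [->].
move=> /filter_single[v1 [v2 [v12 f1 f2]]].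
have cE : count_mem z (v2 ++ word B om s) = count_mem z w.
  by rewrite -e0 count_filter_mem// count_cat -(count_filter_mem v2 zW) f2.
by exists v1, v2; rewrite cE; split=> //; rewrite vE v12 -catA.
Qed.

Lemma single_ring_box_path om B Win (s : R) z b (rho : {perm 'I_F}) w x : regular om ->
  uniq B -> {subset Win <= B} -> 0 <= s -> z \in Win -> nbr b z \in Win -> x \in Win ->
  single_ring Win s z b rho w om ->
  box_path B om (s + 1) x = local_step theta b rho z (box_path B om s) x.
Proof.
move=> reg uB WB s0 zW nW xW /(single_ring_split reg uB WB s0 zW)[v1 [v2 [vE f1 f2 db dr]]].
rewrite /box_path vE (run_outside _ _ f1 xW) /= db dr /local_step.
by rewrite !(run_outside _ _ f2).
Qed.

Lemma agree_on_local_step (Win : seq int) b (rho : {perm 'I_F}) z (e1 e2 : int -> opinion F) :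
  z \in Win -> nbr b z \in Win -> (forall x, x \in Win -> e1 x = e2 x) ->
  forall x, x \in Win -> local_step theta b rho z e1 x = local_step theta b rho z e2 x.
Proof. by move=> zW nW e x xW; rewrite /local_step; case: ifP => _; rewrite !e. Qed.

End WindowSteps.

(** * Pushing a particle to the right *)

Section PushRight.
Variables (F theta : nat).
Implicit Types zeta : int -> opinion F.

Lemma hamming_eq0 (u v : opinion F) : hamming u v = 0%N -> u = v.
Proof.
rewrite hammingE => /eqP; rewrite sum_nat_eq0 => /forallP h.
by apply/ffunP => i; apply/eqP; have := h i; rewrite /= eqb0 negbK.
Qed.

Lemma neq_coord (u v : opinion F) : u <> v -> exists i, u i != v i.
Proof.
move=> uv; apply: contrapT => h; apply: uv; apply/ffunP => i; apply/eqP.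
by apply: contrapT => /negP ui; apply: h; exists i.
Qed.

Lemma hamming_gt0 (u v : opinion F) : (0 < hamming u v)%N -> exists i, u i != v i.
Proof.
by move=> h; apply: neq_coord => e; move: h; rewrite e hammingE big1// => i _; rewrite eqxx.
Qed.

(** [x + 1] copies issue [i] from [x]. The last two clauses are the two fates of the particle on the
    next edge: it annihilates if level [i] is occupied there, and otherwise that edge gains one
    particle. *)
Lemma push_right (x : int) (i : 'I_F) zeta :
  (edge_dist zeta x <= theta)%N -> zeta x i != zeta (x + 1) i ->
  exists rho : {perm 'I_F}, let zeta' := local_step theta false rho (x + 1) zeta in
  [/\ forall y, y != x + 1 -> zeta' y = zeta y,
      zeta' (x + 1) i = zeta x i,
      zeta (x + 1) i != zeta (x + 1 + 1) i ->
        (edge_dist zeta' (x + 1 - 1) + edge_dist zeta' (x + 1) <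
         edge_dist zeta (x + 1 - 1) + edge_dist zeta (x + 1))%N &
      zeta (x + 1) i = zeta (x + 1 + 1) i -> edge_dist zeta' (x + 1) = (edge_dist zeta (x + 1)).+1].
Proof.
move=> dx xi; have [rho /(_ (x + 1) zeta)] := move_right theta i.
rewrite /edge_dist addrK => /(_ dx xi) h; exists rho; rewrite /= h eqxx.
have n1 : (x == x + 1) = false by apply/eqP; lia.
have n2 : (x + 1 + 1 == x + 1) = false by apply/eqP; lia.
rewrite n1 n2; have si := @hamming_set_issue F (zeta (x + 1)) _ i (zeta x i); split.
- by move=> y /negbTE ->.
- by rewrite /set_issue ffunE eqxx.
- move=> x2; have := si (zeta x); have := si (zeta (x + 1 + 1)).
  rewrite eq_sym xi eqxx => /(_ isT) + /(_ isT); rewrite ![hamming _ (zeta x)]hammingC.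
  move: xi x2; case: (zeta x i); case: (zeta (x + 1) i); case: (zeta (x + 1 + 1) i) => //= _ _; lia.
- move=> x2; have := si (zeta (x + 1 + 1)).
  rewrite -x2 eq_sym xi => /(_ isT); move: xi.
  case: (zeta x i); case: (zeta (x + 1) i) => //= _; lia.
Qed.

(** Only sampling times are inspected: an opinion may change and return between two of them. *)
Definition held (s : nat) (x : int) (u : opinion F) (k : nat) (f : nat -> int -> opinion F) : Prop :=
  forall j, (s <= j <= k)%N -> f j x = u.

Lemma local_held s x u k : local_event k x 1 (held s x u k).
Proof. by move=> f g fg h j /andP[sj jk]; rewrite -fg ?h ?sj//; lia. Qed.

End PushRight.

(** * Comparison of the infinite system with finite boxes *)

Section Clustering.
Variables (F theta : nat) (R : realType) (d : measure_display) (Omega : measurableType d).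
Variable P : probability Omega R.
Variables (X : Omega -> mark -> R) (eta : Omega -> R -> int -> opinion F).
Variable mu : probability (pspace R [set: mark]) R.
Hypothesis mX : measurable_fun setT (X : Omega -> pspace R [set: mark]).
Hypothesis muE : forall A, pr mu A = pr P (X @^-1` A).
Hypothesis mu_law : mark_law F mu.
Hypothesis eta_path : {ae P, forall w, path_of theta (X w) (eta w)}.
Hypothesis meta : forall t x u, measurable [set w | eta w t x = u].
Implicit Types (S : (nat -> int -> opinion F) -> Prop) (B : seq int) (ts : nat -> R)
  (zeta : int -> opinion F).
Local Notation W := (pspace R [set: mark]).
Local Notation box_path := (@box_path R F theta).
Local Notation annihilations := (@annihilations R F theta).

Definition path_prob ts S : R := pr P [set w | S (fun j x => eta w (ts j) x)].
Local Notation p := (path_prob (fun j => j%:R)).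
Definition box_event B ts S : set (mark -> R) :=
  [set om | S (fun j x => box_path B om (ts j) x)].

(** Bound on the probability that one of two blocks of [r] sites has no site silent up to time [T]. *)
Definition coupling_error (T : R) (r : nat) : R := 2 * (1 - expR (- T)) ^+ r.

Lemma coupling_error_ge0 T r : 0 <= T -> 0 <= coupling_error T r.
Proof.
by move=> T0; rewrite mulr_ge0// exprn_ge0// subr_ge0 expR_le1 oppr_le0.
Qed.

Lemma coupling_error_cvg T : 0 <= T -> coupling_error T @ \oo --> (0 : R).
Proof.
move=> T0; rewrite -(mulr0 2); apply: cvgMl_tmp; apply: cvg_expr.
rewrite ger0_norm ?subr_ge0 ?expR_le1 ?oppr_le0//.
by rewrite ltrBlDr ltrDl expR_gt0.
Qed.

Lemma measurable_path_event ts S k a m : local_event k a m S ->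
  measurable [set w | S (fun j x => eta w (ts j) x)].
Proof. by move=> loc; apply: (measurable_local loc) => j x u _ _; exact: meta. Qed.

Lemma measurable_box_event B ts S k a m : local_event k a m S ->
  measurable (box_event B ts S : set W).
Proof.
move=> loc; apply: (measurable_local (T := W) loc) => j x u _ _.
exact: measurable_box_path.
Qed.

Let all_ring (T : R) (s : seq int) : set (mark -> R) :=
  [set om | forall i, i \in [seq MTime x 0 | x <- s] -> om i <= T].

Let mle (T : R) : measurable ([set r : R | r <= T]).
Proof. by rewrite (_ : [set r | _] = `]-oo, T]%classic). Qed.

Let mall_ring T s : measurable (all_ring T s : set W).
Proof.
by apply: (measurable_coords (B := fun=> [set r : R | r <= T])) => // i; exact: mle.
Qed.

Let pr_all_ring T s : 0 <= T -> uniq s ->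
  pr mu (all_ring T s) = (1 - expR (- T)) ^+ size s.
Proof.
move=> T0 us; have [ind hexp _ _ _] := mu_law.
rewrite /all_ring (ind _ (fun=> [set r : R | r <= T])); last 2 first.
- by rewrite map_inj_uniq// => x y [].
- by move=> i; exact: mle.
rewrite big_map (eq_bigr (fun=> 1 - expR (- T))) ?big_const_seq ?count_predT.
  by rewrite iter_mulr mulr1.
move=> x _; rewrite -(hexp x 0%N T T0) -(prC (T := W)).
  by congr (pr mu _); apply/seteqP; split=> om /=; rewrite leNgt => /negP.
by apply: measurable_lt => //; exact: measurable_coord.
Qed.

Definition block (a : int) (m : nat) : seq int := [seq k%:Z + a | k <- iota 0 m].

Lemma mem_block a m x : (x \in block a m) = (a <= x < a + m%:Z).
Proof.
apply/mapP/idP => [[k + ->]|]; first by rewrite mem_iota /= add0n => km; lia.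
move=> h; exists `|(x - a)%R|%N; last by lia.
by rewrite mem_iota /= add0n; lia.
Qed.

Lemma block_uniq a m : uniq (block a m).
Proof. by rewrite map_inj_uniq ?iota_uniq// => x y /addIr []. Qed.

Lemma size_block a m : size (block a m) = m.
Proof. by rewrite size_map size_iota. Qed.

Lemma coupling : exists N, [/\ measurable N, pr P N = 0 &
  forall w, ~ N w -> regular (X w) /\ path_of theta (X w) (eta w)].
Proof.
have [mreg reg0] := almost_sure_regular mu_law.
have [N [mN N0 hN]] := eta_path.
have mpre (A : set (mark -> R)) : measurable (A : set W) -> measurable (X @^-1` A).
  by move=> mA; rewrite -[Y in measurable Y]setTI; exact: mX.
have mC : measurable (X @^-1` (~` @regular R)).
  by apply: mpre; exact: (@measurableC _ W).
exists (N `|` X @^-1` (~` @regular R)); split.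
- exact: measurableU.
- apply/eqP; rewrite eq_le pr_ge0 andbT (le_trans (prU_le _ _ _))//.
  by rewrite -muE reg0 addr0 /pr N0.
- move=> w /not_orP[nN nreg]; split; first by apply: contrapT.
  by apply: contrapT => np; apply: nN; apply: hN.
Qed.

(** Outside the exceptional event each margin of width [r] contains a site silent up to time [T];
    the window lies between two such sites, and [path_box_path] applies there. *)
Lemma path_box_event_bad B ts S k a m r T : local_event k a m S -> uniq B ->
  (forall j, (j <= k)%N -> 0 <= ts j <= T) -> 0 <= T ->
  (forall x, a - r%:Z <= x < a + m%:Z + r%:Z -> x \in B) ->
  exists bad, [/\ measurable bad, pr P bad <= coupling_error T r,
    [set w | S (fun j x => eta w (ts j) x)] `<=` X @^-1` box_event B ts S `|` bad &
    X @^-1` box_event B ts S `<=` [set w | S (fun j x => eta w (ts j) x)] `|` bad].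
Proof.
move=> loc uB hT T0 hB.
have [N [mN N0 hN]] := coupling.
have mpre (A : set (mark -> R)) : measurable (A : set W) -> measurable (X @^-1` A).
  by move=> mA; rewrite -[Y in measurable Y]setTI; exact: mX.
pose l := block (a - r%:Z) r; pose rr := block (a + m%:Z) r.
pose bad := X @^-1` all_ring T l `|` X @^-1` all_ring T rr.
have mbad : measurable bad by apply: measurableU; apply: mpre; exact: mall_ring.
have pbad : pr P bad <= coupling_error T r.
  rewrite (le_trans (prU_le _ _ _))//; try by apply: mpre; exact: mall_ring.
  rewrite -!muE !pr_all_ring// ?block_uniq// !size_block /coupling_error; lra.
have ex s w : ~ all_ring T s (X w) -> exists2 x, x \in s & T < ring_time (X w) x 1.
  move=> /existsNP[i /not_implyP[/mapP[x xs ->] /negP]]; rewrite -ltNge => h.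
  by exists x => //; rewrite ring_timeS ring_time0 add0r.
pose A := [set w | S (fun j x => eta w (ts j) x)].
pose A' := X @^-1` box_event B ts S.
have mA : measurable A := measurable_path_event ts loc.
have mA' : measurable A' by apply: mpre; exact: measurable_box_event loc.
have key w j x : ~ N w -> ~ bad w -> (j <= k)%N -> a <= x < a + m%:Z ->
    eta w (ts j) x = box_path B (X w) (ts j) x.
  move=> /hN[reg pw] /not_orP[/ex[x1 + h1] /ex[x2 + h2]] jk xa; rewrite !mem_block => x1l x2r.
  have /andP[t0 tT] := hT j jk.
  apply: (path_box_path (a := x1) (b := x2) reg pw uB t0) => [y|||  |].
  - by move=> yx; apply: hB; lia.
  - by lia.
  - exact: le_lt_trans tT h1.
  - exact: le_lt_trans tT h2.
  - by lia.
exists (bad `|` N); split.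
- exact: measurableU.
- by rewrite (le_trans (prU_le P mbad mN))// N0 addr0.
- move=> w Aw; have [|nN] := pselect (N w); first by right; right.
  have [|nb] := pselect (bad w); first by right; left.
  by left; apply: loc Aw => j x jk xa; exact: key.
- move=> w Aw; have [|nN] := pselect (N w); first by right; right.
  have [|nb] := pselect (bad w); first by right; left.
  by left; apply: loc Aw => j x jk xa; rewrite key.
Qed.

Lemma measurable_preimage_marks (A : set (mark -> R)) :
  measurable (A : set W) -> measurable (X @^-1` A).
Proof. by move=> mA; rewrite -[Y in measurable Y]setTI; exact: mX. Qed.

Lemma path_box_event B ts S k a m r T : local_event k a m S -> uniq B ->
  (forall j, (j <= k)%N -> 0 <= ts j <= T) -> 0 <= T ->
  (forall x, a - r%:Z <= x < a + m%:Z + r%:Z -> x \in B) ->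
  `|path_prob ts S - pr mu (box_event B ts S)| <= coupling_error T r.
Proof.
move=> loc uB hT T0 hB.
have [bad [mbad pbad sub1 sub2]] := path_box_event_bad loc uB hT T0 hB.
have mA := measurable_path_event ts loc.
have mA' := measurable_preimage_marks (measurable_box_event B ts loc).
have h1 := le_trans (pr_le P mA (measurableU _ _ mA' mbad) sub1) (prU_le P mA' mbad).
have h2 := le_trans (pr_le P mA' (measurableU _ _ mA mbad) sub2) (prU_le P mA mbad).
rewrite muE ler_norml /path_prob.
by apply/andP; split; lra.
Qed.

Lemma cvg0_le (x : R) (e : nat -> R) : e @ \oo --> (0 : R) -> (forall r, x <= e r) -> x <= 0.
Proof.
by move=> e0 h; apply: (cvgr_to_ge e0); apply: nearW.
Qed.

Lemma path_prob_eq ts1 ts2 S1 S2 k1 k2 a1 a2 m1 m2 T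
    (B1 B2 : nat -> seq int) :
  local_event k1 a1 m1 S1 -> local_event k2 a2 m2 S2 ->
  (forall j, (j <= k1)%N -> 0 <= ts1 j <= T) ->
  (forall j, (j <= k2)%N -> 0 <= ts2 j <= T) -> 0 <= T ->
  (forall r, uniq (B1 r)) -> (forall r, uniq (B2 r)) ->
  (forall r x, a1 - r%:Z <= x < a1 + m1%:Z + r%:Z -> x \in B1 r) ->
  (forall r x, a2 - r%:Z <= x < a2 + m2%:Z + r%:Z -> x \in B2 r) ->
  (forall r, pr mu (box_event (B1 r) ts1 S1) = pr mu (box_event (B2 r) ts2 S2)) ->
  path_prob ts1 S1 = path_prob ts2 S2.
Proof.
move=> loc1 loc2 h1 h2 T0 u1 u2 c1 c2 e.
apply/eqP; rewrite -subr_eq0 -normr_le0.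
apply: (@cvg0_le _ (fun r => 2 * coupling_error T r)).
  by rewrite -(mulr0 2); apply: cvgMl_tmp; exact: coupling_error_cvg.
move=> r; have := path_box_event loc1 (u1 r) h1 T0 (@c1 r).
have := path_box_event loc2 (u2 r) h2 T0 (@c2 r).
rewrite e; set x := pr mu _; rewrite !ler_norml => /andP[? ?] /andP[? ?].
by apply/andP; split; lra.
Qed.

Lemma local_shift k a m S c : local_event k a m S ->
  local_event k (a + c) m (fun f => S (fun j x => f j (x + c))).
Proof. by move=> loc f g h; apply: loc => j x jk xa; apply: h => //; lia. Qed.

Lemma local_xor k a m S u : local_event k a m S ->
  local_event k a m (fun f => S (fun j x => opinion_xor (f j x) u)).
Proof. by move=> loc f g h; apply: loc => j x jk xa; rewrite h. Qed.

Lemma time_bound k ts : (forall j, (j <= k)%N -> 0 <= ts j) ->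
  exists2 T : R, 0 <= T & forall j, (j <= k)%N -> 0 <= ts j <= T.
Proof.
move=> ts0; pose T : R := \sum_(j < k.+1) ts j.
have T0 : 0 <= T by apply: sumr_ge0 => i _; apply: ts0; rewrite -ltnS.
exists T => // j jk; rewrite ts0//= /T; rewrite -ltnS in jk.
by rewrite (bigD1 (Ordinal jk))//= lerDl sumr_ge0// => i _; apply: ts0; rewrite -ltnS.
Qed.

Lemma path_prob_shift ts S k a m c : local_event k a m S ->
  (forall j, (j <= k)%N -> 0 <= ts j) ->
  path_prob ts (fun f => S (fun j x => f j (x + c))) = path_prob ts S.
Proof.
move=> loc ts0; have [T T0 hT] := time_bound ts0.
pose B r := block (a - r%:Z) (m + r + r).
apply: (@path_prob_eq _ _ _ _ k k (a + c) a m m T (fun r => [seq x + c | x <- B r]) B) => //.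
- exact: local_shift.
- by move=> r; rewrite (map_inj_uniq (@addIr _ c)) block_uniq.
- by move=> r; exact: block_uniq.
- move=> r x xa; apply/mapP; exists (x - c); last by rewrite subrK.
  by rewrite mem_block; lia.
- by move=> r x xa; rewrite mem_block; lia.
move=> r; have mE := measurable_box_event (B r) ts loc.
have [mu_indep _ _ _ [inv _]] := mu_law.
have := space_law_eq mu_indep (@shift_mark_inj c) (fun=> @measurable_id _ _ setT) (inv c) mE.
move=> <-; have areg := almost_sure_regular mu_law; have [mreg _] := areg.
have mE1 := measurable_box_event [seq x + c | x <- B r] ts (local_shift (c := c) loc).
have mE2 : measurable ((fun w : mark -> R => (fun i => w (shift_mark c i))) @^-1`
    box_event (B r) ts S : set W).
  have mG : measurable_fun setT ((fun w i => w (shift_mark c i)) : W -> W).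
    by apply: measurable_to_space => i _; exact: measurable_coord.
  by rewrite -[Y in measurable Y]setTI; exact: mG.
rewrite -(pr_almost_sureI areg mE1) -[RHS](pr_almost_sureI areg mE2).
congr (pr mu _); apply/seteqP; split=> om [h reg]; split=> //; move: h;
  apply: loc => j x jk xa; have /andP[t0 _] := hT j jk;
  have e := box_path_shift F theta c x reg (block_uniq (a - r%:Z) (m + r + r)) t0.
- exact: esym e.
- exact: e.
Qed.

Lemma path_prob_xor ts S k a m u : local_event k a m S ->
  (forall j, (j <= k)%N -> 0 <= ts j) ->
  path_prob ts (fun f => S (fun j x => opinion_xor (f j x) u)) = path_prob ts S.
Proof.
move=> loc ts0; have [T T0 hT] := time_bound ts0.
pose B r := block (a - r%:Z) (m + r + r).
apply: (@path_prob_eq _ _ _ _ k k a a m m T B B) => //.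
- exact: local_xor.
- by move=> r; exact: block_uniq.
- by move=> r; exact: block_uniq.
- by move=> r x xa; rewrite mem_block; lia.
- by move=> r x xa; rewrite mem_block; lia.
move=> r; have mE := measurable_box_event (B r) ts loc.
have [mu_indep _ _ _ [_ inv]] := mu_law.
have mg i : measurable_fun setT (@xor_coord R F u i).
  case: i => [x|x n|x n|x n]; rewrite /xor_coord; try exact: measurable_id.
  move=> _ A mA; rewrite setTI.
  exact: (measurable_decode _ (fun v => A (encode_fin (opinion_xor v u)))).
have -> := esym (space_law_eq mu_indep (@inj_id mark) mg (inv u) mE).
congr (pr mu _); apply/seteqP; split=> om; apply: loc => j x jk xa.
- exact/esym/box_path_xor.
- exact: box_path_xor.
Qed.

Lemma box_event_indep B1 B2 ts S1 S2 k1 k2 a1 a2 m1 m2 (A1 A2 : set int) :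
  local_event k1 a1 m1 S1 -> local_event k2 a2 m2 S2 ->
  (forall y, y \in B1 -> A1 y /\ forall b, A1 (nbr b y)) ->
  (forall y, y \in B2 -> A2 y /\ forall b, A2 (nbr b y)) ->
  (forall x, a1 <= x < a1 + m1%:Z -> A1 x) -> (forall x, a2 <= x < a2 + m2%:Z -> A2 x) ->
  A1 `&` A2 = set0 ->
  pr mu (box_event B1 ts S1 `&` box_event B2 ts S2) =
  pr mu (box_event B1 ts S1) * pr mu (box_event B2 ts S2).
Proof.
move=> loc1 loc2 BA1 BA2 SA1 SA2 A12; have [mu_indep _ _ _ _] := mu_law.
have res B k a m (S : (nat -> int -> opinion F) -> Prop) (A : set int) :
    local_event k a m S -> (forall y, y \in B -> A y /\ forall b, A (nbr b y)) ->
    (forall x, a <= x < a + m%:Z -> A x) ->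
    measurable (box_event B ts S : set (pspace R (site_marks A))).
  move=> loc BA SA.
  have -> : box_event B ts S = restrict_marks (site_marks A) 0 @^-1` box_event B ts S.
    apply/seteqP; split=> om; apply: loc => j x _ /SA Ax;
    by rewrite (box_path_restrict F theta om 0 (ts j) BA Ax).
  rewrite -[Y in measurable Y]setTI; apply: measurable_restrict_marks => //.
  exact: measurable_box_event loc.
apply: (space_indep mu_indep _ (res _ _ _ _ _ _ loc1 BA1 SA1) (res _ _ _ _ _ _ loc2 BA2 SA2)).
apply/seteqP; split=> // -[x|x n|x n|x n] [h1 h2]; by have : (A1 `&` A2) x by []; rewrite A12.
Qed.

(** The two boxes together with their neighbours are disjoint, which is the reason for the gap of
    [2r + 2], so the box events are independent. Two coupling errors come from the factors and two
    from the joint event. *)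
Lemma path_prob_decorrelation ts S1 S2 k a1 a2 m r T :
  local_event k a1 m S1 -> local_event k a2 m S2 ->
  (forall j, (j <= k)%N -> 0 <= ts j <= T) -> 0 <= T ->
  a1 + m%:Z + r%:Z + 2 <= a2 - r%:Z ->
  path_prob ts S1 * path_prob ts S2 <=
  path_prob ts (fun f => S1 f /\ S2 f) + 4 * coupling_error T r.
Proof.
move=> loc1 loc2 hT T0 far.
pose B a := block (a - r%:Z) (m + r + r).
have hB a x : a - r%:Z <= x < a + m%:Z + r%:Z -> x \in B a by rewrite mem_block; lia.
have uB a : uniq (B a) by exact: block_uniq.
have p1 := path_box_event loc1 (uB a1) hT T0 (hB a1).
have p2 := path_box_event loc2 (uB a2) hT T0 (hB a2).
pose A (a : int) : set int := [set x | a - r%:Z - 1 <= x < a + m%:Z + r%:Z + 1].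
have nb (a y : int) : y \in B a -> A a y /\ forall b, A a (nbr b y).
  by rewrite mem_block => yB; split => [|[]] /=; rewrite /A/=; lia.
have inA (a x : int) : a <= x < a + m%:Z -> A a x by rewrite /A/=; lia.
have A12 : A a1 `&` A a2 = set0.
  by apply/seteqP; split=> // x; rewrite /A /= => -[h1 h2]; lia.
have q12 := box_event_indep ts loc1 loc2 (nb a1) (nb a2) (inA a1) (inA a2) A12.
have [bad1 [mb1 pb1 _ sub1]] := path_box_event_bad loc1 (uB a1) hT T0 (hB a1).
have [bad2 [mb2 pb2 _ sub2]] := path_box_event_bad loc2 (uB a2) hT T0 (hB a2).
have mE1 := measurable_box_event (B a1) ts loc1.
have mE2 := measurable_box_event (B a2) ts loc2.
have mS1 := measurable_path_event ts loc1.
have mS2 := measurable_path_event ts loc2.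
have q21 : pr mu (box_event (B a2) ts S2) <= 1 by exact: pr_le1.
have q20 : 0 <= pr mu (box_event (B a2) ts S2) by exact: pr_ge0.
have pp1 : path_prob ts S1 <= 1 by exact: pr_le1.
have pp10 : 0 <= path_prob ts S1 by exact: pr_ge0.
have joint : pr mu (box_event (B a1) ts S1 `&` box_event (B a2) ts S2) <=
    path_prob ts (fun f => S1 f /\ S2 f) + 2 * coupling_error T r.
  have mS : measurable ([set w | S1 (fun j x => eta w (ts j) x)] `&`
      [set w | S2 (fun j x => eta w (ts j) x)]) by exact: measurableI.
  have mb : measurable (bad1 `|` bad2) by exact: measurableU.
  rewrite muE.
  apply: (@le_trans _ _ (pr P (([set w | S1 (fun j x => eta w (ts j) x)] `&`
      [set w | S2 (fun j x => eta w (ts j) x)]) `|` (bad1 `|` bad2)))).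
    apply: pr_le.
    - by apply: measurable_preimage_marks; exact: measurableI.
    - exact: measurableU.
    - by move=> w [/sub1[|] h1 /sub2[|] h2]; [left|right; right|right; left|right; left].
  have := prU_le P mS mb; have := prU_le P mb1 mb2; rewrite /path_prob; lra.
move: p1 p2; rewrite !ler_norml => /andP[a1' b1'] /andP[a2' b2'].
move: q12 joint pp1 pp10 q21 q20 a1' b1' a2' b2'.
set p1 := path_prob ts S1; set p2 := path_prob ts S2.
set q1 := pr mu (box_event (B a1) ts S1); set q2 := pr mu (box_event (B a2) ts S2).
set e := coupling_error T r => -> joint pp1 pp10 q21 q20 a1' b1' a2' b2'.
have e0 : 0 <= e by exact: coupling_error_ge0.
have h1 : p1 * (p2 - q2) <= e.
  by apply: (@le_trans _ _ (p1 * e)); rewrite ?ler_wpM2l// ler_piMl.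
have h2 : q2 * (p1 - q1) <= e.
  by apply: (@le_trans _ _ (q2 * e)); rewrite ?ler_wpM2l// ler_piMl.
by move: h1 h2 joint; rewrite !mulrBr [q2 * p1]mulrC [q2 * q1]mulrC; lra.
Qed.

Lemma local_event_widen k k' a a' m m' S : local_event k a m S -> (k <= k')%N ->
  a' <= a -> a + m%:Z <= a' + m'%:Z -> local_event k' a' m' S.
Proof.
move=> loc kk aa mm f g h; apply: loc => j x jk xa; apply: h; first exact: leq_trans jk kk.
by lia.
Qed.

Lemma local_eventI k a m S1 S2 : local_event k a m S1 -> local_event k a m S2 ->
  local_event k a m (fun f => S1 f /\ S2 f).
Proof. by move=> l1 l2 f g h [h1 h2]; split; [exact: l1 h1|exact: l2 h2]. Qed.

Lemma local_event_agree j k a m c n (zeta : int -> opinion F) : (j <= k)%N ->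
  a <= c -> c + n%:Z <= a + m%:Z ->
  local_event k a m (fun f => forall x, x \in block c n -> f j x = zeta x).
Proof.
move=> jk ac cn f g h e x; rewrite mem_block => xc.
by rewrite -h ?e ?mem_block//; lia.
Qed.

Lemma adapted_box_event B ts (s : R) S k a m : local_event k a m S ->
  (forall j, (j <= k)%N -> ts j <= s) -> adapted s (box_event B ts S).
Proof.
move=> loc hts om om' pos pos' ag; apply: loc => j x jk _.
by rewrite (agree_box_path F theta B pos pos' (hts j jk) ag).
Qed.

(** [kernel_bound] transferred to the infinite system. [S] may involve all sampling times up to [k],
    which allows a condition on the past to be carried through successive moves. *)
Lemma path_kernel S k a m c n z b (rho : {perm 'I_F}) (zeta : int -> opinion F) :
  local_event k a m S -> a <= c -> c + n%:Z <= a + m%:Z ->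
  z \in block c n -> nbr b z \in block c n ->
  kernel_cst R F n * p
     (fun f => S f /\ forall x, x \in block c n -> f k x = zeta x) <=
  p
     (fun f => S f /\ ((forall x, x \in block c n -> f k x = zeta x) /\
        forall x, x \in block c n -> f k.+1 x = local_step theta b rho z zeta x)).
Proof.
move=> loc ac cn zW nW.
set S1 := fun f : nat -> int -> opinion F => _ /\ (forall x, x \in block c n -> f k x = zeta x).
set S2 := fun f : nat -> int -> opinion F => _ /\ _ /\ _.
have loc1 : local_event k a m S1.
  by apply: local_eventI => //; exact: local_event_agree.
have loc2 : local_event k.+1 a m S2.
  apply: local_eventI; first exact: local_event_widen loc (leqnSn k) _ _.
  by apply: local_eventI; apply: local_event_agree.
rewrite -subr_le0.
pose T : R := k.+1%:R.
apply: (@cvg0_le _ (fun r => (kernel_cst R F n + 1) * coupling_error T r)).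
  by rewrite -(mulr0 (kernel_cst R F n + 1)); apply: cvgMl_tmp; exact: coupling_error_cvg.
move=> r; pose B := block (a - r%:Z) (m + r + r).
have hB x : a - r%:Z <= x < a + m%:Z + r%:Z -> x \in B by rewrite mem_block; lia.
have uB : uniq B by exact: block_uniq.
have ht1 j : (j <= k)%N -> 0 <= (j%:R : R) <= T by move=> jk; rewrite ler0n ler_nat leqW.
have ht2 j : (j <= k.+1)%N -> 0 <= (j%:R : R) <= T by move=> jk; rewrite ler0n ler_nat.
have T0 : 0 <= T by exact: ler0n.
have p1 := path_box_event loc1 uB ht1 T0 hB.
have p2 := path_box_event loc2 uB ht2 T0 hB.
have mE1 := measurable_box_event B (fun j => j%:R : R) loc1.
have mE2 := measurable_box_event B (fun j => j%:R : R) loc2.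
have ad : adapted (k%:R : R) (box_event B (fun j => j%:R) S1).
  by apply: adapted_box_event loc1 _ => j jk; rewrite ler_nat.
have ker := kernel_bound mu_law b rho (block_uniq c n) zW (ler0n R k) mE1 ad.
have areg := almost_sure_regular mu_law; have [mreg reg0] := areg.
rewrite size_block in ker.
have le2 : pr mu (box_event B (fun j => j%:R) S1 `&`
    [set om | exists w, single_ring (block c n) k%:R z b rho w om]) <=
    pr mu (box_event B (fun j => j%:R) S2).
  apply: (@pr_le_ae _ _ W _ _ _ (~` @regular R)) => //.
  - apply: measurableI => //; apply: measurable_count_ex => w.
    exact: measurable_single_ring.
  - exact: measurableC.
  - move=> om [[Som e] [w sr]]; have [reg|] := pselect (regular om); last by right.
    left; split=> //; split=> // x xW; rewrite -natr1.
    have WB : {subset block c n <= B} by move=> y; rewrite !mem_block; lia.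
    rewrite (single_ring_box_path theta reg uB WB (ler0n _ _) zW nW xW sr).
    by apply: agree_on_local_step xW.
have kc := kernel_cst_gt0 R F n.
move: p1 p2; rewrite !ler_norml => /andP[a1 b1] /andP[a2 b2].
have h1 : kernel_cst R F n * p S1 <=
   kernel_cst R F n * (pr mu (box_event B (fun j => j%:R) S1) + coupling_error T r).
  by rewrite ler_pM2l//; lra.
by rewrite mulrDr in h1; rewrite mulrDl mul1r; lra.
Qed.

(** * The balance of disagreements per edge *)

Definition differ (x : int) (i : 'I_F) : (nat -> int -> opinion F) -> Prop :=
  fun f => f 0%N x i != f 0%N (x + 1) i.

(** The expected number of disagreements across an edge, the same for all edges by translation invariance. *)
Definition disagreement (t : R) : R := \sum_i path_prob (fun=> t) (differ 0 i).

Lemma local_differ x i : local_event 0 x 2 (differ x i).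
Proof. by move=> f g h; rewrite /differ !h//; lia. Qed.

Lemma path_prob_differ t x i : 0 <= t ->
  path_prob (fun=> t) (differ x i) = path_prob (fun=> t) (differ 0 i).
Proof.
move=> t0.
have := path_prob_shift (ts := fun=> t) x
  (@local_differ 0 i) (fun _ _ => t0).
move=> <-; congr (path_prob _ _); apply/funext => f.
by rewrite /differ add0r addrC.
Qed.

Lemma total_dist_box_event n B t om :
  total_dist n (box_path B om t) =
  (\sum_(0 <= k < n.+1) \sum_(i < F)
     (om \in box_event B (fun=> t) (differ (k%:Z - 1) i)))%N.
Proof.
apply: eq_bigr => k _; rewrite /edge_dist hammingE; apply: eq_bigr => i _.
by congr nat_of_bool; apply/idP/idP; rewrite inE.
Qed.

Definition loses (n : nat) (s t : R) (x : int) om : Prop :=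
  exists2 v, word (sites_below n) om t = v ++ word (sites_below n) om s &
  (0 < annihilations om x v (word (sites_below n) om s) +
       annihilations om (x + 1) v (word (sites_below n) om s))%N.

(** Each annihilation removes two disagreements and is charged by at most the two edges at its site;
    hence the events [C k] together cost no more than the total decrease. *)
Lemma box_loss n r L (s t : R) (C : int -> set W) : (r + L < n)%N -> 0 <= s <= t ->
  (forall x, measurable (C x)) ->
  (forall om (k : nat), regular om -> (r <= k < r + L)%N -> C k%:Z om -> loses n s t k%:Z om) ->
  \sum_(r <= k < r + L) pr mu (C k%:Z) +
  \sum_(0 <= k < n.+1) \sum_(i < F) pr mu (box_event (sites_below n) (fun=> t) (differ (k%:Z - 1) i)) <=
  \sum_(0 <= k < n.+1) \sum_(i < F) pr mu (box_event (sites_below n) (fun=> s) (differ (k%:Z - 1) i)).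
Proof.
move=> rLn /andP[s0 st] mC hC.
have t0 := le_trans s0 st.
have [mreg reg0] := almost_sure_regular mu_law.
pose A (p : nat + nat * 'I_F) : set W := match p with
  | inl k => C k%:Z
  | inr (k, i) => box_event (sites_below n) (fun=> t) (differ (k%:Z - 1) i) end.
pose D (p : nat * 'I_F) : set W := box_event (sites_below n) (fun=> s) (differ (p.1%:Z - 1) p.2).
have mbox (u : R) (k : nat) (i : 'I_F) : measurable (box_event (sites_below n) (fun=> u) (differ (k%:Z - 1) i) : set W).
  exact: (measurable_box_event (sites_below n) (fun=> u) (@local_differ (k%:Z - 1) i)).
pose pairs := [seq (k, i) | k <- index_iota 0 n.+1, i <- index_enum 'I_F].
pose sA := [seq inl k | k <- index_iota r (r + L)] ++ [seq inr p | p <- pairs].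
have := @pr_sum_indic _ _ W mu _ _ sA pairs A D (~` @regular R) _ _ _ reg0.
rewrite big_cat/= !big_map/= !big_allpairs_dep/=; apply.
- by move=> [k|[k i]] /=.
- by move=> [k i]; exact: mbox.
- exact: measurableC.
- move=> om; rewrite -[~ (~` _) _]/(~ ~ regular om) => /contrapT reg.
  rewrite big_cat/= !big_map/= !big_allpairs_dep/=.
  rewrite -(total_dist_box_event n (sites_below n) t om) -(total_dist_box_event n (sites_below n) s om).
  have [pos _ _] := reg.
  have H0 := word_history reg (sites_below_uniq n) s0.
  have H1 := word_history reg (sites_below_uniq n) t0.
  have [v vE] := history_suffix pos st H0 H1.
  have sub : {subset v <= sites_below n}.
    move=> y yv; apply: (chron_mem H1.1); rewrite vE mem_cat yv//.
  rewrite /box_path vE -(total_dist_run F theta om (word (sites_below n) om s) sub).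
  rewrite addnC leq_add2l.
  set a := fun y => annihilations om y v (word (sites_below n) om s).
  apply: (@leq_trans (\sum_(r <= k < r + L) (a k%:Z + a k.+1%:Z))%N).
    rewrite big_nat [X in (_ <= X)%N]big_nat; apply: leq_sum => k kr.
    case: (boolP (om \in C k)) => //= /set_mem /(hC om k reg kr)[v' v'E].
    have sz : size v' = size v by have := congr1 size v'E; rewrite vE !size_cat; lia.
    have -> : v' = v by move/eqP: v'E; rewrite vE eqseq_cat// => /andP[/eqP].
    by have -> : k%:Z + 1 = k.+1%:Z by lia.
  rewrite big_split/= mul2n -addnn; apply: leq_add.
  + apply: (@leq_trans (\sum_(0 <= k < n) a k%:Z)%N); last by rewrite /sites_below big_map /index_iota subn0.
    rewrite (big_cat_nat (n := r) (p := n)) ?(leq_trans (leq_addr L r) (ltnW rLn))//=.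
    by rewrite (big_cat_nat (m := r) (n := r + L) (p := n)) ?leq_addr ?(ltnW rLn)//= addnCA leq_addr.
  + apply: (@leq_trans (\sum_(0 <= k < n) a k%:Z)%N); last by rewrite /sites_below big_map /index_iota subn0.
    rewrite -(big_add1 _ _ r (r + L).+1 xpredT (fun k => a k%:Z)).
    have rLn' : (r.+1 <= (r + L).+1)%N by rewrite ltnS leq_addr.
    have r1n : (r.+1 <= n)%N by rewrite (leq_trans _ rLn).
    rewrite (big_cat_nat (n := r.+1) (p := n) (leq0n _) r1n)/=.
    by rewrite (big_cat_nat (m := r.+1) (n := (r + L).+1) (p := n))//= addnCA leq_addr.
Qed.

Lemma cvg0_le_near (x : R) (e : nat -> R) r0 : e @ \oo --> (0 : R) ->
  (forall r, (r0 <= r)%N -> x <= e r) -> x <= 0.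
Proof.
by move=> e0 h; apply: (cvgr_to_ge e0); near=> r; apply: h; near: r; exact: nbhs_infty_ge.
Unshelve. all: by end_near. Qed.

(** In a box with [2r + L + 2] edges each of the [L] middle edges contributes the deficit of the
    claimed inequality, up to an error depending on [r], while the [2r + 2] outer edges contribute
    at most [F] each. Letting [L] and then [r] tend to infinity removes both errors. *)
Lemma path_loss (s t p0 : R) (e : nat -> R) r0 : 0 <= s <= t ->
  e @ \oo --> (0 : R) ->
  (forall r L, (r0 <= r)%N -> exists C : int -> set W, [/\
    forall x, measurable (C x),
    forall om (k : nat), regular om -> (r <= k < r + L)%N -> C k%:Z om ->
      loses (r + L + r).+1 s t k%:Z om &
    forall k : nat, (r <= k < r + L)%N -> p0 - e r <= pr mu (C k%:Z)]) ->
  p0 + disagreement t <= disagreement s.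
Proof.
move=> st e0 H; have /andP[s0 st'] := st; have t0 := le_trans s0 st'.
rewrite -subr_le0.
pose err r := coupling_error t r.
apply: (@cvg0_le_near _ (fun r => e r + (2 * F%:R) * err r) r0).
  rewrite -[X in _ --> X]addr0; apply: cvgD => //.
  by rewrite -(mulr0 (2 * F%:R)); apply: cvgMl_tmp; exact: coupling_error_cvg.
move=> r r0r; rewrite -subr_le0; set c := _ - _.
have main L : c *+ L <= ((r + r).+2 * F)%:R.
  have [C [mC lC pC]] := H r L r0r; set n := (r + L + r).+1.
  have rLn : (r + L < n)%N by rewrite /n ltnS leq_addr.
  have := box_loss rLn st mC lC.
  pose q u k : R := \sum_(i < F) pr mu (box_event (sites_below n) (fun=> u) (differ (k%:Z - 1) i)).
  rewrite -/(q t) => h.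
  have {}h : \sum_(r <= k < r + L) pr mu (C k%:Z) + \sum_(0 <= k < n.+1) q t k <=
             \sum_(0 <= k < n.+1) q s k by exact: h.
  have q0 u k : 0 <= q u k by apply: sumr_ge0 => i _; exact: pr_ge0.
  have mD u k i : measurable (box_event (sites_below n) (fun=> u) (differ (k%:Z - 1) i) : set W).
    exact: (measurable_box_event (sites_below n) (fun=> u) (@local_differ (k%:Z - 1) i)).
  have qF u k : q u k <= F%:R.
    rewrite -[F in X in _ <= X%:R]card_ord -sum1_card natr_sum; apply: ler_sum => i _.
    exact: pr_le1.
  have qd u k : 0 <= u <= t -> (r.+1 <= k < (r + L).+1)%N ->
      `|disagreement u - q u k| <= F%:R * err r.
    move=> ut kr; rewrite /disagreement /q -sumrB.
    rewrite (le_trans (ler_norm_sum _ _ _))// -[F in X in _ <= X%:R * _]card_ord -sum1_card.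
    rewrite natr_sum mulr_suml; apply: ler_sum => i _; rewrite mul1r.
    rewrite -(path_prob_differ (k%:Z - 1) i); last by case/andP: ut.
    apply: (path_box_event (@local_differ (k%:Z - 1) i)
      (sites_below_uniq n)) => // x; rewrite mem_sites_below /n; lia.
  have split3 (f : nat -> R) : \sum_(0 <= k < n.+1) f k =
      \sum_(0 <= k < r.+1) f k + (\sum_(r.+1 <= k < (r + L).+1) f k +
      \sum_((r + L).+1 <= k < n.+1) f k).
    rewrite (big_cat_nat (n := r.+1) (leq0n _))/=; last by rewrite /n; lia.
    by congr (_ + _); rewrite (big_cat_nat (n := (r + L).+1))//= /n; lia.
  rewrite !split3 in h.
  have hC : (p0 - e r) *+ L <= \sum_(r <= k < r + L) pr mu (C k%:Z).
    rewrite -[L in _ *+ L](addKn r L) -sumr_const_nat big_nat [X in _ <= X]big_nat.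
    by apply: ler_sum => k; exact: pC.
  have ht : (disagreement t - F%:R * err r) *+ L <= \sum_(r.+1 <= k < (r + L).+1) q t k.
    have e1 : ((r + L).+1 - r.+1 = L)%N by lia.
    rewrite -[L in _ *+ L]e1 -sumr_const_nat big_nat [X in _ <= X]big_nat.
    apply: ler_sum => k kr; have := qd t k; rewrite t0 lexx => /(_ isT kr).
    by rewrite ler_norml => /andP[]; lra.
  have hs : \sum_(r.+1 <= k < (r + L).+1) q s k <= (disagreement s + F%:R * err r) *+ L.
    have e1 : ((r + L).+1 - r.+1 = L)%N by lia.
    rewrite -[L in _ *+ L]e1 -sumr_const_nat big_nat [X in _ <= X]big_nat.
    apply: ler_sum => k kr; have := qd s k st kr.
    by rewrite ler_norml => /andP[]; lra.
  have h0 a b : 0 <= \sum_(a <= k < b) q t k by apply: sumr_ge0.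
  have hF a b : \sum_(a <= k < b) q s k <= (F * (b - a))%:R.
    have -> : (F * (b - a))%:R = \sum_(a <= k < b) F%:R :> R.
      by rewrite sumr_const_nat natrM mulr_natr.
    by apply: ler_sum => k _; exact: qF.
  have h1 := hF 0%N r.+1; have h2 := hF (r + L).+1 n.+1.
  have e2 : (F * (r.+1 - 0) + F * (n.+1 - (r + L).+1) = (r + r).+2 * F)%N.
    by rewrite /n; nia.
  rewrite -e2 natrD.
  have cE : c *+ L = (p0 - e r) *+ L + (disagreement t - F%:R * err r) *+ L -
                     (disagreement s + F%:R * err r) *+ L.
    by rewrite -!mulrnDl -mulrnBl; congr (_ *+ _); rewrite /c /err; ring.
  rewrite cE.
  have := h0 0%N r.+1; have := h0 (r + L).+1 n.+1; move: h h1 h2 hC ht hs; lra.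
rewrite leNgt; apply/negP => c0.
have x0 : 0 <= ((r + r).+2 * F)%:R / c by rewrite divr_ge0// ltW.
have /andP[_] := truncn_itv x0; set L := (Num.truncn _).+1.
rewrite ltr_pdivrMr// => h.
by have := main L; rewrite -[c *+ L]mulr_natl leNgt h.
Qed.

Lemma disagreement_nonincreasing s t : 0 <= s <= t -> disagreement t <= disagreement s.
Proof.
move=> st; rewrite -[X in X <= _]add0r.
apply: (@path_loss s t 0 (fun=> 0) 0 st); first exact: cvg_cst.
move=> r L _; exists (fun=> set0); split=> // k _.
by rewrite pr0 subrr.
Qed.

Lemma disagreement_ge0 t : 0 <= disagreement t.
Proof. by apply: sumr_ge0 => i _; exact: pr_ge0. Qed.

(** Mass transport: annihilations are paid for by the decrease of [disagreement], and after
    visiting the window [zeta] one occurs with probability at least [kernel_cst]. *)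
Lemma annihilation_loss (k : nat) c n z b (rho : {perm 'I_F}) (zeta : int -> opinion F) :
  z - 1 \in block c n -> z \in block c n -> z + 1 \in block c n ->
  (edge_dist (local_step theta b rho z zeta) (z - 1) +
   edge_dist (local_step theta b rho z zeta) z <
   edge_dist zeta (z - 1)%R + edge_dist zeta z)%N ->
  kernel_cst R F n * p
    (fun f => forall x, x \in block c n -> f k x = zeta x) + disagreement k.+1%:R <=
  disagreement k%:R.
Proof.
move=> lW zW rW ann.
pose K := kernel_cst R F n; have K0 : 0 < K by exact: kernel_cst_gt0.
have k0 : 0 <= k%:R :> R by exact: ler0n.
(* A translated window may stick out by up to [n] sites, which leaves a margin of [r - n] for the
   coupling. *)
apply: (@path_loss _ _ _ (fun r => K * coupling_error k%:R (r - n)) n).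
- by rewrite ler0n ler_nat leqnSn.
- rewrite -(mulr0 K); apply: cvgMl_tmp.
  rewrite -(cvg_shiftn n (fun r => coupling_error (k%:R : R) (r - n))) /=.
  by under eq_fun do rewrite addnK; exact: coupling_error_cvg.
move=> r L nr; pose N := (r + L + r).+1; pose B := sites_below N.
(* Window and configuration are translated so that [z] goes to [x]; the loss is charged to the edge
   [(x, x + 1)]. *)
pose win (x : int) := block (c - z + x) n.
pose zx (x y : int) := zeta (y - x + z).
pose S (x : int) (f : nat -> int -> opinion F) := forall y, y \in win x -> f k y = zx x y.
pose C (x : int) : set W := box_event B (fun j => j%:R) (S x) `&`
  [set om | exists w, single_ring (win x) k%:R x b rho w om].
have locS x : local_event k (c - z + x) n (S x) by exact: local_event_agree.
have mE x := measurable_box_event B (fun j => j%:R : R) (locS x).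
exists C; split.
- move=> x; apply: measurableI => //; apply: measurable_count_ex => w.
  exact: measurable_single_ring.
- move=> om x reg xr [Som [w sr]].
  have WB : {subset win x%:Z <= B}.
    by move=> y; rewrite mem_block mem_sites_below /N; move: zW; rewrite mem_block; lia.
  have xW : x%:Z \in win x%:Z by move: zW; rewrite !mem_block; lia.
  have x1W : x%:Z - 1 \in win x%:Z by move: lW; rewrite !mem_block; lia.
  have x2W : x%:Z + 1 \in win x%:Z by move: rW; rewrite !mem_block; lia.
  have [v1 [v2 [vE f1 f2 db dr]]] :=
    single_ring_split reg (sites_below_uniq N) WB k0 xW sr.
  exists (v1 ++ x%:Z :: v2); first by rewrite -natr1 vE -catA.
  rewrite (leq_trans _ (leq_addr _ _))//; apply: annihilations_gt0.
  have runE y : y \in win x%:Z ->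
      run F theta om (v2 ++ word B om k%:R) y = zx x%:Z y.
    by move=> yW; rewrite (run_outside F theta om _ f2 yW); exact: Som.
  have e1 : zx x%:Z (x%:Z - 1) = zeta (z - 1) by rewrite /zx; congr zeta; lia.
  have e2 : zx x%:Z x%:Z = zeta z by rewrite /zx; congr zeta; lia.
  have e3 : zx x%:Z (x%:Z + 1) = zeta (z + 1) by rewrite /zx; congr zeta; lia.
  have h1 : (x%:Z - 1 == x%:Z) = false by apply/eqP; lia.
  have h2 : (x%:Z + 1 == x%:Z) = false by apply/eqP; lia.
  have h3 : (z - 1 == z) = false by apply/eqP; lia.
  have h4 : (z + 1 == z) = false by apply/eqP; lia.
  have nE : run F theta om (v2 ++ word B om k%:R) (nbr b x%:Z) = zeta (nbr b z).
    by case: (b); rewrite /nbr runE// ?e1 ?e3.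
  move: ann; rewrite /annihilates /= -/B db dr /edge_dist !subrK /local_step.
  by rewrite !eqxx h1 h2 h3 h4 nE !runE// e1 e2 e3.
- move=> x xr.
  have hts j : (j <= k)%N -> 0 <= (j%:R : R) <= k%:R by rewrite ler0n ler_nat.
  have p1 : `|p (S x%:Z) -
      pr mu (box_event B (fun j => j%:R) (S x%:Z))| <= coupling_error k%:R (r - n).
    apply: (path_box_event (locS x%:Z) (sites_below_uniq N) hts k0) => y.
    by rewrite mem_sites_below /N; move: zW; rewrite mem_block; lia.
  have ad : adapted (k%:R : R) (box_event B (fun j => j%:R) (S x%:Z)).
    by apply: adapted_box_event (locS _) _ => j jk; rewrite ler_nat.
  have xW : x%:Z \in win x%:Z by move: zW; rewrite !mem_block; lia.
  have ker := kernel_bound mu_law b rho (block_uniq (c - z + x%:Z) n) xW k0 (mE x%:Z) ad.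
  rewrite size_block in ker.
  have shift : p (S x%:Z) =
      p (fun f => forall y, y \in block c n -> f k y = zeta y).
    have loc0 : local_event k c n (fun f => forall y, y \in block c n -> f k y = zeta y).
      exact: local_event_agree.
    rewrite -(path_prob_shift (x%:Z - z) loc0); last first.
      by move=> j _; exact: ler0n.
    congr (pr P _); apply/seteqP; split=> w h y; rewrite mem_block => yW.
    - have := h (y + (x%:Z - z)); rewrite /zx => ->; last by rewrite mem_block; lia.
      by congr zeta; lia.
    - have := h (y - (x%:Z - z)); rewrite subrK => ->; last by rewrite mem_block; lia.
      by rewrite /zx; congr zeta; lia.
  move: p1; rewrite shift ler_norml => /andP[_ p1].
  apply: le_trans ker; rewrite -/K -mulrBr ler_pM2l//; lra.
Qed.

Lemma annihilations_cat om y v1 v2 w :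
  annihilations om y (v1 ++ v2) w = (annihilations om y v1 (v2 ++ w) + annihilations om y v2 w)%N.
Proof. by elim: v1 => //= z v1 ->; rewrite catA addnA. Qed.

(** A blocked edge can only be freed by an annihilation at one of its end points. *)
Lemma blocked_loss (k K : nat) : (theta < F)%N -> (k <= K)%N ->
  p (fun f => edge_dist (f k) 0 = F /\
    exists2 j, (k <= j <= K)%N & f j 0 <> f k 0) + disagreement K%:R <=
  disagreement k%:R.
Proof.
move=> tF kK.
pose S (x : int) (f : nat -> int -> opinion F) := edge_dist (f k) x = F /\
    exists2 j, (k <= j <= K)%N & f j x <> f k x.
have locS x : local_event K x 2 (S x).
  move=> f g h [h1 [j jk h2]]; split; first by rewrite /edge_dist -!h//; lia.
  by exists j => //; rewrite -!h//; lia.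
apply: (@path_loss _ _ _ (coupling_error K%:R) 0).
- by rewrite ler0n ler_nat.
- by apply: coupling_error_cvg; exact: ler0n.
move=> r L _; pose N := (r + L + r).+1; pose B := sites_below N.
have mE x := measurable_box_event B (fun j => j%:R : R) (locS x).
exists (fun x => box_event B (fun j => j%:R) (S x)); split=> //.
- move=> om x reg xr [blk [j /andP[kj jK] ne]]; have [pos _ _] := reg.
  have H n := word_history reg (sites_below_uniq N) (ler0n R n).
  have le1 : (k%:R : R) <= j%:R by rewrite ler_nat.
  have le2 : (j%:R : R) <= K%:R by rewrite ler_nat.
  have [v1 v1E] := history_suffix pos le1 (H k) (H j).
  have [v2 v2E] := history_suffix pos le2 (H j) (H K).
  exists (v2 ++ v1); first by rewrite v2E v1E catA.
  rewrite lt0n; apply/negP => /eqP a0; apply: ne.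
  move/eqP: a0; rewrite !annihilations_cat !addn_eq0.
  move=> /andP[/andP[_ /eqP a1] /andP[_ /eqP a2]].
  rewrite /box_path v1E.
  by have [] := blocked_run tF blk a1 a2.
- move=> x xr.
  have hts j : (j <= K)%N -> 0 <= (j%:R : R) <= K%:R by rewrite ler0n ler_nat.
  have : `|p (S x%:Z) -
      pr mu (box_event B (fun j => j%:R) (S x%:Z))| <= coupling_error K%:R r.
    apply: (path_box_event (locS x%:Z)
      (sites_below_uniq N) hts (ler0n R K)) => y; rewrite mem_sites_below /N; lia.
  have -> : p (S x%:Z) = p (S 0).
    rewrite -(path_prob_shift x%:Z (locS 0)); last first.
      by move=> j _; exact: ler0n.
    congr (pr P _); apply/seteqP; split=> w; rewrite /S /edge_dist /= add0r [1 + _]addrC //.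
  by rewrite ler_norml => /andP[]; rewrite /S; lra.
Qed.

(** * Window configurations of vanishing probability *)

Lemma cvg0_squeeze (u v : nat -> R) k0 : v @ \oo --> (0 : R) ->
  (forall k, (k0 <= k)%N -> 0 <= u k <= v k) -> u @ \oo --> (0 : R).
Proof.
move=> v0 h; apply: (@squeeze_cvgr _ _ _ _ (fun=> 0) v) => //; last exact: cvg_cst.
by near=> k; apply: h; near: k; exact: nbhs_infty_ge.
Unshelve. all: by end_near. Qed.

Lemma cvg0_scaled (u v : nat -> R) (K : R) k0 : 0 < K -> v @ \oo --> (0 : R) ->
  (forall k, (k0 <= k)%N -> 0 <= u k /\ K * u k <= v k) -> u @ \oo --> (0 : R).
Proof.
move=> K0 v0 h; have w0 : (fun k => K^-1 * v k) @ \oo --> (0 : R).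
  by rewrite -(mulr0 K^-1); apply: cvgMl_tmp.
apply: (cvg0_squeeze (k0 := k0) w0) => k /h[-> Ku] /=.
by rewrite mulrC ler_pdivlMr// mulrC.
Qed.

Lemma cvg0_sum (I : finType) (a : I -> nat -> R) :
  (forall i, a i @ \oo --> (0 : R)) -> (fun k => \sum_i a i k) @ \oo --> (0 : R).
Proof.
move=> a0; elim: (index_enum I) => [|i s IHs].
  by under eq_fun do rewrite big_nil; exact: cvg_cst.
under eq_fun do rewrite big_cons.
by have h := cvgD (a0 i) IHs; rewrite addr0 in h; exact: h.
Qed.

Lemma p_ge0 S : 0 <= p S.
Proof. exact: pr_ge0. Qed.

Lemma p_le k a m k' a' m' S1 S2 : local_event k a m S1 -> local_event k' a' m' S2 ->
  (forall f, S1 f -> S2 f) -> p S1 <= p S2.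
Proof.
move=> l1 l2 h; apply: pr_le => [||w]; last exact: h.
- exact: measurable_path_event l1.
- exact: measurable_path_event l2.
Qed.

Lemma nonincreasing_limit (u : nat -> R) : (forall k, 0 <= u k) ->
  (forall k, u k.+1 <= u k) ->
  exists l, [/\ u @ \oo --> (l : R), 0 <= l & forall k, l <= u k].
Proof.
move=> u0 dec; have dec' : nonincreasing_seq u by exact/nonincreasing_seqP.
have cu : cvgn u by apply: nonincreasing_is_cvgn => //; exists 0 => _ [k _ <-].
exists (lim (u @ \oo)); split=> //; first by apply: limr_ge => //; exact: nearW.
exact: nonincreasing_cvgn_ge.
Qed.

Lemma nonincreasing_step_cvg0 (u : nat -> R) : (forall k, 0 <= u k) ->
  (forall k, u k.+1 <= u k) -> (fun k => u k - u k.+1) @ \oo --> (0 : R).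
Proof.
move=> u0 dec; have [l [hl _ _]] := nonincreasing_limit u0 dec.
by rewrite -(subrr l); apply: cvgB => //; move: hl; rewrite -(cvg_shiftS u).
Qed.

Let disagreement_step k : disagreement k.+1%:R <= disagreement k%:R.
Proof. by apply: disagreement_nonincreasing; rewrite ler0n ler_nat leqnSn. Qed.

Lemma disagreement_limit : exists l,
  [/\ (fun k => disagreement k%:R) @ \oo --> (l : R), 0 <= l & forall k, l <= disagreement k%:R].
Proof. by apply: nonincreasing_limit => // k; exact: disagreement_ge0. Qed.

Lemma disagreement_step_cvg0 :
  (fun k => disagreement k%:R - disagreement k.+1%:R) @ \oo --> (0 : R).
Proof.
apply: (@nonincreasing_step_cvg0 (fun k => disagreement k%:R)) => // k.
exact: disagreement_ge0.
Qed.

Section Vanishing.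
Variables (c : int) (n : nat) (E : nat -> (nat -> int -> opinion F) -> Prop).
Hypothesis locE : forall k, local_event k c n (E k).

Let on_window k zeta (f : nat -> int -> opinion F) : Prop :=
  forall x, x \in block c n -> f k x = zeta x.

(** [E k] carries the part of the past that an argument relies on: frozen ends in one use, no
    condition in the other. *)
Definition vanishing zeta : Prop :=
  (fun k => p (fun f => E k f /\ on_window k zeta f)) @ \oo --> (0 : R).

Let loc_window k j zeta : (j <= k)%N -> local_event k c n (on_window j zeta).
Proof. by move=> jk; apply: local_event_agree. Qed.

Let locEw k zeta : local_event k c n (fun f => E k f /\ on_window k zeta f).
Proof. by apply: local_eventI => //; exact: loc_window. Qed.

Lemma vanishing_sub (Q : nat -> (nat -> int -> opinion F) -> Prop) zeta k0 :
  (forall k, local_event k c n (Q k)) ->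
  (forall k f, (k0 <= k)%N -> E k f -> on_window k zeta f -> Q k f) ->
  (fun k => p (Q k)) @ \oo --> (0 : R) -> vanishing zeta.
Proof.
move=> locQ h Q0; apply: (cvg0_squeeze (k0 := k0) Q0) => k kk; rewrite p_ge0 /=.
by apply: (p_le (@locEw k zeta) (locQ k)) => f [Ef wf]; exact: h.
Qed.

(** [disagreement] decreases to a limit, so its decrements tend to 0, and they bound [kernel_cst]
    times the probability of the window configuration. *)
Lemma vanishing_annihilation zeta z (rho : {perm 'I_F}) :
  z - 1 \in block c n -> z \in block c n -> z + 1 \in block c n ->
  (edge_dist (local_step theta false rho z zeta) (z - 1)%R +
   edge_dist (local_step theta false rho z zeta) z <
   edge_dist zeta (z - 1)%R + edge_dist zeta z)%N -> vanishing zeta.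
Proof.
move=> z1 z2 z3 ann.
apply: (@vanishing_sub (fun k => on_window k zeta) zeta 0) => //.
  by move=> k; exact: loc_window.
have K0 := kernel_cst_gt0 R F n.
apply: (cvg0_scaled (k0 := 0) K0 disagreement_step_cvg0) => k _; split; first exact: p_ge0.
have := annihilation_loss k z1 z2 z3 ann.
rewrite /on_window; lra.
Qed.

Let kernel k zeta z (rho : {perm 'I_F}) : z - 1 \in block c n -> z \in block c n ->
  kernel_cst R F n * p (fun f => E k f /\ on_window k zeta f) <=
  p (fun f => E k f /\ (on_window k zeta f /\
     on_window k.+1 (local_step theta false rho z zeta) f)).
Proof.
move=> z1 z2; exact: (path_kernel (c := c) (n := n)).
Qed.

Let locE1 k : local_event k.+1 c n (E k).
Proof. by have := local_event_widen (@locE k) (leqnSn k) (lexx c) (lexx (c + n%:Z)). Qed.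

Let locK k zeta zeta' : local_event k.+1 c n
  (fun f => E k f /\ (on_window k zeta f /\ on_window k.+1 zeta' f)).
Proof.
apply: local_eventI; first exact: locE1.
by apply: local_eventI; exact: loc_window.
Qed.

(** Propagation backwards along one forced move; the side condition says that the move preserves
    [E]. *)
Lemma vanishing_pred zeta z (rho : {perm 'I_F}) :
  z - 1 \in block c n -> z \in block c n ->
  (forall k f, E k f -> on_window k zeta f ->
     on_window k.+1 (local_step theta false rho z zeta) f -> E k.+1 f) ->
  vanishing (local_step theta false rho z zeta) -> vanishing zeta.
Proof.
move=> z1 z2 step Z; have K0 := kernel_cst_gt0 R F n.
move: Z; rewrite /vanishing -cvg_shiftS => Z.
apply: (cvg0_scaled (k0 := 0) K0 Z) => k _; split; first exact: p_ge0.
apply: le_trans (kernel k zeta rho z1 z2) _.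
apply: (p_le (@locK _ _ _) (@locEw k.+1 _)) => f [Ef [w1 w2]]; split=> //.
exact: step Ef w1 w2.
Qed.

(** The events [E k] decrease, so the mass they lose per step tends to 0, while a visit to [zeta]
    makes them lose at least a fixed fraction of its probability. *)
Lemma vanishing_exit zeta z (rho : {perm 'I_F}) k0 :
  z - 1 \in block c n -> z \in block c n ->
  (forall k f, E k.+1 f -> E k f) ->
  (forall k f, (k0 <= k)%N -> on_window k zeta f ->
     on_window k.+1 (local_step theta false rho z zeta) f -> ~ E k.+1 f) ->
  vanishing zeta.
Proof.
move=> z1 z2 dec exit; have K0 := kernel_cst_gt0 R F n.
have decp k : p (E k.+1) <= p (E k) by exact: (p_le (@locE k.+1) (@locE k) (dec k)).
have h := nonincreasing_step_cvg0 (fun k => p_ge0 (E k)) decp.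
apply: (cvg0_scaled (k0 := k0) K0 h) => k kk; split; first exact: p_ge0.
apply: le_trans (kernel k zeta rho z1 z2) _.
rewrite lerBrDr -prU; last 3 first.
- exact: (measurable_path_event _ (@locK _ _ _)).
- exact: (measurable_path_event _ (@locE k.+1)).
- by apply/seteqP; split=> // w [[_ [w1 w2]] /(exit _ _ kk w1 w2)].
apply: pr_le.
- apply: measurableU; first exact: (measurable_path_event _ (@locK _ _ _)).
  exact: (measurable_path_event _ (@locE k.+1)).
- exact: (measurable_path_event _ (@locE k)).
- by move=> w [[]//|/dec].
Qed.

(** A window has finitely many configurations, so vanishing of each one with property [Q] gives
    vanishing of the sum. *)
Lemma vanishing_cvg (Q : (int -> opinion F) -> Prop) :
  (forall e1 e2, (forall x, x \in block c n -> e1 x = e2 x) -> Q e1 -> Q e2) ->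
  (forall zeta, Q zeta -> vanishing zeta) ->
  (fun k => p (fun f => E k f /\ Q (f k))) @ \oo --> (0 : R).
Proof.
move=> locQ QZ.
pose ext (g : {ffun 'I_n -> opinion F}) (x : int) : opinion F :=
  if insub `|x - c|%N is Some i then g i else [ffun=> false].
pose a (g : {ffun 'I_n -> opinion F}) k : R :=
  if `[< Q (ext g) >] then p (fun f => E k f /\ on_window k (ext g) f) else 0.
have h : (fun k => \sum_g a g k) @ \oo --> (0 : R).
  apply: cvg0_sum => g; rewrite /a; case: asboolP => [/QZ//|_]; exact: cvg_cst.
have locQk k : local_event k c n (fun f => E k f /\ Q (f k)).
  apply: local_eventI => // f g fg; apply: locQ => x; rewrite mem_block => xc; exact: fg.
apply: (cvg0_squeeze (k0 := 0) h) => k _; rewrite p_ge0 /=.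
pose A (g : {ffun 'I_n -> opinion F}) : set Omega := if `[< Q (ext g) >] then
  [set w | E k (fun j x => eta w j%:R x) /\ on_window k (ext g) (fun j x => eta w j%:R x)] else set0.
have mA g : measurable (A g).
  rewrite /A; case: ifP => // _; exact: (measurable_path_event _ (@locEw k (ext g))).
have -> : \sum_g a g k = \sum_g pr P (A g).
  by apply: eq_bigr => g _; rewrite /a /A; case: ifP => // _; rewrite pr0.
apply: le_trans (pr_bigU_le P (index_enum _) xpredT mA).
apply: pr_le.
- exact: (measurable_path_event _ (locQk k)).
- exact: bigsetU_measurable.
- move=> w [Ew Qw]; rewrite -bigcup_seq.
  pose g := [ffun i : 'I_n => eta w k%:R (c + (i : nat)%:Z)].
  have gE x : x \in block c n -> eta w k%:R x = ext g x.
    rewrite mem_block => xc; rewrite /ext.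
    have xn : (`|(x - c)%R|%N < n)%N by lia.
    by rewrite (insubT (fun i => i < n)%N xn) ffunE; congr (eta w _ _); rewrite /=; lia.
  exists g; first by rewrite /= mem_index_enum.
  rewrite /A asboolT; last by apply: locQ Qw.
  by split.
Qed.

End Vanishing.

Hypothesis F2 : (2 <= F)%N.
Hypothesis FE : F = theta.+1.

(** * Opinions do not freeze *)

Section FrozenEnds.
Variables (n s : nat) (u v : opinion F).

Let E (k : nat) (f : nat -> int -> opinion F) : Prop :=
  forall j, (s <= j <= k)%N -> f j 0 = u /\ f j n%:Z = v.

Let locE k : local_event k 0 n.+1 (E k).
Proof.
move=> f g h Ef j /andP[sj jk]; have [<- <-] := Ef j (introT andP (conj sj jk)).
by split; rewrite h//; lia.
Qed.

(** A disagreement pushed to the right from an active edge meets a blocked edge, where it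
    annihilates, unless it reaches the site [n] and changes the opinion there. *)
Lemma frozen_active (m x : nat) zeta : (x + m.+1 = n)%N -> zeta 0 = u -> zeta n%:Z = v ->
  (0 < edge_dist zeta x%:Z < F)%N -> vanishing 0 n.+1 E zeta.
Proof.
elim: m x zeta => [|m IHm] x zeta xm z0 zn /andP[d0 dF].
  (* The push is made at site [n] itself and changes the opinion there, which contradicts [E]. *)
  have [i xi] := hamming_gt0 d0.
  have dt : (edge_dist zeta x%:Z <= theta)%N by lia.
  have [rho [_ z1 _ _]] := push_right dt xi.
  have xn : x%:Z + 1 = n%:Z by lia.
  apply: (vanishing_exit (@locE) (z := x%:Z + 1) (rho := rho) (k0 := s)).
  - by rewrite mem_block; lia.
  - by rewrite mem_block; lia.
  - by move=> k f Ef j /andP[sj jk]; apply: Ef; lia.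
  - move=> k f sk _ w2 Ef; move: xi; rewrite -z1 -w2; last by rewrite mem_block; lia.
    by rewrite xn zn; have [|_ ->] := Ef k.+1; [lia|rewrite eqxx].
have [i xi] := hamming_gt0 d0.
have dt : (edge_dist zeta x%:Z <= theta)%N by lia.
have xS : x%:Z + 1 = x.+1%:Z by lia.
have [rho [zo z1 za zd]] := push_right dt xi.
have [dz|dz] := posnP (edge_dist zeta x.+1%:Z); last first.
  (* An active next edge takes over without any move; a full one has level [i] occupied, so the push
     annihilates. *)
  have [dF1|dF1] := ltnP (edge_dist zeta x.+1%:Z) F.
    by apply: (IHm x.+1) => //; [lia|rewrite dz].
  apply: (vanishing_annihilation (@locE) (z := x%:Z + 1) (rho := rho)).
  - by rewrite mem_block; lia.
  - by rewrite mem_block; lia.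
  - by rewrite mem_block; lia.
  - apply: za; apply: hamming_full; rewrite xS; apply/eqP; rewrite eqn_leq dF1 andbT.
    exact: hamming_leF.
(* The next edge is empty, so after the push it carries exactly one particle and is active because
   [F >= 2]. *)
apply: (vanishing_pred (@locE) (z := x%:Z + 1) (rho := rho)).
- by rewrite mem_block; lia.
- by rewrite mem_block; lia.
- move=> k f Ef w1 w2 j /andP[sj]; rewrite leq_eqVlt => /orP[/eqP ->|jk]; last by apply: Ef; lia.
  by rewrite !w2 ?mem_block ?zo//; lia.
- apply: (IHm x.+1); rewrite ?zo//; try lia.
  rewrite -xS zd; last by rewrite xS; rewrite (hamming_eq0 dz).
  by rewrite xS dz; lia.
Qed.

(** Along edges that are empty or full the opinion is kept or replaced by its opposite, so it
    remains equal or opposite to the one at [0]. *)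
Lemma active_edge zeta (m : nat) :
  (exists2 x : nat, (x < m)%N & (0 < edge_dist zeta x%:Z < F)%N) \/
  zeta m%:Z = zeta 0 \/ forall i, zeta m%:Z i != zeta 0 i.
Proof.
elim: m => [|m IHm]; first by right; left.
case: IHm => [[x xm h]|IHm]; first by left; exists x => //; lia.
have Sm : m.+1%:Z = m%:Z + 1 by lia.
have [dm|dm] := posnP (edge_dist zeta m%:Z).
  by right; rewrite Sm -(hamming_eq0 dm).
have [dF|dF] := ltnP (edge_dist zeta m%:Z) F; first by left; exists m => //; rewrite dm.
have /hamming_full h : edge_dist zeta m%:Z = F.
  by apply/eqP; rewrite eqn_leq dF andbT; exact: hamming_leF.
right; case: IHm => [<-|h0].
  by right => i; rewrite Sm eq_sym.
left; apply/ffunP => i; rewrite Sm; have := h i; have := h0 i.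
by case: (zeta m%:Z i); case: (zeta 0 i); case: (zeta (m%:Z + 1) i).
Qed.

Lemma frozen_ends : u != v -> (exists i, v i = u i) ->
  (fun k => p (E k)) @ \oo --> (0 : R).
Proof.
move=> uv [i vi].
have h : (fun k => p (fun f => E k f /\ (f k 0 = u /\ f k n%:Z = v))) @ \oo --> (0 : R).
  apply: (vanishing_cvg (@locE) (Q := fun e => e 0 = u /\ e n%:Z = v)).
    by move=> e1 e2 e12; rewrite !e12// mem_block; lia.
  move=> zeta [z0 zn].
  case: (active_edge zeta n) => [[x xn h]|[h|h]].
  - apply: (@frozen_active (n - x.+1) x) => //; lia.
  - by move: uv; rewrite -z0 -zn h eqxx.
  - by have := h i; rewrite z0 zn vi eqxx.
apply: (cvg0_squeeze (k0 := s) h) => k sk; rewrite p_ge0 /=.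
have loc2 : local_event k 0 n.+1 (fun f : nat -> int -> opinion F =>
    E k f /\ (f k 0 = u /\ f k n%:Z = v)).
  apply: local_eventI; first exact: locE.
  by move=> f g fg [h0 hn]; split; rewrite -?h0 -?hn fg//; lia.
apply: (p_le (@locE k) loc2).
by move=> f Ef; split=> //; apply: Ef; rewrite sk leqnn.
Qed.

End FrozenEnds.

(** Shrinking two events lowers their joint probability by at most the mass removed. This carries
    decorrelation, whose error is controlled for a fixed time horizon, to later times. *)
Lemma pr_replace (A B A' B' : set Omega) : measurable A -> measurable B ->
  measurable A' -> measurable B' -> A' `<=` A -> B' `<=` B ->
  pr P (A `&` B) + pr P A' + pr P B' <= pr P (A' `&` B') + pr P A + pr P B.
Proof.
move=> mA mB mA' mB' AA BB.
rewrite (prID P mA mA') (prID P mB mB') (setIidr AA) (setIidr BB).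
have mD1 := measurableD mA mA'; have mD2 := measurableD mB mB'.
have mI' := measurableI _ _ mA' mB'; have mI := measurableI _ _ mA mB.
have : pr P (A `&` B) <= pr P ((A' `&` B') `|` ((A `\` A') `|` (B `\` B'))).
  apply: pr_le => //; first by apply: measurableU => //; exact: measurableU.
  move=> w [Aw Bw]; have [A'w|A'w] := pselect (A' w); last by right; left.
  by have [B'w|B'w] := pselect (B' w); [left|right; right].
have := prU_le P mI' (measurableU _ _ mD1 mD2); have := prU_le P mD1 mD2; lra.
Qed.

Lemma held_law s x u v k : p (held s x u k) = p (held s 0 v k).
Proof.
rewrite -(path_prob_shift x (@local_held F s 0 v k)); last by move=> j _; exact: ler0n.
have l := local_shift (c := x) (@local_held F s 0 v k).
rewrite -(path_prob_xor (opinion_xor u v) l); last by move=> j _; exact: ler0n.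
congr (pr P); apply/seteqP; split=> w /= h j jk; have := h j jk; rewrite add0r.
- by move=> ->; apply/ffunP => i; rewrite !ffunE; case: (u i); case: (v i).
- move=> /ffunP e; apply/ffunP => i; have := e i; rewrite !ffunE.
  by case: (eta _ _ _ _); case: (u i); case: (v i).
Qed.

(** By mixing and symmetry, if [0] kept its opinion forever with positive probability, then
    so would two distant sites with opinions that are neither equal nor opposite. *)
Lemma held_cvg0 s u : (fun k => p (held s 0 u k)) @ \oo --> (0 : R).
Proof.
pose a k := p (held s 0 u k).
have [||l [hl l0 la]] := @nonincreasing_limit a.
- by move=> k; exact: p_ge0.
- move=> k; apply: (p_le (@local_held F s 0 u k.+1) (@local_held F s 0 u k)) => f h j jk.
  by apply: h; lia.
suff l2 : l ^+ 2 <= 0 by have /eqP : l ^+ 2 = 0 by [apply/le_anti; rewrite l2 sqr_ge0];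
  rewrite sqrf_eq0 => /eqP l0'; move: hl; rewrite l0'.
pose i0 : 'I_F := Ordinal (ltnW F2); pose i1 : 'I_F := Ordinal F2.
(* [v] differs from [u] at [i0] and agrees with it at [i1], so it is neither equal nor opposite to
   [u]. *)
pose v : opinion F := [ffun i => (i == i0) (+) u i].
have uv : u != v.
  by apply/eqP => /ffunP /(_ i0); rewrite ffunE eqxx; case: (u i0).
have vi : exists i, v i = u i by exists i1; rewrite ffunE.
(* For fixed [K], decorrelation bounds [a K ^+ 2] by the joint probability up to [K] plus an error
   in [r]. Prolonging both freezings to a later [k] costs at most [2 * (a K - a k)], and the joint
   probability up to [k] tends to 0. The limits are taken in [k], then [r], then [K]. *)
have step K : a K ^+ 2 - 2 * (a K - l) <= 0.
  have err0 : (fun r => 4 * coupling_error (K%:R : R) r) @ \oo --> (0 : R).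
    by rewrite -(mulr0 4); apply: cvgMl_tmp; exact: coupling_error_cvg.
  apply: (cvg0_le err0) => r; rewrite -subr_le0.
  pose n := (r + r + 3)%N.
  have e0 := frozen_ends n s uv vi.
  apply: (cvg0_le_near (r0 := K) e0) => k Kk.
  have far : 0 + 1%:Z + r%:Z + 2 <= n%:Z - r%:Z by rewrite /n; lia.
  have := path_prob_decorrelation (ts := fun j => j%:R) (T := K%:R)
    (@local_held F s 0 u K) (@local_held F s n%:Z v K) _ (ler0n _ _) far.
  have hT j : (j <= K)%N -> 0 <= (j%:R : R) <= K%:R by rewrite ler0n ler_nat.
  move=> /(_ hT); rewrite (held_law _ _ v u) -/(a K) -expr2.
  have mh x u' k' : measurable [set w | held s x u' k' (fun j y => eta w j%:R y)].
    exact: (measurable_path_event _ (@local_held F s x u' k')).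
  have sub x u' : [set w | held s x u' k (fun j y => eta w j%:R y)] `<=`
      [set w | held s x u' K (fun j y => eta w j%:R y)].
    by move=> w h j jk; apply: h; lia.
  have := pr_replace (mh 0 u K) (mh n%:Z v K) (mh 0 u k) (mh n%:Z v k) (sub _ _) (sub _ _).
  have e1 k' : pr P [set w | held s 0 u k' (fun j y => eta w j%:R y)] = a k' by [].
  have e2 k' : pr P [set w | held s n%:Z v k' (fun j y => eta w j%:R y)] = a k'.
    exact: held_law.
  rewrite !e1 !e2.
  have -> : pr P ([set w | held s 0 u K (fun j y => eta w j%:R y)] `&`
    [set w | held s n%:Z v K (fun j y => eta w j%:R y)]) =
    p (fun f => held s 0 u K f /\ held s n%:Z v K f) by [].
  have -> : pr P ([set w | held s 0 u k (fun j y => eta w j%:R y)] `&`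
    [set w | held s n%:Z v k (fun j y => eta w j%:R y)]) =
    p (fun f => forall j, (s <= j <= k)%N -> f j 0 = u /\ f j n%:Z = v).
    congr (pr P); apply/seteqP; split=> w /=.
      by move=> [h1 h2] j jk; split; [exact: h1|exact: h2].
    by move=> h; split=> j /h[].
  have := la k; lra.
have h : (fun K => 2 * (a K - l)) @ \oo --> (0 : R).
  rewrite -(mulr0 2); apply: cvgMl_tmp; rewrite -(subrr l); apply: cvgB => //; exact: cvg_cst.
apply: (cvg0_le h) => K; apply: le_trans (_ : a K ^+ 2 <= _); last by have := step K; lra.
by rewrite lerXn2r// nnegrE ?p_ge0.
Qed.

(** * Pairs of particles of the same level *)

Definition level_edge (x : int) (i : 'I_F) (e : int -> opinion F) : bool := e x i != e (x + 1) i.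

Lemma local_edge_dist x k r : local_event k x 2 (fun f : nat -> int -> opinion F => edge_dist (f k) x = r).
Proof. by move=> f g fg <-; rewrite /edge_dist !fg//; lia. Qed.

(** If the edge at [0] is blocked at time [k], then up to time [K] either the opinion at [0] is
    held, whose probability vanishes as [K] grows, or it changes, which is paid for by
    [disagreement]. So the probability is at most the decrease still available after [k]. *)
Lemma blocked_cvg0 x : (fun k => p (fun f => edge_dist (f k) x = F)) @ \oo --> (0 : R).
Proof.
have tF : (theta < F)%N by rewrite FE.
have [l [hl l0 ld]] := disagreement_limit.
have hd : (fun k => disagreement k%:R - l) @ \oo --> (0 : R).
  by rewrite -(subrr l); apply: cvgB => //; exact: cvg_cst.
apply: (cvg0_squeeze (k0 := 0) hd) => k _; rewrite p_ge0 /=.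
have -> : p (fun f => edge_dist (f k) x = F) = p (fun f => edge_dist (f k) 0 = F).
  rewrite -(path_prob_shift x (@local_edge_dist 0 k F)) => [|j _]; last exact: ler0n.
  by rewrite /edge_dist add0r [1 + x]addrC.
rewrite -subr_le0.
have hs : (fun K => \sum_(u : opinion F) p (held k 0 u K)) @ \oo --> (0 : R).
  by apply: cvg0_sum => u; exact: (held_cvg0).
apply: (cvg0_le_near (r0 := k) hs) => K kK.
pose S (f : nat -> int -> opinion F) := edge_dist (f k) 0 = F /\
  exists2 j, (k <= j <= K)%N & f j 0 <> f k 0.
have locS : local_event K 0 2 S.
  move=> f g fg [h [j jk hj]]; split; first by apply: (@local_edge_dist 0 k F f) => // j' x' jk' xr; apply: fg => //; lia.
  by exists j => //; rewrite -!fg//; lia.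
have := blocked_loss tF kK; rewrite -/S.
have : p (fun f => edge_dist (f k) 0 = F) <= p S + \sum_(u : opinion F) p (held k 0 u K).
  have mS := measurable_path_event (fun j => j%:R) locS.
  have mh u := measurable_path_event (fun j => j%:R) (@local_held F k 0 u K).
  apply: le_trans (_ : pr P ([set w | S (fun j x => eta w j%:R x)] `|`
    \big[setU/set0]_(u : opinion F) [set w | held k 0 u K (fun j x => eta w j%:R x)]) <= _).
    apply: pr_le; first exact: (measurable_path_event _ (@local_edge_dist 0 k F)).
      by apply: measurableU => //; exact: bigsetU_measurable.
    move=> w /= hF; have [hj|hj] := pselect (exists2 j, (k <= j <= K)%N & eta w j%:R 0 <> eta w k%:R 0).
      by left.
    right; rewrite -bigcup_seq; exists (eta w k%:R 0); first by rewrite /= mem_index_enum.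
    by move=> j jk; apply: contrapT => h; apply: hj; exists j.
  have mB : measurable (\big[setU/set0]_(u : opinion F)
    [set w | held k 0 u K (fun j x => eta w j%:R x)]) by exact: bigsetU_measurable.
  by apply: le_trans (prU_le P mS mB) _; rewrite lerD2l; exact: pr_bigU_le.
have := ld K; lra.
Qed.

(** The disagreement on the left edge, pushed to the right, annihilates with the other one
    unless it is stopped by a blocked edge. *)
Lemma pair_vanishing (n m x : nat) (i : 'I_F) zeta : (x + m.+2 < n)%N ->
  level_edge x%:Z i zeta -> level_edge (x + m.+1)%N%:Z i zeta ->
  vanishing 0 n (fun _ _ => True) zeta.
Proof.
have locT k : local_event k 0 n (fun _ : nat -> int -> opinion F => True) by [].
(* Three cases: the edge is blocked, which has vanishing probability; level [i] is occupied on the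
   next edge, and the push annihilates; or the particle moves one edge to the right. *)
have step (z : nat) e : (z.+2 < n)%N -> level_edge z%:Z i e ->
    vanishing 0 n (fun _ _ => True) e \/
    e (z%:Z + 1) i = e (z%:Z + 1 + 1) i /\ exists rho : {perm 'I_F},
      let e' := local_step theta false rho (z%:Z + 1) e in
      (forall y, y != z%:Z + 1 -> e' y = e y) /\ e' (z%:Z + 1) i = e z%:Z i.
  move=> zn de; have [dF|dF] := leqP F (edge_dist e z%:Z).
    have {}dF : edge_dist e z%:Z = F by apply/eqP; rewrite eqn_leq dF hamming_leF.
    left; have locQ k : local_event k 0 n (fun f : nat -> int -> opinion F => edge_dist (f k) z%:Z = F).
      by apply: (local_event_widen (@local_edge_dist z%:Z k F) (leqnn k)); lia.
    apply: (vanishing_sub locT (k0 := 0) locQ _ (blocked_cvg0 z%:Z)) => k f _ _ w.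
    by rewrite -[RHS]dF /edge_dist !w// mem_block; lia.
  have dt : (edge_dist e z%:Z <= theta)%N by lia.
  have [rho [zo z1 za _]] := push_right dt de.
  have [h|h] := eqVneq (e (z%:Z + 1) i) (e (z%:Z + 1 + 1) i); first by right; split=> //; exists rho.
  left; apply: (vanishing_annihilation locT (z := z%:Z + 1) (rho := rho)).
  - by rewrite mem_block; lia.
  - by rewrite mem_block; lia.
  - by rewrite mem_block; lia.
  - exact: za.
have xS (z : nat) : z%:Z + 1 = z.+1%:Z by lia.
elim: m x zeta => [|m IHm] x zeta xn dx dy.
  have [||[e _]] := step x zeta _ dx; [lia|by []|].
  by move: dy; rewrite /level_edge addn1 -xS e eqxx.
have [||[e [rho [zo z1]]]] := step x zeta _ dx; [lia|by []|].
apply: (vanishing_pred locT (z := x%:Z + 1) (rho := rho)) => //.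
- by rewrite mem_block; lia.
- by rewrite mem_block; lia.
apply: (IHm x.+1); first by lia.
- rewrite /level_edge -xS z1 zo; last by lia.
  by rewrite -e.
- move: dy; rewrite /level_edge addSnnS !zo//; lia.
Qed.

Lemma pair_cvg0 (x y : nat) (i : 'I_F) : (x < y)%N ->
  (fun k => p (fun f => level_edge x%:Z i (f k) /\ level_edge y%:Z i (f k))) @ \oo --> (0 : R).
Proof.
move=> xy; pose n := y.+2.
have locT k : local_event k 0 n (fun _ : nat -> int -> opinion F => True) by [].
have <- : (fun k => p (fun f => True /\ (level_edge x%:Z i (f k) /\ level_edge y%:Z i (f k)))) =
  (fun k => p (fun f => level_edge x%:Z i (f k) /\ level_edge y%:Z i (f k))).
  apply/funext => k; congr (pr P); apply/seteqP; split=> w /=; tauto.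
apply: (vanishing_cvg locT (Q := fun e => level_edge x%:Z i e /\ level_edge y%:Z i e)).
- by move=> e1 e2 e12; rewrite /level_edge !e12// mem_block /n; lia.
- move=> zeta [dx dy]; apply: (@pair_vanishing n (y - x.+1) x i) => //; first by rewrite /n; lia.
  by rewrite (_ : (x + (y - x.+1).+1)%N = y)//; lia.
Qed.

(** If pairs rarely occur together, [N] events of equal probability leave each of them little more
    than [1 / N]. *)
Lemma bonferroni (A : nat -> set Omega) (N : nat) : (forall x, measurable (A x)) ->
  \sum_(x < N) pr P (A x) <= 1 + \sum_(x < N) \sum_(y < x) pr P (A y `&` A x).
Proof.
move=> mA; pose U n := \big[setU/set0]_(x < n) A x.
have mU n : measurable (U n) by exact: bigsetU_measurable.
apply: le_trans (_ : pr P (U N) + \sum_(x < N) \sum_(y < x) pr P (A y `&` A x) <= _); last first.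
  by rewrite lerD2r; exact: pr_le1.
elim: N => [|n IHn]; first by rewrite !big_ord0 addr0; exact: pr_ge0.
rewrite !big_ord_recr /=.
have h1 : pr P (U n `|` A n) = pr P (U n) + pr P (A n `\` U n).
  rewrite -prU//; first by rewrite setUDr setDv setD0.
    exact: measurableD.
  by apply/seteqP; split=> // w [? []].
have h2 : pr P (A n) = pr P (A n `&` U n) + pr P (A n `\` U n) by exact: prID.
have h3 : pr P (A n `&` U n) <= \sum_(y < n) pr P (A y `&` A n).
  rewrite setIC /U big_distrl /=; apply: pr_bigU_le => y; exact: measurableI.
have -> : U n.+1 = U n `|` A n by rewrite /U big_ord_recr.
by move: IHn; rewrite h1 h2; lra.
Qed.

(** Bonferroni on [N] edges at each of the [F] levels: the pair terms vanish in the limit, which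
    leaves [N * l <= F] for every [N]. *)
Lemma disagreement_cvg0 : (fun k => disagreement k%:R) @ \oo --> (0 : R).
Proof.
have [l [hl l0 ld]] := disagreement_limit.
suff Nl (N : nat) : N%:R * l - F%:R <= 0.
  suff -> : (0 : R) = l by [].
  apply/esym/eqP; rewrite eq_le l0 andbT leNgt; apply/negP => lp.
  have := Nl (Num.bound (F%:R / l)); apply/negP; rewrite -ltNge subr_gt0 -ltr_pdivrMr//.
  by apply: archi_boundP; rewrite divr_ge0// ltW.
pose q k i x y := p (fun f => level_edge (x : nat)%:Z i (f k) /\ level_edge (y : nat)%:Z i (f k)).
have h : (fun k => \sum_i \sum_(y < N) \sum_(x < y) q k i x y) @ \oo --> (0 : R).
  apply: cvg0_sum => i; apply: cvg0_sum => y; apply: cvg0_sum => x; exact: pair_cvg0.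
apply: (cvg0_le h) => k; apply: le_trans (_ : N%:R * disagreement k%:R - F%:R <= _).
  by rewrite lerD2r ler_wpM2l// ld.
have -> : F%:R = \sum_(i < F) 1 :> R by rewrite sumr_const card_ord.
rewrite lerBlDr mulr_sumr -big_split /=.
apply: ler_sum => i _.
pose A (x : nat) : set Omega := [set w | level_edge x%:Z i (eta w k%:R)].
have mA x : measurable (A x).
  have := measurable_path_event (fun=> k%:R) (@local_differ x%:Z i); exact.
have -> : N%:R * path_prob (fun=> k%:R) (differ 0 i) = \sum_(x < N) pr P (A x).
  rewrite (eq_bigr (fun=> path_prob (fun=> k%:R) (differ 0 i))).
    by rewrite sumr_const card_ord mulr_natl.
  by move=> x _; apply: (path_prob_differ x%:Z i); exact: ler0n.
apply: le_trans (bonferroni N mA) _; rewrite addrC lerD2r.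
by [].
Qed.

(** * From vanishing density to agreement of two sites *)

Lemma local_agree_pair x (m : nat) : local_event 0 x m.+1 (fun f : nat -> int -> opinion F => f 0%N x = f 0%N (x + m%:Z)).
Proof. by move=> f g fg; rewrite !fg//; lia. Qed.

Let mpair t x (m : nat) : measurable [set w | eta w t x = eta w t (x + m%:Z)].
Proof. exact: (measurable_path_event (fun=> t) (@local_agree_pair x m)). Qed.

Lemma pr_differ t x (m : nat) : 0 <= t ->
  1 - m%:R * disagreement t <= pr P [set w | eta w t x = eta w t (x + m%:Z)].
Proof.
move=> t0; elim: m => [|m IHm].
  rewrite mul0r subr0 (_ : mkset _ = setT) ?prT//.
  by apply/seteqP; split=> // w _; rewrite /= addr0.
pose D i : set Omega := [set w | eta w t (x + m%:Z) i != eta w t (x + m%:Z + 1) i].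
have mD i : measurable (D i).
  by have := measurable_path_event (fun=> t) (@local_differ (x + m%:Z) i); exact.
have dE : disagreement t = \sum_i pr P (D i).
  apply: eq_bigr => i _; apply/esym.
  exact: (path_prob_differ (x + m%:Z) i t0).
have mB : measurable (\big[setU/set0]_i D i) by exact: bigsetU_measurable.
have : pr P [set w | eta w t x = eta w t (x + m%:Z)] <=
  pr P ([set w | eta w t x = eta w t (x + m.+1%:Z)] `|` \big[setU/set0]_i D i).
  apply: pr_le => //; first exact: measurableU.
  move=> w /= e; have [h|/eqP h] := eqVneq (eta w t x) (eta w t (x + m.+1%:Z)); [by left|right].
  have [i hi] : exists i, eta w t (x + m%:Z) i != eta w t (x + m%:Z + 1) i.
    by apply: neq_coord => e'; apply: h; rewrite e e'; congr (eta w t _); lia.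
  rewrite -bigcup_seq; exists i => //; exact: mem_index_enum.
have := prU_le P (mpair t x m.+1) mB; have := pr_bigU_le P (index_enum _) xpredT mD.
rewrite -dE -natr1 mulrDl mul1r; lra.
Qed.

Lemma agreement_cvg1 x y : P [set w | eta w t x = eta w t y] @[t --> +oo] --> 1%E.
Proof.
have d0 := disagreement_cvg0.
wlog xy : x y / x <= y.
  move=> H; have [xy|/ltW yx] := leP x y; first exact: H.
  rewrite (_ : (fun t => _) = fun t => P [set w | eta w t y = eta w t x]); first exact: H.
  by apply/funext => t; congr (P _); apply/seteqP; split=> w.
have [m ->] : exists m : nat, y = x + m%:Z by exists `|y - x|%N; lia.
have PE t : P [set w | eta w t x = eta w t (x + m%:Z)] =
  (pr P [set w | eta w t x = eta w t (x + m%:Z)])%:E by rewrite -prE.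
under eq_fun do rewrite PE.
apply: cvg_EFin; first by near=> t.
apply/cvgrPdist_lt => e e0.
(* Convergence is known along the integers; monotonicity of [disagreement] extends it to real
   times. *)
have [k _ hk] : \forall k \near \oo, m%:R * disagreement k%:R < e.
  have : (fun k => m%:R * disagreement k%:R) @ \oo --> (0 : R).
    by rewrite -(mulr0 m%:R); exact: cvgMl_tmp.
  by move=> /cvgrPdist_lt /(_ _ e0); apply: filterS => k; rewrite sub0r normrN; exact: le_lt_trans (ler_norm _).
near=> t.
have kt : k%:R <= t by near: t; exact: nbhs_pinfty_ge.
have t0 : 0 <= t by exact: le_trans (ler0n _ _) kt.
rewrite ger0_norm ?subr_ge0 ?pr_le1//.
have := pr_differ x m t0; have := hk k (leqnn _).
have : m%:R * disagreement t <= m%:R * disagreement k%:R.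
  rewrite ler_wpM2l//; apply: (disagreement_nonincreasing).
  by rewrite ler0n.
rewrite /=; lra.
Unshelve. all: by end_near. Qed.

End Clustering.

Theorem theorem1 (F theta : nat) (htheta : (1 <= theta)%N) (hF2 : (2 <= F)%N)
  (hF : F = theta.+1)
  (R : realType) (d : measure_display) (Omega : measurableType d)
  (P : probability Omega R)
  (eta0 : int -> Omega -> opinion F) (tau : int -> nat -> Omega -> R)
  (dir : int -> nat -> Omega -> bool) (rk : int -> nat -> Omega -> {perm 'I_F})
  (eta : Omega -> R -> int -> opinion F) :
  graphical_marks eta0 tau dir rk P ->
  {ae P, forall w, deffuant_path eta0 tau dir rk theta w (eta w)} ->
  (forall t x u, measurable [set w | eta w t x = u]) ->
  forall x y : int,
    P [set w | eta w t x = eta w t y] @[t --> +oo] --> 1%E.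
Proof.
move=> marks paths meta x y.
have [mu [mu_law muE]] := mark_law_exists marks.
have mX := measurable_marks_of marks.
have eta_path : {ae P, forall w, path_of theta (marks_of eta0 tau dir rk w) (eta w)}.
  apply: filterS paths => w [h0 h1 h2]; split.
  - by move=> z; rewrite h0 /ini /= encode_finK.
  - by move=> z n t /h1.
  - move=> z n m; rewrite /dirn /rank /= !encode_finK => h; exact: h2.
exact: (agreement_cvg1 mX muE mu_law eta_path meta hF2 hF).
Qed.
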